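(* Let $M$ be a compact (possibly disconnected) one-manifold and let $\Gamma$ be a finite simplicial graph. Suppose that there is an injective homomorphism from the right-angled Artin group $A(\Gamma)$ into $\mathrm{Diff}_+^{1+\mathrm{bv}}(M)$. Then $\Gamma$ is $P_4$-free, i.e. no induced subgraph of $\Gamma$ is isomorphic to the path $P_4$ on four vertices.
   Context: $\mathrm{Diff}_+^{1+\mathrm{bv}}(M)$ denotes the group (under composition) of orientation-preserving $C^1$ diffeomorphisms $f$ of $M$ whose first derivative $f'$ has bounded total variation on $M$. For a finite simplicial graph $\Gamma$ with vertex set $V(\Gamma)$ and edge set $E(\Gamma)$, the right-angled Artin group $A(\Gamma)$ is the group generated by $V(\Gamma)$ with defining relations $[v_i,v_j]=1$ for each edge $\{v_i,v_j\}\in E(\Gamma)$ (and no others). A subgraph $\Lambda$ of $\Gamma$ is induced if any two vertices of $\Lambda$ that span an edge of $\Gamma$ also span an edge of $\Lambda$. *)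

(* Defs.v *)
From HB Require Import structures.
From mathcomp Require Import all_boot all_order all_algebra generic_quotient.
From mathcomp Require Import all_classical all_reals all_analysis.
Set Implicit Arguments.
Unset Strict Implicit.
Unset Printing Implicit Defensive.
Import Order.TTheory GRing.Theory Num.Theory numFieldNormedType.Exports.

Local Open Scope classical_set_scope.
Local Open Scope ring_scope.
Local Open Scope quotient_scope.

Definition simple_graph (V : finType) (e : rel V) : Prop :=
  symmetric e /\ irreflexive e.

Definition graph_iso (V W : finType) (e : rel V) (d : rel W) : Prop :=
  exists2 f : V -> W, bijective f & forall x y, d (f x) (f y) = e x y.

Definition induced (V : finType) (e : rel V) (A : {set V}) :
    rel {x : V | x \in A} :=
  fun x y => e (val x) (val y).
Arguments induced {V} e A _ _.

Definition path_graph (n : nat) : rel 'I_n :=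
  fun i j => (i.+1 == j :> nat) || (j.+1 == i :> nat).
Arguments path_graph n _ _ : clear implicits.

Definition P4_free (V : finType) (e : rel V) : Prop :=
  forall A : {set V}, ~ graph_iso (induced e A) (path_graph 4).

(* The letter (x, false) stands for the generator x, (x, true) for x^-1. *)
Definition raag_word (V : finType) : Type := seq (V * bool).

(* The congruence on words generated by the cancellations and the defining
   relations, so that the quotient is the group < V | [x, y], x -- y >. *)
Inductive raag_eq (V : finType) (e : rel V) : raag_word V -> raag_word V -> Prop :=
| raag_eq_refl u : raag_eq e u u
| raag_eq_sym u v : raag_eq e u v -> raag_eq e v u
| raag_eq_trans u v w : raag_eq e u v -> raag_eq e v w -> raag_eq e u w
| raag_eq_cat u u' v v' :
    raag_eq e u u' -> raag_eq e v v' -> raag_eq e (u ++ v) (u' ++ v')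
| raag_eq_cancel x b : raag_eq e [:: (x, b); (x, ~~ b)] [::]
| raag_eq_comm x y : e x y ->
    raag_eq e [:: (x, true); (y, true); (x, false); (y, false)] [::].

Section Raag.
Variables (V : finType) (e : rel V).

Definition raag_eqb : rel (raag_word V) := fun u v => `[< raag_eq e u v >].

Lemma raag_eqb_refl : reflexive raag_eqb.
Proof. by move=> u; apply/asboolP; exact: raag_eq_refl. Qed.

Lemma raag_eqb_sym : symmetric raag_eqb.
Proof. by move=> u v; apply/asboolP/asboolP; exact: raag_eq_sym. Qed.

Lemma raag_eqb_trans : transitive raag_eqb.
Proof.
move=> v u w /asboolP uv /asboolP vw.
by apply/asboolP; exact: raag_eq_trans uv vw.
Qed.

Canonical raag_equiv :=
  EquivRel raag_eqb raag_eqb_refl raag_eqb_sym raag_eqb_trans.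

Definition raag : Type := {eq_quot raag_equiv}.

HB.instance Definition _ : EqQuotient _ raag_equiv raag := EqQuotient.on raag.
HB.instance Definition _ := Choice.on raag.

Lemma raag_piP (u v : raag_word V) :
  \pi_raag u = \pi_raag v <-> raag_eq e u v.
Proof. by split=> [/eqmodP/asboolP//|uv]; apply/eqmodP/asboolP. Qed.

Definition raag_winv (u : raag_word V) : raag_word V :=
  rev [seq (a.1, ~~ a.2) | a <- u].

Definition raag_one : raag := \pi_raag ([::] : raag_word V).
Definition raag_mul (g h : raag) : raag := \pi_raag (repr g ++ repr h : raag_word V).
Definition raag_inv (g : raag) : raag := \pi_raag (raag_winv (repr g)).

Definition raag_gen (x : V) : raag := \pi_raag ([:: (x, false)] : raag_word V).

Lemma raag_repr_pi (u : raag_word V) : raag_eq e (repr (\pi_raag u)) u.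
Proof. by apply/raag_piP; rewrite reprK. Qed.

Lemma raag_mulE (u v : raag_word V) :
  raag_mul (\pi_raag u) (\pi_raag v) = \pi_raag (u ++ v : raag_word V).
Proof. by apply/raag_piP; apply: raag_eq_cat; exact: raag_repr_pi. Qed.

Lemma raag_winvK : involutive raag_winv.
Proof.
move=> u; rewrite /raag_winv map_rev revK -map_comp -[RHS]map_id.
by apply: eq_map => -[x b] /=; rewrite negbK.
Qed.

Lemma raag_mulwV (u : raag_word V) : raag_eq e (u ++ raag_winv u) [::].
Proof.
elim: u => [|[x b] u IH]; first exact: raag_eq_refl.
have -> : ((x, b) :: u) ++ raag_winv ((x, b) :: u) =
    [:: (x, b)] ++ ((u ++ raag_winv u) ++ [:: (x, ~~ b)]).
  by rewrite /raag_winv /= rev_cons -cats1 -catA.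
apply: raag_eq_trans (raag_eq_cancel e x b).
have -> : [:: (x, b); (x, ~~ b)] = [:: (x, b)] ++ ([::] ++ [:: (x, ~~ b)]) by [].
apply: raag_eq_cat; first exact: raag_eq_refl.
by apply: raag_eq_cat => //; exact: raag_eq_refl.
Qed.

Lemma raag_mulA : associative raag_mul.
Proof.
move=> f g h; rewrite -[f]reprK -[g]reprK -[h]reprK.
move: (repr f) (repr g) (repr h) => u v w.
rewrite (raag_mulE v w) (raag_mulE u v).
by rewrite (raag_mulE u (v ++ w)) (raag_mulE (u ++ v)) catA.
Qed.

Lemma raag_mul1g : left_id raag_one raag_mul.
Proof. by move=> g; rewrite -[g]reprK raag_mulE. Qed.

Lemma raag_mulg1 : right_id raag_one raag_mul.
Proof. by move=> g; rewrite -[g]reprK raag_mulE cats0. Qed.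

Lemma raag_mulgV : right_inverse raag_one raag_inv raag_mul.
Proof.
move=> g; rewrite -{1}[g]reprK raag_mulE; apply/raag_piP; exact: raag_mulwV.
Qed.

Lemma raag_mulVg : left_inverse raag_one raag_inv raag_mul.
Proof.
move=> g; rewrite -{2}[g]reprK raag_mulE; apply/raag_piP.
by rewrite -{2}[repr g]raag_winvK; exact: raag_mulwV.
Qed.

HB.instance Definition _ := isGroup.Build raag
  raag_mulA raag_mul1g raag_mulg1 raag_mulVg raag_mulgV.

End Raag.

Section Calculus.
Variable R : realType.
Implicit Types (A : set R) (h : R -> R).

Definition diff_quot h (x y : R) : R := (h y - h x) / (y - x).

(* Derivatives relative to A: one-sided at an endpoint of an interval. *)
Definition derivable_in A h (x : R) : Prop :=
  cvg (diff_quot h x @ within A x^').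

Definition deriv_in A h (x : R) : R :=
  lim (diff_quot h x @ within A x^').

Definition C1_on A h : Prop :=
  (forall x, A x -> derivable_in A h x) /\ {within A, continuous (deriv_in A h)}.

Definition increasing_on A h : Prop := forall x, A x -> 0 < deriv_in A h x.

Definition deriv_BV_on A h : Prop :=
  forall a b, a <= b -> `[a, b] `<=` A -> bounded_variation a b (deriv_in A h).

(* h is, near each point of A, the restriction to A of a smooth function on the
   line with positive derivative at that point. *)
Definition smooth_increasing_on A h : Prop :=
  forall x, A x -> exists g : R -> R,
    [/\ forall (n : nat) (y : R), derivable (derive1n n g) y 1,
        0 < derive1 g x
      & \forall y \near within A (nbhs x), h y = g y].

End Calculus.

Section Manifolds.
Variables (R : realType) (M : topologicalType).

(* A chart is a homeomorphism from an open set onto a nondegenerate interval,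
   which may contain endpoints: those are the boundary points of M. *)
Record chart := Chart {
  chart_dom : set M;
  chart_fun : M -> R;
  chart_inv : R -> M;
  chart_dom_open : open chart_dom;
  chart_funK : forall p, chart_dom p -> chart_inv (chart_fun p) = p;
  chart_fun_continuous : {within chart_dom, continuous chart_fun};
  chart_inv_continuous : {within chart_fun @` chart_dom, continuous chart_inv};
  chart_interval : is_interval (chart_fun @` chart_dom);
  chart_nondegenerate :
    exists p q, [/\ chart_dom p, chart_dom q & chart_fun p < chart_fun q] }.

(* The expression of f in the charts c and d, and the set where it makes sense. *)
Definition local_expr (c d : chart) (f : M -> M) : R -> R :=
  chart_fun d \o f \o chart_inv c.

Definition local_dom (c d : chart) (f : M -> M) : set R :=
  chart_fun c @` (chart_dom c `&` f @^-1` chart_dom d).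

(* Smooth one-manifolds, possibly with boundary and possibly disconnected,
   oriented by an atlas whose coordinate changes are increasing. *)
Record one_manifold := OneManifold {
  atlas : set chart;
  mfd_hausdorff : hausdorff_space M;
  mfd_second_countable : @second_countable M;
  atlas_cover : forall p, exists2 c, atlas c & chart_dom c p;
  atlas_compat : forall c d, atlas c -> atlas d ->
    smooth_increasing_on (local_dom c d id) (local_expr c d id) }.

Variable X : one_manifold.

Definition locally_in_charts (P : set R -> (R -> R) -> Prop) (f : M -> M) : Prop :=
  forall c d, atlas X c -> atlas X d -> P (local_dom c d f) (local_expr c d f).

Definition C1_map (f : M -> M) : Prop :=
  continuous f /\ locally_in_charts (@C1_on R) f.

Definition C1_diffeo (f : M -> M) : Prop :=
  C1_map f /\ exists g : M -> M, [/\ cancel f g, cancel g f & C1_map g].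

Definition orientation_preserving (f : M -> M) : Prop :=
  locally_in_charts (@increasing_on R) f.

(* On a compact M, the derivative has bounded total variation on M if and only
   if its expression in charts has bounded variation on compact intervals; this
   form needs no choice of a metric on M. *)
Definition deriv_BV (f : M -> M) : Prop :=
  locally_in_charts (@deriv_BV_on R) f.

Definition Diff_1bv : set (M -> M) :=
  [set f | [/\ C1_diffeo f, orientation_preserving f & deriv_BV f]].

End Manifolds.

(* Injective homomorphisms from G to the group Diff_+^{1+bv}(M), whose law is
   composition. *)
Definition embeds_in_Diff_1bv (G : groupType) (R : realType)
    (M : topologicalType) (X : one_manifold R M) : Prop :=
  exists phi : G -> M -> M,
    [/\ forall g, Diff_1bv X (phi g),
        forall g h, phi (g * h)%g = phi g \o phi h
      & injective phi].

(* Main.v *)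
(** Let a - b - c - d be an induced P_4 and, for m > 0, put u = b^m,
    v = [a^m, c^m] and t = d^m. Letting the group act on copies of a finite set
    indexed by the integers shows that a word w with w(u, v, t) = 1 satisfies
    w(x, x, s) = 1 in A_5, where x is a 3-cycle and s an involution such that x
    and s x s^-1 generate A_5.

    In a group of C^{1+bv} diffeomorphisms, however, there is a word with
    w(u, v, t) = 1 and w(x, x, s) <> 1. Choose m such that the m-th powers
    preserve every component and lift to homeomorphisms of the line, commuting
    with the unit translation, that have a fixed point or induce no periodic
    point. Since b commutes with a and c, Kopell's lemma and Hölder's theorem
    show that on each component v is trivial or has support disjoint from that
    of u. In the latter case the two-jumps lemma of Kim and Koberda makes a
    certain commutator theta of conjugates of u and v trivial near every common
    fixed point of u, v and a suitable conjugate of t; what remains of its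
    support is compact in the gaps between these points, where it can be pushed
    off itself. A_5 being simple and nonabelian, any two nontrivial elements
    have conjugates that do not commute, so words that are trivial on two
    invariant sets combine, by a commutator, into one that is trivial on their
    union. *)

Require Import Defs.
From HB Require Import structures.
From mathcomp Require Import all_boot all_order all_algebra all_fingroup all_solvable.
From mathcomp Require Import all_classical all_reals all_analysis.
From mathcomp Require Import zify ring lra.
Set Implicit Arguments.
Unset Strict Implicit.
Unset Printing Implicit Defensive.
Import Order.TTheory GRing.Theory Num.Theory numFieldNormedType.Exports.

(** * Words and the alternating group A5 *)

Local Open Scope group_scope.

(** The obstacle is that no single word works everywhere: which words become trivial depends on the
    component and on the gap, and m is known only once the action is given. A_5 is a target that
    exists for every m and in which words that vanish on different sets can be merged. Sending both
    u and v to x makes two choices harmless. Where u or v is trivial, the word u or v itself serves,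
    as x is not 1. If t moves a common fixed point p of u and v, then one of tut^-1 and tvt^-1 fixes
    p, because u or v fixes t^-1 p; both conjugates go to the same y = sxs^-1. Finiteness makes
    pushing possible: each word has a power in the kernel of the map to A_5, so the kernel fixes no
    point that some word moves, and a push by a kernel word leaves the image in A_5 unchanged.

    Derivatives of lifts are never computed. Regularity is expressed by slopes of chords, through
    strict derivatives for the two-jumps lemma and bounded ratios of slopes for Kopell's lemma; both
    pass through composition, division by a chart and gluing. *)

Inductive word := WU | WV | WT | W1 | WM of word & word | WI of word.

Fixpoint ev (G : groupType) (u v t : G) (w : word) : G :=
  match w with
  | WU => u | WV => v | WT => t | W1 => 1
  | WM w1 w2 => ev u v t w1 * ev u v t w2
  | WI w1 => (ev u v t w1)^-1
  end.

Definition wconj (w1 w2 : word) : word := WM (WM w1 w2) (WI w1).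
Definition wcomm (w1 w2 : word) : word := WM (WM w1 w2) (WM (WI w1) (WI w2)).

Fixpoint wsubst (s w : word) : word :=
  match w with
  | WU => WU | WV => WV | WT => s | W1 => W1
  | WM w1 w2 => WM (wsubst s w1) (wsubst s w2)
  | WI w1 => WI (wsubst s w1)
  end.

Fixpoint wpow (w : word) (n : nat) : word :=
  if n is n'.+1 then WM w (wpow w n') else W1.

Lemma ev_wsubst (G : groupType) (u v t : G) s w :
  ev u v t (wsubst s w) = ev u v (ev u v t s) w.
Proof. by elim: w => //= [w1 -> w2 ->|w1 ->]. Qed.

Lemma ev_wpow (G : groupType) (u v t : G) w n :
  ev u v t (wpow w n) = ev u v t w ^+ n.
Proof. by elim: n => [|n IH]; rewrite ?expg0 // expgS /= IH. Qed.

Notation A5 := 'Alt_('I_5).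
Definition i0 : 'I_5 := @Ordinal 5 0 isT.
Definition i1 : 'I_5 := @Ordinal 5 1 isT.
Definition i2 : 'I_5 := @Ordinal 5 2 isT.
Definition i3 : 'I_5 := @Ordinal 5 3 isT.
Definition i4 : 'I_5 := @Ordinal 5 4 isT.

(* sx and sy = st sx st^-1 generate A5. *)
Definition sx : {perm 'I_5} := tperm i0 i1 * tperm i0 i2.
Definition st : {perm 'I_5} := tperm i0 i4 * tperm i1 i3.
Definition sy : {perm 'I_5} := st * sx * st^-1.
(** [rho] is for words in u, v and t, [rhoy] for words in which t stands for one of the conjugates
    tut^-1 and tvt^-1; [rho] sends both of these to [sy]. *)
Definition rho (w : word) : {perm 'I_5} := ev sx sx st w.
Definition rhoy (w : word) : {perm 'I_5} := ev sx sx sy w.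

(** Lists of images reduce where products of permutations do not, so the computations in A_5 are
    checked by conversion on such lists. *)
Definition lperm (s : seq 'I_5) (p : {perm 'I_5}) :=
  forall i, p i = nth i0 s i.

Lemma lpermM s t p q :
  lperm s p -> lperm t q -> lperm [seq nth i0 t (nth i0 s (val i)) | i <- [:: i0; i1; i2; i3; i4]] (p * q).
Proof. by move=> sp tq i; rewrite permM sp tq; case: i => -[|[|[|[|[|]]]]]. Qed.

Lemma lpermP s p q : lperm s p -> lperm s q -> p = q.
Proof. by move=> sp sq; apply/permP => i; rewrite sp sq. Qed.

Lemma lperm1 : lperm [:: i0; i1; i2; i3; i4] 1.
Proof. by move=> -[[|[|[|[|[|]]]]] //= ?]; rewrite perm1; apply: val_inj. Qed.

Lemma lpermV s t p : lperm s p ->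
  [seq nth i0 t (nth i0 s (val i)) | i <- [:: i0; i1; i2; i3; i4]] = [:: i0; i1; i2; i3; i4] ->
  lperm t p^-1.
Proof.
move=> sp st1 i; rewrite -{2}(permKV p i) sp.
move: (p^-1 i) => {i} j.
have H (k : 'I_5) : nth i0 [seq nth i0 t (nth i0 s (val i)) | i <- [:: i0; i1; i2; i3; i4]] k = k.
  by rewrite st1; case: k => -[|[|[|[|[|]]]]] //= ?; apply: val_inj.
by rewrite -{1}(H j); case: j => -[|[|[|[|[|]]]]].
Qed.

Lemma lperm_sx : lperm [:: i1; i2; i0; i3; i4] sx.
Proof. by case=> -[|[|[|[|[|]]]]] //= ?; rewrite permM !permE /=; apply: val_inj. Qed.

Lemma lperm_st : lperm [:: i4; i3; i2; i1; i0] st.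
Proof. by case=> -[|[|[|[|[|]]]]] //= ?; rewrite permM !permE /=; apply: val_inj. Qed.

Lemma lperm_sy : lperm [:: i0; i1; i4; i2; i3] sy.
Proof.
by apply: (lpermM (lpermM lperm_st lperm_sx)
  (lpermV (t := [:: i4; i3; i2; i1; i0]) lperm_st _)).
Qed.

Lemma perm5_neq1 s (p : {perm 'I_5}) : lperm s p -> s != [:: i0; i1; i2; i3; i4] -> size s = 5 -> p != 1.
Proof.
move=> sp s_id s5; apply: contraNneq s_id => p1; apply/eqP.
apply: (@eq_from_nth _ i0) => // i; rewrite s5 => i5.
by rewrite -(sp (Ordinal i5)) p1 (lperm1 (Ordinal i5)).
Qed.

Lemma sx_Alt : sx \in A5.
Proof. by rewrite Alt_even !odd_permM !odd_tperm. Qed.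

Lemma st_Alt : st \in A5.
Proof. by rewrite Alt_even !odd_permM !odd_tperm. Qed.

Lemma sy_Alt : sy \in A5.
Proof. by rewrite /sy 2?groupM ?groupV ?sx_Alt ?st_Alt. Qed.

Lemma lperm_sxy : lperm [:: i1; i4; i0; i2; i3] (sx * sy).
Proof. exact: (lpermM lperm_sx lperm_sy). Qed.


(** With c = tut^-1 and d = tvt^-1 this is [[v, cuc^-1], d]. Near a common fixed point the inner
    commutator fixes the points moved by d, which makes the outer one trivial there; in A_5 the word
    becomes the double transposition (0 1)(2 3). *)
Definition theta_word : word :=
  let c := wconj WT WU in let d := wconj WT WV in
  wcomm (wcomm WV (wconj c WU)) d.

Lemma lperm_theta : lperm [:: i1; i0; i3; i2; i4] (rhoy theta_word).
Proof.
have X := lperm_sx; have Y := lperm_sy.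
have X' : lperm [:: i2; i0; i1; i3; i4] sx^-1 by exact: (lpermV X).
have Y' : lperm [:: i0; i1; i3; i4; i2] sy^-1 by exact: (lpermV Y).
have Z : lperm [:: i1; i3; i2; i0; i4] (sy * sx * sy^-1).
  exact: (lpermM (lpermM Y X) Y').
have Z' : lperm [:: i3; i0; i2; i1; i4] (sy * sx * sy^-1)^-1 by exact: (lpermV Z).
move: Z Z'; rewrite /rhoy /theta_word /=; set z := sy * sx * sy^-1 => Z Z'.
have W : lperm [:: i2; i1; i3; i0; i4] (z * sx * z^-1).
  exact: (lpermM (lpermM Z X) Z').
have W' : lperm [:: i3; i1; i0; i2; i4] (z * sx * z^-1)^-1 by exact: (lpermV W).
move: W W'; set w := z * sx * z^-1 => W W'.
have P : lperm [:: i3; i2; i1; i0; i4] (sx * w * (sx^-1 * w^-1)).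
  exact: (lpermM (lpermM X W) (lpermM X' W')).
have P' : lperm [:: i3; i2; i1; i0; i4] (sx * w * (sx^-1 * w^-1))^-1.
  exact: (lpermV P).
exact: (lpermM (lpermM P Z) (lpermM P' Z')).
Qed.

Lemma rhoy_theta_neq1 : rhoy theta_word != 1.
Proof. by apply: (perm5_neq1 lperm_theta). Qed.

Lemma rhoyE w : rhoy w = rho (wsubst (wconj WT WU) w).
Proof. by rewrite /rho ev_wsubst. Qed.

Lemma rhoy_mem w : rhoy w \in <<[set sx; sy]>>.
Proof.
have xG : sx \in <<[set sx; sy]>> by rewrite mem_gen // set21.
have yG : sy \in <<[set sx; sy]>> by rewrite mem_gen // set22.
by rewrite /rhoy; elim: w => //= [w1 h1 w2 h2|w1 h1]; rewrite ?groupM ?groupV.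
Qed.

Lemma rho_Alt w : rho w \in A5.
Proof.
have xA := sx_Alt; have tA := st_Alt.
by rewrite /rho; elim: w => //= [w1 h1 w2 h2|w1 h1]; rewrite ?groupM ?groupV.
Qed.

Lemma order_lperm3 s p : lperm s p -> 
  [seq nth i0 s (nth i0 [seq nth i0 s (nth i0 s (val i)) | i <- [:: i0; i1; i2; i3; i4]] (val i))
     | i <- [:: i0; i1; i2; i3; i4]] = [:: i0; i1; i2; i3; i4] ->
  s != [:: i0; i1; i2; i3; i4] -> size s = 5 -> #[p] = 3.
Proof.
move=> sp s3 s1 s5; apply: nt_prime_order => //; last by apply: (perm5_neq1 sp).
rewrite !expgS expg0 mulg1 mulgA; apply: (@lpermP [:: i0; i1; i2; i3; i4]) lperm1.
by have := lpermM (lpermM sp sp) sp; rewrite s3.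
Qed.

(** The subgroup has elements of orders 3, 5 and 2, the last being [rhoy theta_word], so 30 divides
    its order and its index in A_5 is 1 or 2. Index 2 would make it normal in a simple group. *)
Lemma gen_sxy : <<[set sx; sy]>> = A5.
Proof.
have X := lperm_sx; have Y := lperm_sy; have P := lperm_sxy.
pose G := <<[set sx; sy]>>%G; rewrite -[LHS]/(gval G).
have GA : G \subset A5.
  rewrite gen_subG; apply/fintype.subsetP => p.
  by case/set2P => ->; [exact: sx_Alt|exact: sy_Alt].
have xG : sx \in G by rewrite mem_gen // !inE eqxx.
have yG : sy \in G by rewrite mem_gen // !inE eqxx orbT.
have o3 : 3 %| #|G| by have := order_dvdG xG; rewrite (order_lperm3 X).
have o5 : 5 %| #|G|.
  suff E : #[sx * sy] = 5 by have := order_dvdG (groupM xG yG); rewrite E.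
  apply: nt_prime_order => //; last by apply: (perm5_neq1 P).
  rewrite !expgS expg0 mulg1; apply: (@lpermP [:: i0; i1; i2; i3; i4]) lperm1.
  exact: (lpermM P (lpermM P (lpermM P (lpermM P P)))).
have o2 : 2 %| #|G|.
  suff E : #[rhoy theta_word] = 2.
    by have := order_dvdG (rhoy_mem theta_word : _ \in G); rewrite E.
  apply: nt_prime_order => //; last exact: rhoy_theta_neq1.
  rewrite expgS expg1; apply: (@lpermP [:: i0; i1; i2; i3; i4]) lperm1.
  exact: (lpermM lperm_theta lperm_theta).
have cA : #|A5| = 60.
  have : 1 < #|'I_5| by rewrite card_ord.
  by move=> /card_Alt; rewrite card_ord -[5`!]/(2 * 60)%N => /eqP; rewrite eqn_mul2l => /eqP.
have iGA := Lagrange GA.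
have o30 : 30 %| #|G| by rewrite (@Gauss_dvd 6 5) // (@Gauss_dvd 2 3) // o2 o3.
have sA : simple A5 by apply: simple_Alt5; rewrite card_ord.
have /orP[/eqP i1|/eqP i2] : (#|A5 : G| == 1%N) || (#|A5 : G| == 2).
  move: iGA; rewrite cA; case/dvdnP: o30 => k ->.
  have := indexg_gt0 A5 G; case: #|A5 : G| => [|[|[|n]]] //.
  case: k => // k; rewrite !mulSn; lia.
- by apply/eqP; rewrite finset.eqEsubset GA -indexg_eq1 i1.
- have nG := index2_normal GA i2.
  case/simpleP: sA => _ /(_ _ nG)[G1|->//].
  by move: o3; rewrite G1 cards1.
Qed.

(* A5 is simple and nonabelian, so only the identity centralizes a conjugacy class. *)
Lemma alt5_conj_noncomm (p q : {perm 'I_5}) : p \in A5 -> q \in A5 -> p != 1 -> q != 1 ->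
  exists2 f, f \in A5 & p * (f * q * f^-1) * (p^-1 * (f * q * f^-1)^-1) != 1.
Proof.
move=> pA qA p1 q1; have sA : simple A5 by apply: simple_Alt5; rewrite card_ord.

have H0 f : p * (f * q * f^-1) * (p^-1 * (f * q * f^-1)^-1) == 1 -> commute p (q ^ f^-1).
  rewrite conjgE invgK [X in commute _ X]mulgA; set c := f * q * f^-1; rewrite /commute -invMg => /eqP E.
  by apply: (mulIg (c * p)^-1); rewrite E mulgV.
apply/not_exists2P => H.
have {H0}H f : f \in A5 -> commute p (q ^ f).
  move=> fA; have := H f^-1; rewrite groupV fA => -[//|/negP/negPn/H0].
  by rewrite invgK.
case/simpleP: sA => _ sA.
have nA (G : {group {perm 'I_5}}) r : r \in G -> r != 1 -> normal G A5 -> G = 'Alt_('I_5)%G.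
  move=> rG r1 /sA[G1|E]; last exact/val_inj.
  by move: rG r1; rewrite G1 inE => ->.
have EN : <<q ^: A5>>%G = 'Alt_('I_5)%G.
  apply: (nA _ q) => //; first by rewrite mem_gen // class_refl.
  rewrite /normal norms_gen ?class_norm // andbT gen_subG.
  by apply/fintype.subsetP => _ /imsetP[f fA ->]; rewrite groupJ.
have EN' : <<q ^: A5>> = A5 := congr1 (@gval _) EN.
have pC : p \in 'C(<<q ^: A5>>).
  by rewrite cent_gen; apply/centP => _ /imsetP[f fA ->]; exact: H.
have pZ : p \in 'Z(A5).
  by apply/centerP; split=> // r rA; apply: (centP pC); rewrite EN'.
have Zall := nA _ _ pZ p1 (center_normal _).
have : sx * sy = sy * sx.
  have /centerP[_] : sx \in 'Z(A5) by move/(congr1 (@gval _)): Zall => /= ->; exact: sx_Alt.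
  by apply; exact: sy_Alt.
move=> E; have := lpermM lperm_sy lperm_sx i1; rewrite -E lperm_sxy.
by move=> /(congr1 val).
Qed.

Lemma rhoy_surj f : f \in A5 -> exists w, rhoy w = f.
Proof.
rewrite -gen_sxy => /gen_prodgP[n [c cS ->]].
elim: n c cS => [|n IH] c cS; first by exists W1; rewrite big_ord0.
have [w ww] := IH _ (fun i => cS (widen_ord (leqnSn n) i)).
have [w' ww'] : exists w', rhoy w' = c ord_max.
  by have := cS ord_max; rewrite !inE => /orP[]/eqP->; [exists WU|exists WT].
by exists (WM w w'); rewrite big_ord_recr /= -ww -ww'.
Qed.

Lemma rho_surj f : f \in A5 -> exists w, rho w = f.
Proof. by move=> /rhoy_surj[w <-]; exists (wsubst (wconj WT WU) w); rewrite -rhoyE. Qed.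

(** * Words in right-angled Artin groups *)

(** The inverse is carried as data. Products apply the right factor first, whereas products of
    permutations apply the left one first; hence the inverses of permutations in the action
    below. *)
Record bijn (T : Type) := Bijn {
  bf :> T -> T; bg : T -> T; bfK : cancel bf bg; bgK : cancel bg bf }.

Lemma bijnP T (f g : bijn T) : f =1 g -> f = g.
Proof.
case: f g => f f' fK f'K [g g' gK g'K] /= /funext E; subst g.
have E : f' = g' by apply/funext => x; rewrite -{1}(g'K x) fK.
by subst g'; congr Bijn; exact: Prop_irrelevance.
Qed.

HB.instance Definition _ T := gen_eqMixin (bijn T).
HB.instance Definition _ T := gen_choiceMixin (bijn T).

Section BijnGroup.
Variable T : Type.
Implicit Types f g h : bijn T.

Definition bijn_mul f g : bijn T :=
  Bijn (can_comp (@bfK _ f) (@bfK _ g)) (can_comp (@bgK _ g) (@bgK _ f)).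
Definition bijn_one : bijn T := @Bijn T id id (fun=> erefl) (fun=> erefl).
Definition bijn_inv f : bijn T := Bijn (@bgK _ f) (@bfK _ f).

Lemma bijn_mulA : associative bijn_mul. Proof. by move=> f g h; exact: bijnP. Qed.
Lemma bijn_mul1g : left_id bijn_one bijn_mul. Proof. by move=> f; exact: bijnP. Qed.
Lemma bijn_mulg1 : right_id bijn_one bijn_mul. Proof. by move=> f; exact: bijnP. Qed.
Lemma bijn_mulVg : left_inverse bijn_one bijn_inv bijn_mul.
Proof. by move=> f; apply: bijnP => x /=; rewrite bfK. Qed.
Lemma bijn_mulgV : right_inverse bijn_one bijn_inv bijn_mul.
Proof. by move=> f; apply: bijnP => x /=; rewrite bgK. Qed.

HB.instance Definition _ := isGroup.Build (bijn T)
  bijn_mulA bijn_mul1g bijn_mulg1 bijn_mulVg bijn_mulgV.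

Lemma bijnM f g x : (f * g) x = f (g x). Proof. by []. Qed.
Lemma bijnX f n x : (f ^+ n) x = iter n f x.
Proof. by elim: n => // n IH; rewrite expgS bijnM IH. Qed.
End BijnGroup.

Section Morphism.
Variables (G H : groupType) (f : G -> H).
Hypothesis fM : forall x y, f (x * y) = f x * f y.

Lemma gmorph1 : f 1 = 1.
Proof. by apply: (mulgI (f 1)); rewrite -fM !mulg1. Qed.

Lemma gmorphV x : f x^-1 = (f x)^-1.
Proof. by apply: (mulgI (f x)); rewrite -fM !mulgV gmorph1. Qed.

Lemma gmorphX x n : f (x ^+ n) = f x ^+ n.
Proof. by elim: n => [|n IH]; rewrite ?gmorph1 // !expgS fM IH. Qed.

Lemma ev_morph u v t w : f (ev u v t w) = ev (f u) (f v) (f t) w.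
Proof.
by elim: w => //= [|w1 <- w2 <-|w1 <-]; rewrite ?gmorph1 ?fM ?gmorphV.
Qed.
End Morphism.

Section RaagAction.
Variables (V : finType) (e : rel V) (T : Type) (s : V -> bijn T).
Hypothesis s_comm : forall x y, e x y -> s x * s y = s y * s x.

Definition raag_letter (l : V * bool) : bijn T := if l.2 then (s l.1)^-1 else s l.1.
Definition raag_act_word (u : raag_word V) : bijn T :=
  foldr (fun l f => raag_letter l * f) 1 u.

Lemma raag_act_cat u v : raag_act_word (u ++ v) = raag_act_word u * raag_act_word v.
Proof. by elim: u => [|l u IH] /=; rewrite ?mul1g // IH mulgA. Qed.

Lemma raag_act_wordP u v : raag_eq e u v -> raag_act_word u = raag_act_word v.
Proof.
elim=> //= [{}u {}v w _ -> _ ->//|u1 u2 v1 v2 _ IHu _ IHv|x b|x y /s_comm E].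
- by rewrite !raag_act_cat IHu IHv.
- by case: b; rewrite /raag_letter /= mulg1 ?mulgV ?mulVg.
- rewrite /raag_letter /= mulg1 E mulgA mulgA -mulgA -E -invMg -E.
  by rewrite E mulVg.
Qed.

Definition raag_act (g : raag e) : bijn T := raag_act_word (generic_quotient.repr g).

Lemma raag_actM g h : raag_act (g * h) = raag_act g * raag_act h.
Proof. by rewrite -raag_act_cat; apply: raag_act_wordP; exact: raag_repr_pi. Qed.

Lemma raag_act_gen v : raag_act (raag_gen e v) = s v.
Proof.
rewrite /raag_act (@raag_act_wordP _ [:: (v, false)]); last exact: raag_repr_pi.
exact: mulg1.
Qed.
End RaagAction.

(* b acts on every layer, and c on layer 0, by an m-th root of sx; d acts on
   layer m by an m-th root of st, and a shifts the layers. Then b^m, [a^m, c^m]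
   and d^m act on layer m as sx, sx and st. *)
Section Layers.
Variable m : nat.
Hypothesis m_gt0 : (0 < m)%N.
Local Open Scope ring_scope.
Notation layers := (int * (int * 'I_5))%type.

(** The integer counts steps, and the permutation acts only when the count reaches a multiple of m,
    hence once in m steps. *)
Definition root_fun (s : {perm 'I_5}) (p : int * 'I_5) : int * 'I_5 :=
  (p.1 + 1, if (m %| p.1 + 1)%Z then (s^-1)%g p.2 else p.2).
Definition root_inv (s : {perm 'I_5}) (p : int * 'I_5) : int * 'I_5 :=
  (p.1 - 1, if (m %| p.1)%Z then s p.2 else p.2).

Lemma root_funK s : cancel (root_fun s) (root_inv s).
Proof. by move=> [j i]; rewrite /root_inv /root_fun /= addrK; case: (_ %| _)%Z; rewrite ?permKV. Qed.

Lemma root_invK s : cancel (root_inv s) (root_fun s).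
Proof. by move=> [j i]; rewrite /root_inv /root_fun /= subrK; case: (_ %| _)%Z; rewrite ?permK. Qed.

Lemma iter_root s q i :
  iter m (root_fun s) (m%:Z * q, i) = (m%:Z * (q + 1), (s^-1)%g i).
Proof.
have H n : (n < m)%N -> iter n (root_fun s) (m%:Z * q, i) = (m%:Z * q + n%:Z, i).
  elim: n => [|n IH] nm; first by rewrite addr0.
  rewrite iterS IH ?(ltnW nm) // /root_fun /=.
  case: ifP => [|_]; last by congr pair; rewrite -addrA -[n.+1]addn1 PoszD.
  move=> /dvdzP[k E]; exfalso; have {}E : (k - q) * m%:Z = n%:Z + 1 by lia.
  have : (0 < (k - q) * m%:Z < m%:Z) by rewrite E; lia.
  case: (k - q) => [[|l]|l]; nia.
have -> f x : @iter (int * 'I_5) m f x = f (iter m.-1 f x) by rewrite -iterS prednK.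
rewrite H ?prednK // /root_fun /=.
have -> : m%:Z * q + m.-1%:Z + 1 = m%:Z * (q + 1) by rewrite mulrDr mulr1; lia.
by rewrite dvdz_mulr.
Qed.

Definition on_layers (P : pred int) (s : {perm 'I_5}) (x : layers) : layers :=
  (x.1, if P x.1 then root_fun s x.2 else x.2).
Definition on_layers_inv (P : pred int) (s : {perm 'I_5}) (x : layers) : layers :=
  (x.1, if P x.1 then root_inv s x.2 else x.2).

Lemma on_layersK P s : cancel (on_layers P s) (on_layers_inv P s).
Proof. by move=> [k p]; rewrite /on_layers_inv /on_layers /=; case: (P k); rewrite ?root_funK. Qed.

Lemma on_layers_invK P s : cancel (on_layers_inv P s) (on_layers P s).
Proof. by move=> [k p]; rewrite /on_layers_inv /on_layers /=; case: (P k); rewrite ?root_invK. Qed.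

Definition layer_root P s : bijn layers := Bijn (on_layersK P s) (on_layers_invK P s).

Lemma shiftK : cancel (fun x : layers => (x.1 + 1, x.2)) (fun x => (x.1 - 1, x.2)).
Proof. by move=> [k p] /=; rewrite addrK. Qed.
Lemma shiftKV : cancel (fun x : layers => (x.1 - 1, x.2)) (fun x => (x.1 + 1, x.2)).
Proof. by move=> [k p] /=; rewrite subrK. Qed.
Definition layer_shift : bijn layers := Bijn shiftK shiftKV.

Lemma layer_shiftX n k p : (layer_shift ^+ n)%g (k, p) = (k + n%:Z, p).
Proof.
rewrite bijnX; elim: n => [|n IH]; first by rewrite addr0.
by rewrite iterS IH /=; congr pair; lia.
Qed.

Lemma layer_rootX P s n k p :
  (layer_root P s ^+ n)%g (k, p) = (k, if P k then iter n (root_fun s) p else p).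
Proof.
rewrite bijnX; elim: n => [|n IH]; first by case: ifP.
by rewrite iterS IH /= /on_layers /=; case: ifP => ->.
Qed.

Let A := layer_shift.
Let B := layer_root predT sx.
Let C := layer_root (pred1 0) sx.
Let D := layer_root (pred1 m%:Z) st.

Lemma layer_AB : (A * B = B * A)%g.
Proof. by apply: bijnP => -[k p]. Qed.
Lemma layer_BC : (B * C = C * B)%g.
Proof. by apply: bijnP => -[k p]; rewrite !bijnM /= /on_layers /=; case: (k == 0). Qed.
Lemma layer_CD : (C * D = D * C)%g.
Proof.
apply: bijnP => -[k p]; rewrite !bijnM /= /on_layers /=.
case: eqP => [->|_]; case: eqP => // /eqP; lia.
Qed.

(** The exponent sum: on layer m each of u, v and t advances the counter by m. *)
Fixpoint wdeg (w : word) : int :=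
  match w with
  | WU | WV | WT => 1 | W1 => 0
  | WM w1 w2 => wdeg w1 + wdeg w2 | WI w1 => - wdeg w1
  end.

Lemma layer_ev w q i :
  ev (B ^+ m)%g (A ^+ m * C ^+ m * ((A ^+ m)^-1 * (C ^+ m)^-1))%g (D ^+ m)%g w
    (m%:Z, (m%:Z * q, i)) = (m%:Z, (m%:Z * (q + wdeg w), ((rho w)^-1)%g i)).
Proof.
rewrite /rho; elim: w q i => /= [||||w1 H1 w2 H2|w1 H1] q i.
- by rewrite layer_rootX /= iter_root.
(* On layer m the factor c^-m acts trivially, a^-m leads to layer 0, c^m acts there, and a^m leads
   back: the commutator acts as a copy of c^m transported from layer 0. *)
- have -> : bg (C ^+ m)%g (m%:Z, (m%:Z * q, i)) = (m%:Z, (m%:Z * q, i)).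
    apply: (can_inj (@bfK _ (C ^+ m)%g)); rewrite bgK layer_rootX /=.
    by case: eqP => // /eqP; lia.
  have -> : bg (A ^+ m)%g (m%:Z, (m%:Z * q, i)) = (0, (m%:Z * q, i)).
    by apply: (can_inj (@bfK _ (A ^+ m)%g)); rewrite bgK layer_shiftX add0r.
  by rewrite layer_rootX /= iter_root layer_shiftX add0r.
- by rewrite layer_rootX /= eqxx iter_root.
- by rewrite addr0 invg1 perm1.
- by rewrite H2 H1 invMg permM [wdeg w1 + _]addrC addrA.
- set f := ev _ _ _ w1 in H1 *; apply: (can_inj (@bfK _ f)).
  by rewrite bgK H1 subrK invgK permK.
Qed.

End Layers.

(** Let all other vertices act as the identity. The bijections of a and b, of b and c, of c and d
    commute, and the remaining pairs among the four are non-edges. So the whole group acts on the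
    layers, and layer m detects [rho w]. *)
Lemma raag_word_trivial (V : finType) (e : rel V) (va vb vc vd : V) (m : nat) (w : word) :
  simple_graph e -> (0 < m)%N -> uniq [:: va; vb; vc; vd] ->
  ~~ e va vc -> ~~ e va vd -> ~~ e vb vd ->
  let g := fun v => raag_gen e v ^+ m in
  ev (g vb) (g va * g vc * ((g va)^-1 * (g vc)^-1)) (g vd) w = 1 -> rho w = 1.
Proof.
move=> [es ei] m0 /= un eac ead ebd.
pose s v : bijn (int * (int * 'I_5)) :=
  if v == va then layer_shift else if v == vb then layer_root m predT sx else
  if v == vc then layer_root m (pred1 0%R) sx else
  if v == vd then layer_root m (pred1 (Posz m)) st else 1.
have [E1 E2] := (layer_AB m, layer_BC m); have E3 := @layer_CD m m0.
have s_comm x y : e x y -> s x * s y = s y * s x.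
  rewrite /s => exy.
  move: un; rewrite !inE !negb_or => /and4P[/and3P[ab ac ad] /andP[bc bd] cd _].
  have ex : e x x = false by exact: ei.
  have := exy; rewrite es => eyx.
  have := eac; have := ead; have := ebd; rewrite es => eda; rewrite es => edb; rewrite es => eca.
  move: exy eyx ex; case: (eqVneq x va) => [->|xa]; last case: (eqVneq x vb) => [->|xb];
    last case: (eqVneq x vc) => [->|xc]; last case: (eqVneq x vd) => [->|xd];
  (case: (eqVneq y va) => [->|ya]; last case: (eqVneq y vb) => [->|yb];
    last case: (eqVneq y vc) => [->|yc]; last case: (eqVneq y vd) => [->|yd]);
  rewrite ?(negPf eac) ?(negPf ead) ?(negPf ebd) ?(negPf eca) ?(negPf eda) ?(negPf edb) ?mul1g ?mulg1 //.
have sa : s va = layer_shift by rewrite /s eqxx.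
move: un; rewrite !inE !negb_or => /and4P[/and3P[ab ac ad] /andP[bc bd] cd _].
have sb : s vb = layer_root m predT sx by rewrite /s eqxx eq_sym (negPf ab).
have sc : s vc = layer_root m (pred1 0%R) sx.
  by rewrite /s eqxx eq_sym (negPf ac) eq_sym (negPf bc).
have sd : s vd = layer_root m (pred1 (Posz m)) st.
  by rewrite /s eqxx eq_sym (negPf ad) eq_sym (negPf bd) eq_sym (negPf cd).
move=> /(congr1 (raag_act (e := e) s)).
have actM := raag_actM s_comm; rewrite (ev_morph actM) !actM !(gmorphV actM) !(gmorphX actM).
rewrite !(raag_act_gen s_comm) sa sb sc sd (gmorph1 actM) => E.
(* Started at [rho w i], the word leads to i on layer m; as it acts as the identity,
   [rho w i = i]. *)
apply/permP => i; rewrite perm1; have := layer_ev m0 w 0 ((rho w) i).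
by rewrite E permK => -[].
Qed.

(** * Strict derivatives and bounded distortion *)

Close Scope group_scope.
Local Open Scope classical_set_scope.
Local Open Scope ring_scope.

Section LocalToGlobal.
Variable R : realType.

(** Compactness of [a, b] in the form of a supremum argument: the set of x with P a x cannot stop
    before b. The local hypothesis concerns only intervals that contain s, so that information at
    the point s, such as a derivative, is enough. *)
Lemma local_to_global_at (P : R -> R -> Prop) (a b : R) : a <= b ->
  (forall p q r, a <= p -> p <= q -> q <= r -> r <= b -> P p q -> P q r -> P p r) ->
  (forall s, a <= s <= b -> exists2 d, 0 < d &
     forall p q, a <= p -> p <= s -> s <= q -> q <= b -> s - d < p -> q < s + d -> P p q) ->
  P a b.
Proof.
move=> ab glue loc.
pose S := [set x | a <= x <= b /\ P a x].
have Sa : S a.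
  split; first by rewrite lexx.
  have [|d d0 H] := loc a; first by rewrite lexx.
  by apply: H => //; lra.
have Sb : ubound S b by move=> x [/andP[]].
have hS : has_sup S by split; [exists a | exists b].
set s := sup S.
have as_ : a <= s by exact: sup_upper_bound hS _ Sa.
have sb : s <= b by apply: ge_sup => //; exists a.
have [|d d0 H] := loc s; first by rewrite as_.
have [x Sx xs] := sup_adherent d0 hS.
have [/andP[ax xb] Px] := Sx.
have xs' : x <= s by exact: sup_upper_bound hS _ Sx.
pose y := Num.min b (s + d / 2).
have xy : x <= y by rewrite le_min xb /=; lra.
have yb : y <= b by rewrite ge_min lexx.
have ysd : y < s + d by rewrite gt_min; apply/orP; right; lra.
have Sy : S y.
  split; first by rewrite yb (le_trans ax).
  have sy : s <= y by rewrite le_min sb lerDl ltW // divr_gt0.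
  by apply: (glue a x y) => //; apply: H => //; rewrite (le_trans ax).
have ys : y <= s by exact: sup_upper_bound hS _ Sy.
have yE : y = b.
  by move: ys; rewrite /y; case: (leP b (s + d / 2)) => //; lra.
by move: Sy; rewrite yE => -[].
Qed.

Lemma local_to_global (P : R -> R -> Prop) (a b : R) : a <= b ->
  (forall p q r, a <= p -> p <= q -> q <= r -> r <= b -> P p q -> P q r -> P p r) ->
  (forall s, a <= s <= b -> exists2 d, 0 < d &
     forall p q, a <= p -> p <= q -> q <= b -> s - d < p -> q < s + d -> P p q) ->
  P a b.
Proof.
move=> ab glue loc; apply: local_to_global_at => // s /loc[d d0 H].
by exists d => // p q ap ps sq; apply: H => //; exact: le_trans sq.
Qed.

End LocalToGlobal.

Section ChordRatio.
Variable R : realType.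
Implicit Types (A B : set R) (h k m : R -> R) (s l : R).

Definition nbd A s (d : R) : set R := [set x | A x /\ `|x - s| < d].
Definition nd A m := forall x y, A x -> A y -> x <= y -> m x <= m y.

(* Over a window [p, q] the slopes of the chords of h differ by a factor at most
   exp (m q - m p): this expresses that log h' has bounded variation. *)
Definition CR A h m := forall p q x y x' y', A p -> A q ->
  p <= x -> x < y -> y <= q -> p <= x' -> x' < y' -> y' <= q ->
  (h y - h x) * (y' - x') <= expR (m q - m p) * ((h y' - h x') * (y - x)).

(* l is a strict derivative: both ends of the chord vary. *)
Definition sdiff A h s l := 0 < l /\
  forall e, 0 < e -> exists2 d, 0 < d & forall x y, nbd A s d x -> nbd A s d y ->
    x < y -> `|h y - h x - l * (y - x)| <= e * (y - x).

Definition bvnear A h s := exists2 d, 0 < d &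
  exists m, nd (nbd A s d) m /\ CR (nbd A s d) h m.

(** A local form of being C^{1+bv} with positive derivative that mentions no derivative function,
    suited to maps known only through charts. *)
Definition tame A h s := (exists l, sdiff A h s l) /\ bvnear A h s.

Lemma nbdS A s d d' x : nbd A s d x -> d <= d' -> nbd A s d' x.
Proof. by move=> [Ax xd] dd; split=> //; exact: lt_le_trans dd. Qed.

Lemma nbd_itv A s d : is_interval A -> is_interval (nbd A s d).
Proof.
move=> iA x y [Ax xd] [Ay yd] z /andP[xz zy]; split; first by apply: (iA x y); rewrite ?xz.
by move: xd yd; rewrite !ltr_norml => /andP[? ?] /andP[? ?]; apply/andP; split; lra.
Qed.

Lemma sub_nd A B m : B `<=` A -> nd A m -> nd B m.
Proof. by move=> BA H x y /BA Ax /BA Ay; exact: H. Qed.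

Lemma sub_CR A B h m : B `<=` A -> CR A h m -> CR B h m.
Proof. by move=> BA H p q x y x' y' /BA Ax /BA Ay; exact: H. Qed.

Lemma CR_eq A h k m : is_interval A -> (forall x, A x -> k x = h x) -> CR A h m -> CR A k m.
Proof.
move=> iA kh H p q x y x' y' Ap Aq px xy yq px' xy' yq'.
have I z : p <= z -> z <= q -> k z = h z.
  by move=> pz zq; apply: kh; apply: (iA p q); rewrite ?pz.
rewrite !I; try lra; exact: (H p q).
Qed.

Lemma sdiff_restrict A B h k s l : (exists2 d, 0 < d & forall x, B x -> `|x - s| < d -> A x /\ k x = h x) ->
  sdiff A h s l -> sdiff B k s l.
Proof.
move=> [d d0 BA] [l0 H]; split=> // e /H[d' d'0 {}H].
exists (Num.min d d'); first by rewrite lt_min d0.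
move=> x y [Bx]; rewrite lt_min => /andP[xd xd'] [By]; rewrite lt_min => /andP[yd yd'] xy.
have [Ax ->] := BA x Bx xd; have [Ay ->] := BA y By yd.
exact: H.
Qed.

Lemma bvnear_restrict A B h k s : is_interval B ->
  (exists2 d, 0 < d & forall x, B x -> `|x - s| < d -> A x /\ k x = h x) ->
  bvnear A h s -> bvnear B k s.
Proof.
move=> iB [d d0 BA] [d' d'0 [m [ndm Hm]]].
have S x : nbd B s (Num.min d d') x -> nbd A s d' x /\ k x = h x.
  by move=> [Bx]; rewrite lt_min => /andP[xd xd']; have [] := BA x Bx xd.
exists (Num.min d d'); first by rewrite lt_min d0.
exists m; split; first by apply: sub_nd ndm => x /S[].
apply: (@CR_eq _ h); first exact: nbd_itv.
  by move=> x /S[].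
by apply: sub_CR Hm => x /S[].
Qed.

Lemma tame_restrict A B h k s : is_interval B ->
  (exists2 d, 0 < d & forall x, B x -> `|x - s| < d -> A x /\ k x = h x) ->
  tame A h s -> tame B k s.
Proof.
move=> iB H [[l /(sdiff_restrict H) ?] /(bvnear_restrict iB H) ?].
by split=> //; exists l.
Qed.

Lemma sdiff_incr A h s l : sdiff A h s l -> exists2 d, 0 < d &
  forall x y, nbd A s d x -> nbd A s d y -> x < y -> h x < h y.
Proof.
move=> [l0 H]; have [|d d0 {}H] := H (l / 2); first by rewrite divr_gt0.
exists d => // x y Ax Ay xy; have := H x y Ax Ay xy.
rewrite ler_norml => /andP[+ _]; have : 0 < l * (y - x) by rewrite mulr_gt0 ?subr_gt0.
by rewrite mulrAC; lra.
Qed.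

Lemma sdiff_cont A h s l : A s -> sdiff A h s l -> forall e, 0 < e ->
  exists2 d, 0 < d & forall x, nbd A s d x -> `|h x - h s| < e.
Proof.
move=> As [l0 H] e e0; have [|d d0 {}H] := H l => //.
have l20 : 0 < 2 * l by lra.
exists (Num.min d (e / (2 * l))); first by rewrite lt_min d0 divr_gt0.
move=> x [Ax]; rewrite lt_min => /andP[xd]; rewrite ltr_pdivlMr // => xe.
have As' : nbd A s d s by split=> //; rewrite subrr normr0.
have Ax' : nbd A s d x by split.
have B a : `|a| < e -> `|- a| < e by rewrite normrN.
case: (ltgtP x s) => [xs|sx|->]; last by rewrite subrr normr0.
- have := H _ _ Ax' As' xs; move: xe.
  rewrite distrC gtr0_norm ?subr_gt0 // => xe.
  rewrite distrC ler_norml ltr_norml => /andP[? ?]; apply/andP.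
  by split; nra.
- have := H _ _ As' Ax' sx; move: xe; rewrite gtr0_norm ?subr_gt0 // => xe.
  rewrite ler_norml ltr_norml => /andP[? ?]; apply/andP.
  by split; nra.
Qed.

(** Since log (k o g)' = log g' + (log k') o g, the bounds on the variation add up. *)
Lemma CR_comp A B g k m1 m2 : is_interval A -> (forall x, A x -> B (g x)) ->
  (forall x y, A x -> A y -> x < y -> g x < g y) ->
  (forall x y, B x -> B y -> x < y -> k x < k y) ->
  CR A g m1 -> CR B k m2 -> CR A (k \o g) (fun x => m1 x + m2 (g x)).
Proof.
move=> iA AB gi ki C1 C2 p q x y x' y' Ap Aq px xy yq px' xy' yq' /=.
have I z : p <= z -> z <= q -> A z by move=> pz zq; apply: (iA p q); rewrite ?pz.
have [Ax Ay Ax' Ay'] : [/\ A x, A y, A x' & A y'] by split; apply: I; lra.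
have gw z z' : A z -> A z' -> z <= z' -> g z <= g z'.
  by rewrite [z <= z']le_eqVlt => Az Az' /orP[/eqP->//|/gi H]; apply/ltW/H.
have H1 := C1 p q x y x' y' Ap Aq px xy yq px' xy' yq'.
have H2 := C2 (g p) (g q) (g x) (g y) (g x') (g y') (AB _ Ap) (AB _ Aq)
  (gw _ _ Ap Ax px) (gi _ _ Ax Ay xy) (gw _ _ Ay Aq yq)
  (gw _ _ Ap Ax' px') (gi _ _ Ax' Ay' xy') (gw _ _ Ay' Aq yq').
have -> : m1 q + m2 (g q) - (m1 p + m2 (g p)) = (m2 (g q) - m2 (g p)) + (m1 q - m1 p) by ring.
rewrite expRD.
have gxy' : 0 < g y' - g x' by rewrite subr_gt0 gi.
have kxy' : 0 < k (g y') - k (g x') by rewrite subr_gt0; apply: ki; [exact: AB|exact: AB|exact: gi].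
rewrite -(ler_pM2r gxy').
have E0 := expR_gt0 (m2 (g q) - m2 (g p)).
set e2 := expR (m2 (g q) - m2 (g p)) in H2 E0 *; set e1 := expR (m1 q - m1 p) in H1 *.
have xy0 : 0 < y' - x' by rewrite subr_gt0.
have H2' := ler_wpM2r (ltW xy0) H2.
have H1' := ler_wpM2l (mulr_ge0 (ltW E0) (ltW kxy')) H1.
by lra.
Qed.

(** Since log F' = log (k o F)' - (log k') o F, the variation of F is again bounded by the sum. *)
Lemma CR_div A B F k m1 m2 : is_interval A -> (forall x, A x -> B (F x)) ->
  (forall x y, A x -> A y -> x < y -> F x < F y) ->
  (forall x y, B x -> B y -> x < y -> k x < k y) ->
  CR A (k \o F) m1 -> CR B k m2 -> CR A F (fun x => m1 x + m2 (F x)).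
Proof.
move=> iA AB gi ki C1 C2 p q x y x' y' Ap Aq px xy yq px' xy' yq' /=.
have I z : p <= z -> z <= q -> A z by move=> pz zq; apply: (iA p q); rewrite ?pz.
have [Ax Ay Ax' Ay'] : [/\ A x, A y, A x' & A y'] by split; apply: I; lra.
have gw z z' : A z -> A z' -> z <= z' -> F z <= F z'.
  by rewrite [z <= z']le_eqVlt => Az Az' /orP[/eqP->//|/gi H]; apply/ltW/H.
have H1 := C1 p q x y x' y' Ap Aq px xy yq px' xy' yq'.
have H2 := C2 (F p) (F q) (F x') (F y') (F x) (F y) (AB _ Ap) (AB _ Aq)
  (gw _ _ Ap Ax' px') (gi _ _ Ax' Ay' xy') (gw _ _ Ay' Aq yq')
  (gw _ _ Ap Ax px) (gi _ _ Ax Ay xy) (gw _ _ Ay Aq yq).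
have -> : m1 q + m2 (F q) - (m1 p + m2 (F p)) = (m2 (F q) - m2 (F p)) + (m1 q - m1 p) by ring.
rewrite expRD.
have kxy : 0 < k (F y) - k (F x) by rewrite subr_gt0; apply: ki; [exact: AB|exact: AB|exact: gi].
have Fxy : 0 < F y - F x by rewrite subr_gt0 gi.
rewrite -(ler_pM2r kxy).
have E0 := expR_gt0 (m1 q - m1 p).
move: H1 => /= H1.
set e2 := expR (m2 (F q) - m2 (F p)) in H2 *; set e1 := expR (m1 q - m1 p) in H1 E0 *.
have xy0 : 0 < y - x by rewrite subr_gt0.
have H1' := ler_wpM2r (ltW Fxy) H1.
have H2' := ler_wpM2l (mulr_ge0 (ltW E0) (ltW xy0)) H2.
by lra.
Qed.

Lemma sdiff_comp A B g k s l1 l2 : A s -> (exists2 d, 0 < d & forall x, nbd A s d x -> B (g x)) ->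
  sdiff A g s l1 -> sdiff B k (g s) l2 -> sdiff A (k \o g) s (l2 * l1).
Proof.
move=> As [d0 d00 AB] D1 D2; have [d3 d30 I3] := sdiff_incr D1.
have [l10 H1] := D1; have [l20 H2] := D2; split; first exact: mulr_gt0.
move=> e e0.
(* With X and U the increments of the argument and of g, the error is at most e2 U + l2 e1 X. As e1
   <= 1 gives U <= (l1 + 1) X, each term is at most (e / 2) X. *)
pose e1 := Num.min 1 (e / (2 * l2)); pose e2 := e / (2 * (l1 + 1)).
have e20 : 0 < e2 by rewrite divr_gt0 // mulr_gt0 // addr_gt0.
have e10 : 0 < e1 by rewrite lt_min ltr01 divr_gt0 // mulr_gt0.
have [d5 d50 {}H1] := H1 _ e10; have [d6 d60 {}H2] := H2 _ e20.
have [d7 d70 G] := sdiff_cont As D1 d60.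
exists (Num.min (Num.min d0 d3) (Num.min d5 d7)); first by rewrite !lt_min d00 d30 d50.
move=> x y nx ny xy.
have N d z : Num.min (Num.min d0 d3) (Num.min d5 d7) <= d ->
  nbd A s (Num.min (Num.min d0 d3) (Num.min d5 d7)) z -> nbd A s d z.
  by move=> ? /nbdS; apply.
have [L0 L3 L5 L7] : [/\ Num.min (Num.min d0 d3) (Num.min d5 d7) <= d0,
   Num.min (Num.min d0 d3) (Num.min d5 d7) <= d3, Num.min (Num.min d0 d3) (Num.min d5 d7) <= d5
   & Num.min (Num.min d0 d3) (Num.min d5 d7) <= d7] by rewrite !ge_min !lexx ?orbT.
have gxy := I3 _ _ (N _ _ L3 nx) (N _ _ L3 ny) xy.
have K1 := H1 _ _ (N _ _ L5 nx) (N _ _ L5 ny) xy.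
have Bg z : nbd A s (Num.min (Num.min d0 d3) (Num.min d5 d7)) z -> nbd B (g s) d6 (g z).
  by move=> nz; split; [exact: AB (N _ _ L0 nz) | exact: G (N _ _ L7 nz)].
have K2 := H2 _ _ (Bg _ nx) (Bg _ ny) gxy.
have xy0 : 0 < y - x by rewrite subr_gt0.
have [E1a E1b] : e1 <= 1 /\ l2 * e1 <= e / 2.
  split; first by rewrite ge_min lexx.
  have : e1 <= e / (2 * l2) by rewrite ge_min lexx orbT.
  by rewrite ler_pdivlMr ?mulr_gt0 //; lra.
have E2 : e2 * (l1 + 1) = e / 2 by rewrite /e2; field; apply: lt0r_neq0; lra.
rewrite /= in K1 K2 *; move: K1 K2; set X := y - x in xy0 *.
set U := g y - g x => K1 K2; set W := k (g y) - k (g x) in K2 *.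
have -> : W - l2 * l1 * X = (W - l2 * U) + l2 * (U - l1 * X) by ring.
apply: le_trans (ler_normD _ _) _; rewrite normrM (gtr0_norm l20).
have U1 : U <= (l1 + 1) * X by move: K1; rewrite ler_norml => /andP[_]; nra.
have := ler_wpM2l (ltW l20) K1; have := ler_wpM2l (ltW e20) U1.
have := ler_wpM2r (ltW xy0) E1b.
nra.
Qed.

Lemma tame_comp A B g k s : is_interval A -> is_interval B -> A s ->
  (exists2 d, 0 < d & forall x, nbd A s d x -> B (g x)) ->
  tame A g s -> tame B k (g s) -> tame A (k \o g) s.
Proof.
move=> iA iB As [d0 d00 AB] [[l1 D1] [d1 d10 [m1 [nd1 C1]]]] [[l2 D2] [d2 d20 [m2 [nd2 C2]]]].
have [d3 d30 I3] := sdiff_incr D1; have [d4 d40 I4] := sdiff_incr D2.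
split.
- by exists (l2 * l1); apply: sdiff_comp D1 D2 => //; exists d0.
- have d240 : 0 < Num.min d2 d4 by rewrite lt_min d20.
  have [d7 d70 G] := sdiff_cont As D1 d240.
  pose d := Num.min (Num.min d0 d1) (Num.min d3 d7).
  have [L0 L1 L3 L7] : [/\ d <= d0, d <= d1, d <= d3 & d <= d7] by rewrite /d !ge_min !lexx ?orbT.
  have AB' x : nbd A s d x -> nbd B (g s) (Num.min d2 d4) (g x).
    by move=> nx; split; [apply: AB; exact: nbdS L0 | apply: G; exact: nbdS L7].
  have [L2 L4] : Num.min d2 d4 <= d2 /\ Num.min d2 d4 <= d4 by rewrite !ge_min !lexx orbT.
  have gi x y : nbd A s d x -> nbd A s d y -> x < y -> g x < g y.
    by move=> nx ny; apply: I3; exact: nbdS L3.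
  exists d; first by rewrite !lt_min d00 d10 d30.
  exists (fun x => m1 x + m2 (g x)); split.
    move=> x y nx ny xy; apply: lerD; first by apply: nd1 => //; exact: nbdS L1.
    apply: nd2; try by apply: nbdS L2; exact: AB'.
    by move: xy; rewrite le_eqVlt => /orP[/eqP->//|/gi xy]; apply/ltW/xy.
  apply: (CR_comp (B := nbd B (g s) (Num.min d2 d4))) => //.
  + exact: nbd_itv.
  + by move=> x y nx ny; apply: I4; exact: nbdS L4.
  + by apply: sub_CR C1 => x; move/nbdS; exact.
  + by apply: sub_CR C2 => x; move/nbdS; exact.
Qed.

End ChordRatio.

Section Tame.
Variable R : realType.
Implicit Types (A B : set R) (h k F m : R -> R) (s l : R).

(** A lift F is at first only continuous, but in charts k o F is a tame map with k tame. As k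
    increases strictly near F s, so does F near s, and the slopes of F are quotients of slopes of k
    o F and of k. *)
Lemma tame_div A B F k s : is_interval A -> is_interval B -> A s ->
  (forall e, 0 < e -> exists2 d, 0 < d &
     forall x, nbd A s d x -> B (F x) /\ `|F x - F s| < e) ->
  tame B k (F s) -> tame A (k \o F) s -> tame A F s.
Proof.
move=> iA iB As FC [[l1 D1] [d1 d10 [m1 [nd1 C1]]]] [[l2 D2] [d2 d20 [m2 [nd2 C2]]]].
have [d3 d30 I3] := sdiff_incr D1; have [d4 d40 I4] := sdiff_incr D2.
have d130 : 0 < Num.min d1 d3 by rewrite lt_min d10.
have [d5 d50 F5] := FC _ d130.
pose d := Num.min (Num.min d2 d4) d5.
have d0 : 0 < d by rewrite !lt_min d20 d40.
have [L2 L4 L5] : [/\ d <= d2, d <= d4 & d <= d5] by rewrite /d !ge_min !lexx ?orbT.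
clearbody d.
have [M1 M3] : Num.min d1 d3 <= d1 /\ Num.min d1 d3 <= d3 by rewrite !ge_min !lexx orbT.
have AB x : nbd A s d x -> nbd B (F s) (Num.min d1 d3) (F x).
  by move=> nx; apply: F5; exact: nbdS L5.
have ki x y : nbd B (F s) (Num.min d1 d3) x -> nbd B (F s) (Num.min d1 d3) y -> x < y -> k x < k y.
  by move=> nx ny; apply: I3; exact: nbdS M3.
have Fi x y : nbd A s d x -> nbd A s d y -> x < y -> F x < F y.
  move=> nx ny xy; have H := I4 _ _ (nbdS nx L4) (nbdS ny L4) xy.
  case: (ltP (F x) (F y)) => // yx; exfalso; move: H => /=.
  move: yx; rewrite le_eqVlt => /orP[/eqP->|/ki H]; first by rewrite ltxx.
  by rewrite ltNge (ltW (H _ _)) //; exact: AB.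
split.
- exists (l2 / l1); have [l10 H1] := D1; have [l20 H2] := D2; split; first exact: divr_gt0.
  move=> e e0.
  (* With W the increment of k o F, the error is ((W - l2 X) - (W - l1 U)) / l1. The crude bounds W
     <= (l2 + 1) X and l1 U <= 2 W turn e1 U into a multiple of X, and both differences are then at
     most e l1 X / 2. *)
  pose e1 := Num.min (l1 / 2) (e * l1 ^+ 2 / (4 * (l2 + 1))); pose e2 := Num.min 1 (e * l1 / 2).
  have e20 : 0 < e2 by rewrite lt_min ltr01 divr_gt0 // mulr_gt0.
  have l2p : 0 < 4 * (l2 + 1) by rewrite mulr_gt0 // addr_gt0.
  have e10 : 0 < e1 by rewrite lt_min !divr_gt0 // mulr_gt0 // exprn_gt0.
  have [d6 d60 {}H1] := H1 _ e10; have [d7 d70 {}H2] := H2 _ e20.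
  have [d8 d80 F8] := FC _ d60.
  exists (Num.min (Num.min d d7) d8); first by rewrite !lt_min d0 d70.
  have [K1 K2 K3] : [/\ Num.min (Num.min d d7) d8 <= d, Num.min (Num.min d d7) d8 <= d7
    & Num.min (Num.min d d7) d8 <= d8] by rewrite !ge_min !lexx ?orbT.
  move=> x y nx ny xy.
  have Fxy := Fi _ _ (nbdS nx K1) (nbdS ny K1) xy.
  have := H2 _ _ (nbdS nx K2) (nbdS ny K2) xy => /=.
  have := H1 _ _ (F8 _ (nbdS nx K3)) (F8 _ (nbdS ny K3)) Fxy.
  have U0 : 0 < F y - F x by rewrite subr_gt0.
  have X0 : 0 < y - x by rewrite subr_gt0.
  set X := y - x in X0 *; set U := F y - F x in U0 *; set W := k (F y) - k (F x).
  move=> G1 G2.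
  have E1a : e1 <= l1 / 2 by rewrite ge_min lexx.
  have E1b : e1 * (4 * (l2 + 1)) <= e * l1 ^+ 2.
    have : e1 <= e * l1 ^+ 2 / (4 * (l2 + 1)) by rewrite ge_min lexx orbT.
    by rewrite ler_pdivlMr.
  have E2a : e2 <= 1 by rewrite ge_min lexx.
  have E2b : e2 <= e * l1 / 2 by rewrite ge_min lexx orbT.
  have WX : W <= (l2 + 1) * X.
    by move: G2 (ler_wpM2r (ltW X0) E2a); rewrite ler_norml => /andP[_]; clear; lra.
  have UW : l1 * U <= 2 * W.
    by move: G1 (ler_wpM2r (ltW U0) E1a); rewrite ler_norml => /andP[+ _]; clear; lra.
  have UX : l1 * U <= 2 * (l2 + 1) * X by move: UW WX; clear; lra.
  have eU : e1 * U <= e * l1 / 2 * X.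
    rewrite -(ler_pM2r l10).
    have : e1 * (l1 * U) <= e1 * (2 * (l2 + 1) * X) by rewrite ler_pM2l.
    by have := ler_wpM2r (ltW X0) E1b; clear; lra.
  have -> : U - l2 / l1 * X = ((W - l2 * X) - (W - l1 * U)) / l1 by field; exact: lt0r_neq0.
  rewrite normrM normfV (gtr0_norm l10) ler_pdivrMr //.
  apply: le_trans (ler_normB _ _) _.
  by move: G1 G2 eU (ler_wpM2r (ltW X0) E2b); clear; lra.
- exists d => //; exists (fun x => m2 x + m1 (F x)); split.
    move=> x y nx ny xy; apply: lerD; first by apply: nd2 => //; exact: nbdS L2.
    apply: nd1; try by apply: nbdS M1; exact: AB.
    by move: xy; rewrite le_eqVlt => /orP[/eqP->//|/Fi xy]; apply/ltW/xy.
  apply: (CR_div (B := nbd B (F s) (Num.min d1 d3)) (k := k)) => //.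
  + exact: nbd_itv.
  + by apply: sub_CR C2 => x; move/nbdS; exact.
  + by apply: sub_CR C1 => x; move/nbdS; exact.
Qed.

(** Chords with one end at s that shrink to s have slopes tending to l; comparing a fixed chord with
    them and passing to the limit compares it with l. *)
Lemma CR_slope A h s l m P Q x y : is_interval A -> sdiff A h s l -> CR A h m ->
  A P -> A Q -> P <= s -> s <= Q -> P <= x -> x < y -> y <= Q ->
  h y - h x <= expR (m Q - m P) * (l * (y - x)) /\
  l * (y - x) <= expR (m Q - m P) * (h y - h x).
Proof.
move=> iA [l0 D] C AP AQ Ps sQ Px xy yQ.
have xy0 : 0 < y - x by rewrite subr_gt0.
have e0 := expR_gt0 (m Q - m P); set E := expR _ in e0 *.
have H e : 0 < e -> exists x' y', [/\ P <= x', x' < y', y' <= Q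
    & `|h y' - h x' - l * (y' - x')| <= e * (y' - x')].
  move=> /D[d d0 {}D].
  have [Ps'|sP] := ltP P s.
  - pose x' := Num.max P (s - d / 2).
    have x's : x' < s by rewrite gt_max Ps' /= ltrBlDr ltrDl divr_gt0.
    have Px' : P <= x' by rewrite le_max lexx.
    exists x', s; split=> //; apply: D => //; split.
    + by apply: (iA P Q) => //; rewrite Px' /=; lra.
    + have : s - d / 2 <= x' by rewrite le_max lexx orbT.
      by rewrite ltr_norml => ?; apply/andP; split; lra.
    + by apply: (iA P Q) => //; rewrite Ps sQ.
    + by rewrite subrr normr0.
  - pose y' := Num.min Q (s + d / 2).
    have sy' : s < y' by rewrite lt_min (_ : s < Q) ?ltrDl ?divr_gt0 //; lra.
    have y'Q : y' <= Q by rewrite ge_min lexx.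
    exists s, y'; split=> //; try lra; apply: D => //; split.
    + by apply: (iA P Q) => //; rewrite Ps sQ.
    + by rewrite subrr normr0.
    + by apply: (iA P Q) => //; rewrite y'Q /=; lra.
    + have : y' <= s + d / 2 by rewrite ge_min lexx orbT.
      by rewrite ltr_norml => ?; apply/andP; split; lra.
split.
- apply/ler_addgt0Pr => e ee.
  have c0 : 0 < E * (y - x) by rewrite mulr_gt0.
  have [|x' [y' [Px' xy' yQ' G]]] := H (e / (E * (y - x))); first by rewrite divr_gt0.
  have xy'0 : 0 < y' - x' by rewrite subr_gt0.
  rewrite -(ler_pM2r xy'0); apply: le_trans (C P Q x y x' y' AP AQ Px xy yQ Px' xy' yQ') _.
  rewrite -/E; move: G; rewrite ler_norml => /andP[_ G].
  have := ler_wpM2r (ltW c0) G.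
  have -> : e / (E * (y - x)) * (y' - x') * (E * (y - x)) = e * (y' - x').
    by field; apply/andP; split; exact: lt0r_neq0.
  lra.
- apply/ler_addgt0Pr => e ee.
  have [|x' [y' [Px' xy' yQ' G]]] := H (e / (y - x)); first by rewrite divr_gt0.
  have xy'0 : 0 < y' - x' by rewrite subr_gt0.
  rewrite -(ler_pM2r xy'0).
  have := C P Q x' y' x y AP AQ Px' xy' yQ' Px xy yQ; rewrite -/E => K.
  move: G; rewrite ler_norml => /andP[G _].
  have := ler_wpM2r (ltW xy0) G.
  have -> : - (e / (y - x) * (y' - x')) * (y - x) = - (e * (y' - x')).
    by field; exact: lt0r_neq0.
  lra.
Qed.

Definition belowA A s : set R := [set x | A x /\ x <= s].
Definition aboveA A s : set R := [set x | A x /\ s <= x].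

Lemma belowA_itv A s : is_interval A -> is_interval (belowA A s).
Proof.
move=> iA x y [Ax xs] [Ay ys] z /andP[xz zy]; split; last lra.
by apply: (iA x y); rewrite ?xz.
Qed.

Lemma aboveA_itv A s : is_interval A -> is_interval (aboveA A s).
Proof.
move=> iA x y [Ax xs] [Ay ys] z /andP[xz zy]; split; last lra.
by apply: (iA x y); rewrite ?xz.
Qed.

(** A chord on the left and a chord on the right are both comparable with the common derivative l at
    s, and the two factors multiply. *)
Lemma CR_glue A h s l m1 m2 : is_interval A -> A s ->
  sdiff (belowA A s) h s l -> sdiff (aboveA A s) h s l ->
  nd (belowA A s) m1 -> nd (aboveA A s) m2 ->
  CR (belowA A s) h m1 -> CR (aboveA A s) h m2 ->
  exists m, nd A m /\ CR A h m.
Proof.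
move=> iA As D1 D2 n1 n2 C1 C2.
have [l0 _] := D1.
(* Both functions are normalized to vanish at s, so the increment over a window around s is the sum
   of the two increments. *)
exists (fun x => if x <= s then m1 x - m1 s else m2 x - m2 s); split.
  have ss : s <= s by [].
  move=> x y Ax Ay xy; case: (leP x s) => [xs|sx]; case: (leP y s) => [ys|sy].
  - by rewrite lerD2r; apply: n1.
  - have := n1 x s (conj Ax xs) (conj As ss) xs.
    by have := n2 s y (conj As ss) (conj Ay (ltW sy)) (ltW sy); lra.
  - lra.
  - by rewrite lerD2r; apply: n2 => //; split=> //; exact: ltW.
move=> P Q x y x' y' AP AQ Px xy yQ Px' xy' yQ'.
case: (leP Q s) => [Qs|sQ].
  rewrite ifT; last lra.
  have -> : m1 Q - m1 s - (m1 P - m1 s) = m1 Q - m1 P by ring.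
  by apply: (C1 P Q) => //; split=> //; lra.
case: (leP P s) => [Ps|sP]; last first.
  have -> : m2 Q - m2 s - (m2 P - m2 s) = m2 Q - m2 P by ring.
  by apply: (C2 P Q) => //; split=> //; lra.
have ss : s <= s by [].
have BP : belowA A s P by []. have Bs : belowA A s s by split.
have Us : aboveA A s s by split. have UQ : aboveA A s Q by split=> //; exact: ltW.
have L1 := fun x y => @CR_slope _ h s l m1 P s x y (belowA_itv iA) D1 C1 BP Bs Ps ss.
have L2 := fun x y => @CR_slope _ h s l m2 s Q x y (aboveA_itv iA) D2 C2 Us UQ ss (ltW sQ).
have a1 : 1 <= expR (m1 s - m1 P).
  by apply: le_trans (expR_ge1Dx _); rewrite lerDl subr_ge0; exact: n1.
have b1 : 1 <= expR (m2 Q - m2 s).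
  by apply: le_trans (expR_ge1Dx _); rewrite lerDl subr_ge0; apply: n2 => //; exact: ltW.
have -> : m2 Q - m2 s - (m1 P - m1 s) = (m1 s - m1 P) + (m2 Q - m2 s) by ring.
rewrite expRD; set a := expR (m1 s - m1 P) in a1 L1 *; set b := expR (m2 Q - m2 s) in b1 L2 *.
have C1' : forall x y x' y', P <= x -> x < y -> y <= s -> P <= x' -> x' < y' -> y' <= s ->
   (h y - h x) * (y' - x') <= a * ((h y' - h x') * (y - x)) by move=> *; exact: (C1 P s).
have C2' : forall x y x' y', s <= x -> x < y -> y <= Q -> s <= x' -> x' < y' -> y' <= Q ->
   (h y - h x) * (y' - x') <= b * ((h y' - h x') * (y - x)) by move=> *; exact: (C2 s Q).
(* Chords that do not cross s. The desired inequality is additive in each of its two chords, so a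
   crossing chord is split at s. *)
pose pure x y := P <= x /\ x < y /\ y <= Q /\ (y <= s \/ s <= x).
have pureP x1 y1 : pure x1 y1 -> 0 < (h y1 - h x1) /\ 0 < y1 - x1.
  move=> [p1 [p2 [p3 p4]]]; have z : 0 < y1 - x1 by rewrite subr_gt0.
  split=> //; have z' : 0 < l * (y1 - x1) by rewrite mulr_gt0.
  case: p4 => p4.
  - have [_ H] := L1 _ _ p1 p2 p4; move: (lt_le_trans z' H).
    by rewrite pmulr_rgt0 //; lra.
  - have [_ H] := L2 _ _ p4 p2 p3; move: (lt_le_trans z' H).
    by rewrite pmulr_rgt0 //; lra.
have Hpure x1 y1 x2 y2 : pure x1 y1 -> pure x2 y2 ->
    (h y1 - h x1) * (y2 - x2) <= a * b * ((h y2 - h x2) * (y1 - x1)).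
  move=> P1 P2; have [H1 X1] := pureP _ _ P1; have [H2 X2] := pureP _ _ P2.
  have Z0 : 0 <= (h y2 - h x2) * (y1 - x1) by rewrite mulr_ge0 ?ltW.
  have [aab bab] : a <= a * b /\ b <= a * b by move: a1 b1; clear; split; nra.
  move: P1 P2 => [p1 [p2 [p3 [p4|p4]]]] [q1 [q2 [q3 [q4|q4]]]].
  - by apply: le_trans (C1' _ _ _ _ p1 p2 p4 q1 q2 q4) _; rewrite ler_wpM2r.
  - have [K1 _] := L1 _ _ p1 p2 p4; have [_ K2] := L2 _ _ q4 q2 q3.
    have := ler_wpM2r (ltW X2) K1; have a0 : 0 <= a * (y1 - x1) by rewrite mulr_ge0 ?expR_ge0 ?ltW.
    by have := ler_wpM2l a0 K2; clear; lra.
  - have [K1 _] := L2 _ _ p4 p2 p3; have [_ K2] := L1 _ _ q1 q2 q4.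
    have := ler_wpM2r (ltW X2) K1; have a0 : 0 <= b * (y1 - x1) by rewrite mulr_ge0 ?expR_ge0 ?ltW.
    by have := ler_wpM2l a0 K2; clear; lra.
  - by apply: le_trans (C2' _ _ _ _ p4 p2 p3 q4 q2 q3) _; rewrite ler_wpM2r.
have split2 x1 y1 : P <= x1 -> x1 < y1 -> y1 <= Q -> pure x1 y1 \/ (pure x1 s /\ pure s y1).
  move=> p1 p2 p3; rewrite /pure; case: (leP y1 s) => [ys|sy].
    by left; split=> //; split=> //; split=> //; left.
  case: (leP s x1) => [sx|xs].
    by left; split=> //; split=> //; split=> //; right.
  right; split; first by split=> //; split=> //; split; [exact: ltW|left].
  by split=> //; split=> //; split=> //; right.
have Hleft x1 y1 : pure x1 y1 -> (h y1 - h x1) * (y' - x') <= a * b * ((h y' - h x') * (y1 - x1)).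
  move=> p1; have [p2|[p2 p3]] := split2 _ _ Px' xy' yQ'; first exact: Hpure.
  by have := Hpure _ _ _ _ p1 p2; have := Hpure _ _ _ _ p1 p3; clear; lra.
have [p2|[p2 p3]] := split2 _ _ Px xy yQ; first exact: Hleft.
by have := Hleft _ _ p2; have := Hleft _ _ p3; clear; lra.
Qed.

Lemma sdiff_glue A h s l : is_interval A ->
  sdiff (belowA A s) h s l -> sdiff (aboveA A s) h s l -> sdiff A h s l.
Proof.
move=> iA [l0 D1] [_ D2]; split=> // e e0.
have [d1 d10 {}D1] := D1 _ e0; have [d2 d20 {}D2] := D2 _ e0.
exists (Num.min d1 d2); first by rewrite lt_min d10.
move=> x y [Ax]; rewrite lt_min => /andP[x1 x2] [Ay]; rewrite lt_min => /andP[y1 y2] xy.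
case: (leP y s) => [ys|sy].
  by apply: D1 => //; do !split=> //; lra.
case: (leP s x) => [sx|xs].
  by apply: D2 => //; do !split=> //; lra.
have As : A s by apply: (iA x y) => //; rewrite !ltW.
have s0 d : 0 < d -> `|s - s| < d by rewrite subrr normr0.
have H1 : `|h s - h x - l * (s - x)| <= e * (s - x).
  by apply: D1 => //; [split=> //; split=> //; exact: ltW|split; [split|exact: s0]].
have H2 : `|h y - h s - l * (y - s)| <= e * (y - s).
  by apply: D2 => //; [split; [split|exact: s0]|split=> //; split=> //; exact: ltW].
have -> : h y - h x - l * (y - x) = (h s - h x - l * (s - x)) + (h y - h s - l * (y - s)) by ring.
by apply: le_trans (ler_normD _ _) _; lra.
Qed.

Lemma tame_glue A h s l : is_interval A -> A s ->
  sdiff (belowA A s) h s l -> sdiff (aboveA A s) h s l ->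
  bvnear (belowA A s) h s -> bvnear (aboveA A s) h s -> tame A h s.
Proof.
move=> iA As D1 D2 [d1 d10 [m1 [n1 C1]]] [d2 d20 [m2 [n2 C2]]].
split; first by exists l; exact: sdiff_glue.
pose d := Num.min d1 d2; have d0 : 0 < d by rewrite lt_min d10.
have [L1 L2] : d <= d1 /\ d <= d2 by rewrite !ge_min !lexx orbT.
exists d => //.
have S1 : belowA (nbd A s d) s `<=` nbd (belowA A s) s d1.
  by move=> x [[Ax xd] xs]; split=> //; lra.
have S2 : aboveA (nbd A s d) s `<=` nbd (aboveA A s) s d2.
  by move=> x [[Ax xd] xs]; split=> //; lra.
apply: (@CR_glue _ h s l m1 m2).
- exact: nbd_itv.
- by split=> //; rewrite subrr normr0.
- by apply: sdiff_restrict D1; exists d => // x [[]].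
- by apply: sdiff_restrict D2; exists d => // x [[]].
- exact: sub_nd n1.
- exact: sub_nd n2.
- exact: sub_CR C1.
- exact: sub_CR C2.
Qed.

Lemma sdiff_affine A a b s : 0 < a -> sdiff A (fun x => a * x + b) s a.
Proof.
move=> a0; split=> // e e0; exists 1 => // x y _ _ xy.
have -> : a * y + b - (a * x + b) - a * (y - x) = 0 by ring.
by rewrite normr0 mulr_ge0 ?subr_ge0 ?ltW.
Qed.

Lemma bvnear_affine A a b s : 0 < a -> bvnear A (fun x => a * x + b) s.
Proof.
move=> a0; exists 1 => //; exists (fun=> 0); split; first by [].
by move=> p q x y x' y' *; rewrite subrr expR0 mul1r le_eqVlt; apply/orP; left; apply/eqP; ring.
Qed.

Lemma tame_affine A a b s : 0 < a -> tame A (fun x => a * x + b) s.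
Proof. by move=> a0; split; [exists a; exact: sdiff_affine|exact: bvnear_affine]. Qed.

Lemma sdiff_mirror A h s l : sdiff A h s l ->
  sdiff [set x | A (- x)] (fun x => - h (- x)) (- s) l.
Proof.
move=> [l0 D]; split=> // e /D[d d0 {}D]; exists d => // x y [Ax xd] [Ay yd] xy.
have N z : `|z - - s| < d -> `|- z - s| < d by rewrite -normrN opprD opprK.
have /= := D (- y) (- x) (conj Ay (N _ yd)) (conj Ax (N _ xd)).
rewrite ltrN2 => /(_ xy).
have -> : - x - - y = y - x by ring.
by have -> : h (- x) - h (- y) = - h (- y) - - h (- x) by ring.
Qed.

Lemma bvnear_mirror A h s : bvnear A h s -> bvnear [set x | A (- x)] (fun x => - h (- x)) (- s).
Proof.
move=> [d d0 [m [n C]]]; exists d => //; exists (fun x => - m (- x)).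
have N z : `|z - - s| < d -> `|- z - s| < d by rewrite -normrN opprD opprK.
split.
  move=> x y [Ax xd] [Ay yd] xy; rewrite lerN2; apply: n; try by split=> //; exact: N.
  by rewrite lerN2.
move=> p q x y x' y' [Ap pd] [Aq qd] px xy yq px' xy' yq'.
have := C (- q) (- p) (- y) (- x) (- y') (- x') (conj Aq (N _ qd)) (conj Ap (N _ pd)).
rewrite !lerN2 !ltrN2 => /(_ yq xy px yq' xy' px').
have -> : m (- p) - m (- q) = - m (- q) - - m (- p) by ring.
have -> : - x - - y = y - x by ring.
have -> : - x' - - y' = y' - x' by ring.
have -> : h (- x) - h (- y) = - h (- y) - - h (- x) by ring.
by have -> : h (- x') - h (- y') = - h (- y') - - h (- x') by ring.
Qed.

Lemma tame_mirror A h s : tame A h s -> tame [set x | A (- x)] (fun x => - h (- x)) (- s).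
Proof. by move=> [[l /sdiff_mirror ?] /bvnear_mirror ?]; split=> //; exists l. Qed.

End Tame.

(** * Homeomorphisms of the line *)

Record homeo (R : realType) := Homeo { homeo_bijn :> bijn R; hmono : {mono homeo_bijn : x y / x <= y} }.

Section HomeoGroup.
Variable R : realType.
Implicit Types f g h : homeo R.

Lemma homeoP f g : f =1 g -> f = g.
Proof.
case: f g => f fm [g gm] /= /bijnP E; subst g.
by congr Homeo; exact: Prop_irrelevance.
Qed.

HB.instance Definition _ := gen_eqMixin (homeo R).
HB.instance Definition _ := gen_choiceMixin (homeo R).

Lemma homeo_mul_subproof f g : {mono bijn_mul f g : x y / x <= y}.
Proof. by move=> x y /=; rewrite !hmono. Qed.
Lemma homeo_one_subproof : {mono bijn_one R : x y / x <= y}.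
Proof. by []. Qed.
Lemma homeo_inv_subproof f : {mono bijn_inv f : x y / x <= y}.
Proof. by move=> x y /=; rewrite -{2}[x](bgK f) -{2}[y](bgK f) hmono. Qed.

Definition homeo_mul f g := Homeo (homeo_mul_subproof f g).
Definition homeo_one := Homeo homeo_one_subproof.
Definition homeo_inv f := Homeo (homeo_inv_subproof f).

Lemma homeo_mulA : associative homeo_mul. Proof. by move=> f g h; exact: homeoP. Qed.
Lemma homeo_mul1g : left_id homeo_one homeo_mul. Proof. by move=> f; exact: homeoP. Qed.
Lemma homeo_mulg1 : right_id homeo_one homeo_mul. Proof. by move=> f; exact: homeoP. Qed.
Lemma homeo_mulVg : left_inverse homeo_one homeo_inv homeo_mul.
Proof. by move=> f; apply: homeoP => x /=; rewrite bfK. Qed.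
Lemma homeo_mulgV : right_inverse homeo_one homeo_inv homeo_mul.
Proof. by move=> f; apply: homeoP => x /=; rewrite bgK. Qed.

HB.instance Definition _ := isGroup.Build (homeo R)
  homeo_mulA homeo_mul1g homeo_mulg1 homeo_mulVg homeo_mulgV.

Lemma homeoM f g x : (f * g)%g x = f (g x). Proof. by []. Qed.
Lemma homeo1 x : (1%g : homeo R) x = x. Proof. by []. Qed.
Lemma homeoK f x : (f^-1)%g (f x) = x. Proof. exact: bfK. Qed.
Lemma homeoKV f x : f ((f^-1)%g x) = x. Proof. exact: bgK. Qed.
Lemma homeoX f n x : (f ^+ n)%g x = iter n f x.
Proof. by elim: n => // n IH; rewrite expgS homeoM IH. Qed.
Lemma homeo_le f x y : (f x <= f y) = (x <= y). Proof. exact: hmono. Qed.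
Lemma homeo_lt f x y : (f x < f y) = (x < y). Proof. exact: (leW_mono (@hmono _ f)). Qed.
Lemma homeo_inj f : injective f. Proof. exact: (can_inj (@bfK _ f)). Qed.
Lemma homeoV_fix f x : f x = x -> (f^-1)%g x = x.
Proof. by move=> E; rewrite -{1}E homeoK. Qed.
Lemma homeoX_fix f n x : f x = x -> (f ^+ n)%g x = x.
Proof. by move=> E; rewrite homeoX; elim: n => //= n ->. Qed.

Lemma homeoX_fix_inv f n x : (0 < n)%N -> (f ^+ n)%g x = x -> f x = x.
Proof.
case: n => // n _; rewrite homeoX; case: (ltgtP (f x) x) => // fx E; exfalso.
- suff : iter n.+1 f x < x by rewrite E ltxx.
  elim: n {E} => // n IH; rewrite iterS; apply: lt_trans fx.
  by rewrite homeo_lt.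
- suff : x < iter n.+1 f x by rewrite E ltxx.
  elim: n {E} => // n IH; rewrite iterS; apply: (lt_trans fx).
  by rewrite homeo_lt.
Qed.

Definition per f := forall x, f (x + 1) = f x + 1.

Lemma perN f : per f -> forall n x, f (x + n%:R) = f x + n%:R.
Proof.
move=> pf; elim=> [|n IH] x; first by rewrite !addr0.
by rewrite -natr1 addrA pf IH addrA.
Qed.

Lemma perZ f : per f -> forall (k : int) x, f (x + k%:~R) = f x + k%:~R.
Proof.
move=> pf [n|n] x; first exact: perN.
rewrite NegzE mulrNz; apply: (addIr (n.+1%:R)).
by rewrite -(perN pf) !subrK.
Qed.

Lemma per1 : per 1%g. Proof. by []. Qed.
Lemma perM f g : per f -> per g -> per (f * g)%g.
Proof. by move=> pf pg x; rewrite !homeoM pg pf. Qed.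
Lemma perV f : per f -> per (f^-1)%g.
Proof. by move=> pf x; apply: (@homeo_inj f); rewrite pf !homeoKV. Qed.
Lemma perX f n : per f -> per (f ^+ n)%g.
Proof. by move=> pf; elim: n => [|n IH]; rewrite ?expgS; [exact: per1|exact: perM]. Qed.

Definition seg (a b : R) : set R := [set x | a <= x <= b].

Lemma seg_itv a b : is_interval (seg a b).
Proof. by move=> x y /andP[? ?] /andP[? ?] z /andP[? ?]; apply/andP; split; lra. Qed.

Definition bv f := forall a b, a <= b -> exists m, nd (seg a b) m /\ CR (seg a b) f m.

Lemma tame_bv f : (forall s, tame setT f s) -> bv f.
Proof.
move=> tf a b ab.
apply: (@local_to_global _ (fun p q => exists m, nd (seg p q) m /\ CR (seg p q) f m)) => //.
- move=> p q r ap pq qr rb [m1 [n1 C1]] [m2 [n2 C2]].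
  have [[l D] _] := tf q.
  have DA A : sdiff A f q l by apply: sdiff_restrict D; exists 1.
  have S1 : belowA (seg p r) q `<=` seg p q.
    by move=> x [/andP[? ?] ?]; apply/andP; split.
  have S2 : aboveA (seg p r) q `<=` seg q r.
    by move=> x [/andP[? ?] ?]; apply/andP; split.
  apply: (@CR_glue _ (seg p r) f q l m1 m2) => //.
  + exact: seg_itv.
  + by rewrite /seg /= pq qr.
  + exact: sub_nd n1.
  + exact: sub_nd n2.
  + exact: sub_CR C1.
  + exact: sub_CR C2.
- move=> s _; have [_ [d d0 [m [n C]]]] := tf s; exists d => // p q _ _ _ sp qs.
  have S : seg p q `<=` nbd setT s d.
    by move=> x /andP[? ?]; split=> //; rewrite ltr_norml; apply/andP; split; lra.
  by exists m; split; [exact: sub_nd n|exact: sub_CR C].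
Qed.

(** Uniform continuity of log f' stated on chords: d does not depend on the place u of the
    window. *)
Definition uc f := forall e : R, 0 < e -> exists2 d : R, 0 < d & forall u x y x' y' : R,
  u <= x -> x < y -> y <= u + d -> u <= x' -> x' < y' -> y' <= u + d ->
  (f y - f x) * (y' - x') <= (1 + e) * ((f y' - f x') * (y - x)).

Lemma sdiff_chord A h s l e : sdiff A h s l -> 0 < e -> exists2 d, 0 < d &
  forall x y x' y' : R, nbd A s d x -> nbd A s d y -> x < y ->
   nbd A s d x' -> nbd A s d y' -> x' < y' ->
  (h y - h x) * (y' - x') <= (1 + e) * ((h y' - h x') * (y - x)).
Proof.
move=> [l0 D] e0; have e20 : 0 < e + 2 by lra.
(* The tolerance t = l e / (e + 2) solves (1 + e)(l - t) = l + t, where l - t and l + t are the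
   extreme slopes. *)
have [|d d0 {}D] := D (l * e / (e + 2)); first by rewrite divr_gt0 // mulr_gt0.
exists d => // x y x' y' nx ny xy nx' ny' xy'.
have := D _ _ nx ny xy; have := D _ _ nx' ny' xy'.
rewrite !ler_norml => /andP[H' _] /andP[_ H].
have X0 : 0 < y - x by rewrite subr_gt0.
have X0' : 0 < y' - x' by rewrite subr_gt0.
have E : (1 + e) * (l - l * e / (e + 2)) = l + l * e / (e + 2) by field; exact: lt0r_neq0.
set t := l * e / (e + 2) in H H' E *.
have K : (h y - h x) * (y' - x') <= (l + t) * (y - x) * (y' - x').
  by rewrite ler_pM2r //; lra.
have K' : (l - t) * (y' - x') * (y - x) <= (h y' - h x') * (y - x).
  by rewrite ler_pM2r //; lra.
have e1 : 0 <= 1 + e by lra.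
have := ler_wpM2l e1 K'; have -> : (1 + e) * ((l - t) * (y' - x') * (y - x)) =
   ((1 + e) * (l - t)) * (y' - x') * (y - x) by ring.
by rewrite E; lra.
Qed.

Lemma sdiff_uc f : per f -> (forall s, exists l, sdiff setT f s l) -> uc f.
(* The predicate P below confines only the left end u of a window to [p, q]; up to an integer
   translation every window then starts in [0, 1]. *)
Proof.
move=> pf Df e e0.
pose P (p q : R) := exists2 d : R, 0 < d & forall u x y x' y' : R,
  p <= u -> u <= q ->
  u <= x -> x < y -> y <= u + d -> u <= x' -> x' < y' -> y' <= u + d ->
  (f y - f x) * (y' - x') <= (1 + e) * ((f y' - f x') * (y - x)).
have [d d0 H] : P 0 1.
  apply: local_to_global => //.
  - move=> p q r _ pq qr _ [d d0 H] [d' d'0 H'].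
    exists (Num.min d d'); first by rewrite lt_min d0.
    have [L L'] : Num.min d d' <= d /\ Num.min d d' <= d' by rewrite !ge_min !lexx orbT.
    move=> u x y x' y' pu ur *; case: (leP u q) => uq.
      by apply: (H u) => //; lra.
    by apply: (H' u) => //; lra.
  - move=> s _; have [l Ds] := Df s; have [d d0 H] := sdiff_chord Ds e0.
    exists (d / 2); first by rewrite divr_gt0.
    move=> p q _ pq _ sp qs; exists (d / 2); first by rewrite divr_gt0.
    have near u z : p <= u -> u <= q -> u <= z -> z <= u + d / 2 -> nbd setT s d z.
      by move=> *; split=> //; rewrite ltr_norml; apply/andP; split; lra.
    move=> u x y x' y' pu uq ux xy yu ux' xy' yu'.
    have [x1 y1] := (ltW (lt_le_trans xy yu), ltW (le_lt_trans ux xy)).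
    have [x2 y2] := (ltW (lt_le_trans xy' yu'), ltW (le_lt_trans ux' xy')).
    by apply: H => //; exact: (near u).
exists d => // u x y x' y' ux xy yu ux' xy' yu'.
pose k : int := - Num.floor u.
have T z : f z = f (z + k%:~R) - k%:~R by rewrite perZ // addrK.
rewrite (T x) (T y) (T x') (T y').
have E (a b : R) : a - k%:~R - (b - k%:~R) = a - b by ring.
rewrite !E.
have -> : y' - x' = (y' + k%:~R) - (x' + k%:~R) by ring.
have -> : y - x = (y + k%:~R) - (x + k%:~R) by ring.
have K1 : u + k%:~R = u - (Num.floor u)%:~R by rewrite mulrNz.
have F1 := floor_le u; have F2 := floorD1_gt u.
rewrite intrD in F2.
by apply: (H (u + k%:~R)); rewrite ?lerD2r ?ltrD2r //; rewrite ?K1; lra.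
Qed.

End HomeoGroup.

(** * Kopell's lemma *)

Section Kopell.
Variable R : realType.
Implicit Types (f h : homeo R) (m : R -> R) (a b : R).

Lemma int_translate (z a : R) : exists k : int, a <= z + k%:~R < a + 1.
Proof.
exists (- Num.floor (z - a)); rewrite mulrNz.
by have /andP[] := floor_itv (z - a); rewrite intrD => ? ?; apply/andP; split; lra.
Qed.

Lemma sum_disjoint_seg m (s : seq (R * R)) p q : p <= q -> nd (seg p q) m ->
  all (fun i => [&& p <= i.1, i.1 <= i.2 & i.2 <= q]) s ->
  pairwise (fun i j => (i.2 <= j.1) || (j.2 <= i.1)) s ->
  \sum_(i <- s) (m i.2 - m i.1) <= m q - m p.
Proof.
have [n] := ubnP (size s); elim: n => // n IH in s p q *.
case: s => [|i s] /=; rewrite ?ltnS => sn pq ndm.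
  by rewrite big_nil subr_ge0 ndm // /seg /= lexx ?pq.
move=> /andP[/and3P[pi ii iq] als] /andP[ali pws].
rewrite big_cons (bigID (fun j => j.2 <= i.1)) /=.
rewrite -[X in _ + (X + _)]big_filter -[X in _ + (_ + X)]big_filter.
have sub (P : pred (R * R)) : (size [seq x <- s | P x] < n)%N.
  by rewrite size_filter; apply: leq_ltn_trans sn; exact: count_size.
have H1 : \sum_(j <- [seq j <- s | j.2 <= i.1]) (m j.2 - m j.1) <= m i.1 - m p.
  apply: (IH _ _ _ (sub _)) => //.
  - by apply: sub_nd ndm => x /andP[? ?]; apply/andP; split; lra.
  - rewrite all_filter; apply: sub_all als => j /= /and3P[-> -> _].
    by apply/implyP.
  - exact: pairwise_filter.
have H2 : \sum_(j <- [seq j <- s | ~~ (j.2 <= i.1)]) (m j.2 - m j.1) <= m q - m i.2.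
  apply: (IH _ _ _ (sub _)) => //.
  - by apply: sub_nd ndm => x /andP[? ?]; apply/andP; split; lra.
  - rewrite all_filter; apply/allP => j js; apply/implyP => nj.
    have /and3P[_ -> ->] := allP als _ js; rewrite !andbT.
    by have := allP ali _ js; rewrite (negPf nj) orbF.
  - exact: pairwise_filter.
lra.
Qed.

Section Contraction.
Variables (f h : homeo R) (a b : R).
Hypotheses (pf : per f) (ph : per h) (bvf : bv f) (uch : forall n, uc (h ^+ n)%g).
Hypotheses (fh : (f * h = h * f)%g) (ab : a < b) (ba1 : b <= a + 1).
Hypotheses (ha : h a = a) (hb : h b = b).
Hypothesis disj : forall i j (k : int), (i < j)%N ->
  (f ^+ j)%g b + k%:~R <= (f ^+ i)%g a \/ (f ^+ i)%g b <= (f ^+ j)%g a + k%:~R.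

Let iterh n x : (f ^+ n)%g (h x) = h ((f ^+ n)%g x).
Proof.
have F y : f (h y) = h (f y) by rewrite -!homeoM fh.
by rewrite !homeoX; elim: n => // n IH; rewrite !iterS IH F.
Qed.


(** The translation that brings the i-th image of [a, b] into the period [a, a + 1]. *)
Let kk (i : nat) : int := if i is 0%N then 0 else
  projT1 (cid (int_translate ((f ^+ i)%g a) a)).
Let lo i := (f ^+ i)%g a + (kk i)%:~R.
Let hi i := (f ^+ i)%g b + (kk i)%:~R.

Lemma kopell_window i : [&& a <= lo i, lo i <= hi i & hi i <= a + 1].
Proof.
rewrite /lo /hi; case: i => [|i]; first by rewrite /= addr0 lexx addr0 ba1 ltW.
rewrite lerD2r homeo_le (ltW ab) /=.
rewrite /kk; case: cid => k /= /andP[k1 k2]; rewrite k1 /=.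
have E (K : R) : K = k%:~R -> (k - 1)%:~R = K - (1 : R) by move=> ->; rewrite intrB.
(* The other alternative would put the translated image to the right of b + 1, although its left end
   is below a + 1. *)
have [] := @disj 0 i.+1 (k - 1) isT; rewrite expg0 !homeo1 (E _ erefl); have := ab; lra.
Qed.

Lemma kopell_pairwise n : pairwise (fun i j : R * R => (i.2 <= j.1) || (j.2 <= i.1))
  [seq (lo i, hi i) | i <- iota 0 n].
Proof.
rewrite pairwise_map; have := iota_ltn_sorted 0 n; rewrite (sorted_pairwise ltn_trans).
apply: sub_pairwise => i j /= ij; rewrite /lo /hi.
have E : (kk j - kk i)%:~R = (kk j)%:~R - (kk i)%:~R :> R by rewrite intrB.
have [] := @disj i j (kk j - kk i) ij; rewrite E => H; apply/orP; [right|left]; lra.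
Qed.

Lemma kopell_sum m n : nd (seg a (a + 1)) m ->
  \sum_(0 <= i < n) (m (hi i) - m (lo i)) <= m (a + 1) - m a.
Proof.
move=> ndm; have := @sum_disjoint_seg m _ a (a + 1) _ ndm _ (kopell_pairwise n).
rewrite big_map => H.
have -> : \sum_(0 <= i < n) (m (hi i) - m (lo i)) = \sum_(j <- iota 0 n) (m (hi j) - m (lo j)).
  by rewrite /index_iota subn0.
apply: H; first by rewrite lerDl.
by rewrite all_map; apply/allP => i _ /=; exact: kopell_window.
Qed.

Lemma kopell_small d : 0 < d -> exists n, (f ^+ n)%g b - (f ^+ n)%g a < d.
Proof.
move=> d0; apply: contrapT => /forallNP H.
have K n : n%:R * d <= 1.
  (* With m the identity the sum is that of the lengths of the images, bounded by the length 1 of a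
     period. *)
  have /= := @kopell_sum id n (fun x y _ _ xy => xy).
  rewrite [a + 1]addrC addrK; apply: le_trans.
  rewrite mulr_natl -[n in d *+ n]subn0 -sumr_const_nat; apply: ler_sum => i _.
  by move: (H i) => /negP; rewrite -leNgt /lo /hi; lra.
have := archi_boundP (ltW (divr_gt0 ltr01 d0)).
by rewrite ltr_pdivrMr // => /lt_le_trans/(_ (K _)); rewrite ltxx.
Qed.

(** The distortion of f^n on [a, b] is the product of the distortions of f on the successive images.
    These are disjoint modulo integers, so the exponents add up to at most the variation over one
    period, whatever n is. *)
Lemma kopell_distortion m n x y x' y' : nd (seg a (a + 1)) m -> CR (seg a (a + 1)) f m ->
  a <= x -> x < y -> y <= b -> a <= x' -> x' < y' -> y' <= b ->
  ((f ^+ n)%g y - (f ^+ n)%g x) * (y' - x') <=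
   expR (m (a + 1) - m a) * (((f ^+ n)%g y' - (f ^+ n)%g x') * (y - x)).
Proof.
move=> ndm Cm ax xy yb ax' xy' yb'.
have X0 : 0 < y - x by rewrite subr_gt0.
have X0' : 0 < y' - x' by rewrite subr_gt0.
have U0 i : 0 < (f ^+ i)%g y' - (f ^+ i)%g x' by rewrite subr_gt0 homeo_lt.
suff H : ((f ^+ n)%g y - (f ^+ n)%g x) * (y' - x') <=
   expR (\sum_(0 <= i < n) (m (hi i) - m (lo i))) * (((f ^+ n)%g y' - (f ^+ n)%g x') * (y - x)).
  apply: le_trans H _; apply: ler_wpM2r; first by rewrite mulr_ge0 // ltW.
  by rewrite ler_expR kopell_sum.
elim: n => [|n IH]; first by rewrite big_nil expR0 mul1r !expg0 !homeo1 mulrC.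
rewrite big_nat_recr //= expRD.
rewrite expgS !homeoM.
have /and3P[w1 w2 w3] := kopell_window n.
pose k := (kk n)%:~R : R.
have L z : a <= z -> z <= b -> lo n <= (f ^+ n)%g z + k /\ (f ^+ n)%g z + k <= hi n.
  by move=> az zb; rewrite /lo /hi !lerD2r !homeo_le.
have := Cm (lo n) (hi n) ((f ^+ n)%g x + k) ((f ^+ n)%g y + k)
  ((f ^+ n)%g x' + k) ((f ^+ n)%g y' + k).
rewrite !(perZ pf) !ltrD2r !homeo_lt.
have [l1 l2] := L x ax (ltW (lt_le_trans xy yb)).
have [l3 l4] := L y (le_trans ax (ltW xy)) yb.
have [l5 l6] := L x' ax' (ltW (lt_le_trans xy' yb')).
have [l7 l8] := L y' (le_trans ax' (ltW xy')) yb'.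
have s1 : seg a (a + 1) (lo n) by rewrite /seg /= w1 (le_trans w2 w3).
have s2 : seg a (a + 1) (hi n) by rewrite /seg /= w3 (le_trans w1 w2).
move=> /(_ s1 s2 l1 xy l4 l5 xy' l8).
have D (u v : R) : u + k - (v + k) = u - v by ring.
rewrite -/k !D; set M := m (hi n) - m (lo n); set S := \sum_(_ <= _ < _) _ in IH *.
have V0 := U0 n; have V1 : 0 < f ((f ^+ n)%g y') - f ((f ^+ n)%g x').
  by rewrite subr_gt0 !homeo_lt.
have E0 := expR_gt0 M; have E1 := expR_gt0 S => H.
rewrite -(ler_pM2r V0).
have IH' := ler_wpM2l (mulr_ge0 (ltW E0) (ltW V1)) IH.
have H' := ler_wpM2r (ltW X0') H.
lra.
Qed.

(* Conjugation by f^n shrinks [a, b] to a place where h^k is almost an isometry;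
   as f^n has bounded distortion on [a, b], no h^k contracts there by a large factor. *)
Lemma kopell_up x : a <= x -> x <= b -> h x <= x.
Proof.
move=> ax xb; case: leP => // xh; exfalso.
have a1 : a <= a + 1 by rewrite lerDl.
have [m [ndm Cm]] := bvf a1.
set K := expR (m (a + 1) - m a); have K0 : 0 < K by exact: expR_gt0.
have hk k : a <= (h ^+ k)%g x /\ (h ^+ k)%g x <= b.
  by rewrite -{1}(homeoX_fix k ha) -{1}(homeoX_fix k hb) !homeo_le.
have hxb : h x <= b by have [] := hk 1%N.
have ahx : a <= h x by rewrite (le_trans ax) ?ltW.
have hkx k : (h ^+ k)%g (h x) = (h ^+ k.+1)%g x by rewrite expgSr.
have lk k : (h ^+ k)%g x < (h ^+ k.+1)%g x by rewrite -hkx homeo_lt.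
have key k : h x - x <= 2 * K * ((h ^+ k.+1)%g x - (h ^+ k)%g x).
  have [d d0 U] := uch k ltr01.
  have [n nd'] := kopell_small d0.
  have fhk z : (f ^+ n)%g ((h ^+ k)%g z) = (h ^+ k)%g ((f ^+ n)%g z).
    elim: k {U} z => [|k IH] z; first by rewrite expg0.
    by rewrite [(h ^+ _.+1)%g]expgS !homeoM iterh IH.
  have fixe z : h z = z -> (h ^+ k)%g ((f ^+ n)%g z) = (f ^+ n)%g z.
    by move=> hz; rewrite -fhk (homeoX_fix k hz).
  (* h^k fixes both ends of f^n [a, b], so it has slope 1 along that whole interval. As the interval
     is shorter than d, the slope of h^k on its part from f^n x to f^n (h x) is at least 1/2. *)
  have := U ((f ^+ n)%g a) ((f ^+ n)%g a) ((f ^+ n)%g b) ((f ^+ n)%g x) ((f ^+ n)%g (h x)).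
  rewrite lexx !homeo_lt !homeo_le ab ax xh.
  have fb : (f ^+ n)%g b <= (f ^+ n)%g a + d by lra.
  have fhx : (f ^+ n)%g (h x) <= (f ^+ n)%g a + d.
    by apply: le_trans fb; rewrite homeo_le.
  move=> /(_ isT isT fb isT isT fhx); rewrite !(fixe a) // !(fixe b) // -!fhk hkx.
  have L0 : 0 < (f ^+ n)%g b - (f ^+ n)%g a by rewrite subr_gt0 homeo_lt.
  rewrite mulrC mulrA ler_pM2r // => H1.
  have [ak kb] := hk k; have [ak1 k1b] := hk k.+1.
  have H2 := kopell_distortion n ndm Cm ak (lk k) k1b ax xh hxb.
  rewrite -/K in H2; set J := h x - x in H2 *; set Jk := (h ^+ k.+1)%g x - (h ^+ k)%g x in H2 *.
  set FJ := (f ^+ n)%g (h x) - _ in H1 H2; set FJk := (f ^+ n)%g _ - (f ^+ n)%g _ in H1 H2.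
  have J0 : 0 < J by rewrite subr_gt0.
  have FJ0 : 0 < FJ by rewrite subr_gt0 homeo_lt.
  rewrite -(ler_pM2r FJ0).
  have := ler_wpM2r (ltW J0) H1; lra.
have J0 : 0 < h x - x by rewrite subr_gt0.
(* By [key] the steps of the orbit of x under h stay above a fixed positive length, yet they add up
   to at most b - a. *)
have tot n : n%:R * (h x - x) <= 2 * K * (b - a).
  apply: (@le_trans _ _ (2 * K * ((h ^+ n)%g x - x))).
    elim: n => [|n IH]; first by rewrite mul0r expg0 homeo1 subrr mulr0.
    by rewrite -natr1 mulrDl mul1r; have := key n; lra.
  by rewrite ler_pM2l ?mulr_gt0 //; have [] := hk n; lra.
have B0 : 0 <= 2 * K * (b - a) / (h x - x).
  by rewrite divr_ge0 ?mulr_ge0 // ?subr_ge0 ?ltW.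
have := archi_boundP B0; rewrite ltr_pdivrMr //.
by move=> /lt_le_trans/(_ (tot _)); rewrite ltxx.
Qed.

End Contraction.

Lemma kopell f h a b : per f -> per h -> bv f ->
  (forall n, uc (h ^+ n)%g) -> (forall n, uc (h^-1 ^+ n)%g) ->
  (f * h = h * f)%g -> a < b -> b <= a + 1 -> h a = a -> h b = b ->
  (forall i j (k : int), (i < j)%N ->
    (f ^+ j)%g b + k%:~R <= (f ^+ i)%g a \/ (f ^+ i)%g b <= (f ^+ j)%g a + k%:~R) ->
  forall x, a <= x -> x <= b -> h x = x.
Proof.
move=> pf ph bvf uh uhV fh ab ba1 ha hb disj x ax xb; apply/le_anti/andP; split.
  by apply: (@kopell_up f h a b).
have fhV : commute f h^-1.
  exact: commuteV.
have H : (h^-1)%g x <= x.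
  by apply: (@kopell_up f _ a b) => //; apply: homeoV_fix.
by rewrite -(homeo_le (h^-1)%g) homeoK.
Qed.

End Kopell.

(** * Gaps of fixed point sets and Hölder's theorem *)

Section Gaps.
Variable R : realType.
Implicit Types (f g h : homeo R) (H : homeo R -> Prop) (x y z l : R).

Definition fixes H (z : R) := forall h, H h -> h z = z.

Lemma fixes_translate H z (k : int) : (forall h, H h -> per h) -> fixes H z -> fixes H (z + k%:~R).
Proof. by move=> pH fz h Hh; rewrite (perZ (pH _ Hh)) fz. Qed.

(** a and b are the nearest common fixed points on either side of x. They are fixed by monotonicity:
    every h in H satisfies a <= h a, and so does its inverse. The bound b <= a + 1 holds since a + 1
    is fixed too. *)
Lemma fixes_gap H x : (forall h, H h -> per h) -> (forall h, H h -> H (h^-1)%g) ->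
  (exists z, fixes H z) -> ~ fixes H x -> exists a b : R,
  [/\ a < x, x < b, b <= a + 1, fixes H a & fixes H b /\ forall y, a < y -> y < b -> ~ fixes H y].
Proof.
move=> pH HV [z fz] nfx.
pose S := [set y | y <= x /\ fixes H y]; pose U := [set y | x <= y /\ fixes H y].
have hS : has_sup S.
  split; last by exists x => y [].
  have [k /andP[_ k2]] := int_translate z (x - 1).
  by exists (z + k%:~R); split; [lra|exact: fixes_translate].
have hU : has_inf U.
  split; last by exists x => y [].
  have [k /andP[k1 _]] := int_translate z x.
  by exists (z + k%:~R); split; [lra|exact: fixes_translate].
set a := sup S; set b := inf U.
have Sle y : S y -> y <= a by exact: sup_upper_bound.
have Uge y : U y -> b <= y by apply: ge_inf; case: hU.
have le_a h : H h -> a <= h a.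
  move=> Hh; apply: ge_sup; first by case: hS.
  by move=> y Sy; have [_ fy] := Sy; rewrite -(fy h Hh) homeo_le; exact: Sle.
have ge_b h : H h -> h b <= b.
  move=> Hh; apply: lb_le_inf; first by case: hU.
  by move=> y Uy; have [_ fy] := Uy; rewrite -(fy h Hh) homeo_le; exact: Uge.
have fa : fixes H a.
  move=> h Hh; apply/le_anti; rewrite le_a // andbT.
  by rewrite -(homeo_le (h^-1)%g) homeoK; apply: le_a; exact: HV.
have fb : fixes H b.
  move=> h Hh; apply/le_anti; rewrite ge_b //=.
  by rewrite -(homeo_le (h^-1)%g) homeoK; apply: ge_b; exact: HV.
have ax : a < x.
  rewrite lt_neqAle; apply/andP; split; last by apply: ge_sup; [case: hS|move=> y []].
  by apply/eqP => E; apply: nfx; rewrite -E.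
have xb : x < b.
  rewrite lt_neqAle; apply/andP; split; last by apply: lb_le_inf; [case: hU|move=> y []].
  by apply/eqP => E; apply: nfx; rewrite E.
exists a, b; split=> //.
- apply: Uge; split; last exact: (@fixes_translate H a 1).
  case: leP => // a1x; have /Sle : S (a + 1).
    by split; [exact: ltW|exact: (@fixes_translate H a 1)].
  by rewrite gerDl lt_geF.
- split=> // y ay yb fy; case: (leP y x) => [yx|/ltW xy].
  + by have /Sle : S y by []; rewrite leNgt ay.
  + by have /Uge : U y by []; rewrite leNgt yb.
Qed.

Lemma homeo_gap h x : per h -> (exists z, h z = z) -> h x <> x -> exists a b : R,
  [/\ a < x, x < b, b <= a + 1, h a = a & h b = b /\ forall y, a < y -> y < b -> h y <> y].
Proof.
move=> ph [z hz] hx; pose H g := g = h \/ g = (h^-1)%g.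
have E y : fixes H y <-> h y = y.
  by split=> [|hy g [->//|->]]; [apply; left|exact: homeoV_fix].
have [||||a [b [ax xb ba fa [fb nf]]]] := @fixes_gap H x.
- by move=> g [->//|->]; exact: perV.
- by move=> g [->|->]; [right|left; rewrite invgK].
- by exists z; apply/E.
- by move/E.
exists a, b; split=> //; first by apply/E.
by split=> [|y ay yb /E]; [apply/E|exact: nf].
Qed.

(** Some translate z' of z lies in [l, l + 1), so f l lies between z' - 1 and z'; hence |k| < 1. *)
Lemma fix_int_eq0 f z l (k : int) : per f -> f z = z -> f l = l + k%:~R -> k = 0.
Proof.
move=> pf fz fl; have [j /andP[j1 j2]] := int_translate z l.
set z' := z + j%:~R in j1 j2.
have fz' : f z' = z' by rewrite perZ // fz.
have H1 : f l <= z' by rewrite -fz' homeo_le.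
have H2 : z' - 1 < f l.
  have E : f (z' - 1) = z' - 1 by apply: (addIr 1); rewrite -pf subrK.
  by rewrite -E homeo_lt; lra.
have k1 : k%:~R < 1%:~R :> R by rewrite mulr1z; lra.
have k2 : (-1)%:~R < k%:~R :> R by rewrite mulrNz mulr1z; lra.
by move: k1 k2; rewrite !ltr_int; lia.
Qed.

End Gaps.

Section GapPeriodic.
Variables (R : realType) (T : homeo R -> Prop).
Hypotheses (TM : forall f g, T f -> T g -> T (f * g)%g) (T1 : T 1%g).
Hypotheses (TV : forall f, T f -> T (f^-1)%g).
Hypotheses (Tper : forall f, T f -> per f) (Tuc : forall f, T f -> uc f).
Hypotheses (Tbv : forall f, T f -> bv f).
Implicit Types (f g h : homeo R) (a b x y z : R).

Lemma TX f n : T f -> T (f ^+ n)%g.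
Proof. by move=> Tf; elim: n => [|n IH]; rewrite ?expgS //; exact: TM. Qed.

(** As f commutes with h it permutes the gaps of h, so two images of (a, b) are equal or disjoint
    modulo integers. Were they all disjoint, Kopell's lemma would make h trivial on the gap. *)
Lemma gap_periodic f h a b : T f -> T h -> commute f h -> a < b -> b <= a + 1 ->
  h a = a -> h b = b -> (forall y, a < y -> y < b -> h y <> y) ->
  exists n (k : int), [/\ (0 < n)%N, (f ^+ n)%g a = a + k%:~R & (f ^+ n)%g b = b + k%:~R].
Proof.
move=> Tf Th fh ab ba ha hb gap; apply: contrapT => nper.
have ph := Tper Th; have pf := Tper Tf.
apply: (gap ((a + b) / 2)); [lra|lra|].
apply: (@kopell _ f h a b) => //; try lra.
- exact: Tbv.
- by move=> n; apply/Tuc/TX.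
- by move=> n; apply/Tuc/TX/TV.
have fhX n z : h ((f ^+ n)%g z) = (f ^+ n)%g (h z).
  by rewrite -!homeoM; congr (bf (homeo_bijn _) z); apply/commuteX/commute_sym.
have end_fix n (k : int) e : h e = e -> h ((f ^+ n)%g e + k%:~R) = (f ^+ n)%g e + k%:~R.
  by move=> he; rewrite perZ // fhX he.
(* A fixed point of h inside a translated image of the gap pulls back to one inside the gap. *)
have inner n (k : int) y : h y = y -> (f ^+ n)%g a + k%:~R < y -> y < (f ^+ n)%g b + k%:~R -> False.
  move=> hy ay yb; pose y' := ((f ^+ n)^-1)%g (y - k%:~R).
  have Ey : (f ^+ n)%g y' = y - k%:~R by rewrite homeoKV.
  apply: (gap y').
  - by rewrite -(homeo_lt (f ^+ n)%g) Ey; lra.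
  - by rewrite -(homeo_lt (f ^+ n)%g) Ey; lra.
  apply: (@homeo_inj _ (f ^+ n)%g); rewrite -fhX Ey.
  by apply: (addIr (k%:~R)); rewrite -perZ // subrK.
move=> i j k ij; apply: contrapT => /not_orP[/negP]; rewrite -ltNge => c1 /negP; rewrite -ltNge => c2.
have i0 x : (f ^+ i)%g x = (f ^+ i)%g x + 0%:~R by rewrite addr0.
have E e e' : h e = e -> (f ^+ j)%g e + k%:~R = (f ^+ i)%g e ->
    (f ^+ (j - i)) %g e = e + (- k)%:~R.
  move=> _ Ee; apply: (@homeo_inj _ (f ^+ i)%g); rewrite perZ; last exact: perX.
  by rewrite -homeoM -expgnDr subnKC ?(ltnW ij) // -Ee mulrNz addrK.
apply: nper; exists (j - i)%N, (- k); split; first by rewrite subn_gt0.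
- apply: E => //; apply/le_anti/andP; split; rewrite leNgt; apply/negP => c.
  + by apply: (@inner i 0 ((f ^+ j)%g a + k%:~R)); rewrite -?i0 //; exact: end_fix.
  + by apply: (@inner j k ((f ^+ i)%g a)) => //; rewrite fhX ha.
- apply: E => //; apply/le_anti/andP; split; rewrite leNgt; apply/negP => c.
  + by apply: (@inner j k ((f ^+ i)%g b)) => //; rewrite fhX hb.
  + by apply: (@inner i 0 ((f ^+ j)%g b + k%:~R)); rewrite -?i0 //; exact: end_fix.
Qed.

End GapPeriodic.

(** * Hölder's theorem for free actions on an interval *)

Section Hoelder.
Variable R : realType.
Implicit Types (f g h : homeo R) (x y z : R).

(** Tarski's argument for the monotone map g: the supremum of the z with z <= g z is fixed. *)
Lemma homeo_ivt_le g x y : x <= y -> x <= g x -> g y <= y ->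
  exists z, [/\ x <= z, z <= y & g z = z].
Proof.
move=> xy xg gy; pose S := [set z | [/\ x <= z, z <= y & z <= g z]].
have Sx : S x by [].
have hS : has_sup S by split; [exists x|exists y => z []].
set s := sup S.
have Ss z : S z -> z <= s by exact: sup_upper_bound.
have sy : s <= y by apply: ge_sup; [exists x|move=> z []].
have xs : x <= s by exact: Ss.
exists s; split=> //; apply/le_anti/andP; split; last first.
  apply: ge_sup; first by exists x.
  by move=> z Sz; have [_ _ zg] := Sz; apply: le_trans zg _; rewrite homeo_le; exact: Ss.
case: leP => // sg; have [ys|sy'] := leP y s.
  have E : s = y by apply: le_anti; rewrite sy.
  by move: sg; rewrite E ltNge gy.
pose w := Num.min (g s) y.
have sw : s < w by rewrite lt_min sg.
have wg : w <= g s by rewrite ge_min lexx.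
have wy : w <= y by rewrite ge_min lexx orbT.
have /Ss : S w.
  by split=> //; [exact: le_trans xs (ltW sw)|apply: (le_trans wg); rewrite homeo_le ltW].
by rewrite leNgt sw.
Qed.

Lemma homeo_ivt g x y : x <= g x -> g y <= y ->
  exists z, (x <= z <= y \/ y <= z <= x) /\ g z = z.
Proof.
move=> xg gy; have [xy|/ltW yx] := leP x y.
  by have [z [h1 h2 h3]] := homeo_ivt_le xy xg gy; exists z; split=> //; left; rewrite h1.
have [||z [h1 h2 h3]] := @homeo_ivt_le (g^-1)%g _ _ yx.
- by rewrite -(homeo_le g) homeoKV.
- by rewrite -(homeo_le g) homeoKV.
by exists z; split; [right; rewrite h1|rewrite -{1}h3 homeoKV].
Qed.

Variables (G : homeo R -> Prop) (J : set R).
Hypotheses (GM : forall f g, G f -> G g -> G (f * g)%g).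
Hypotheses (GV : forall f, G f -> G (f^-1)%g).
Hypotheses (Jitv : is_interval J) (GJ : forall g x, G g -> J x -> J (g x)).
Hypothesis free : forall g x y, G g -> J x -> J y -> g x = x -> g y = y.

(** By freeness g y - y has constant sign on J, so comparing two elements at one point compares them
    everywhere: G, restricted to J, is an ordered group. *)
Let G_pos g x y : G g -> J x -> J y -> x < g x -> y < g y.
Proof.
move=> Gg Jx Jy xg; case: ltP => // gy; exfalso.
have [z [hz gz]] := homeo_ivt (ltW xg) gy.
have Jz : J z by case: hz => hz; [apply: (Jitv Jx Jy)|apply: (Jitv Jy Jx)].
by move: xg; rewrite (free Gg Jz Jx gz) ltxx.
Qed.

Let G_lt f g x y : G f -> G g -> J x -> J y -> f x < g x -> f y < g y.
Proof.
move=> Gf Gg Jx Jy H; rewrite -(homeo_lt (f^-1)%g) homeoK -homeoM.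
apply: (@G_pos _ x) => //; first by apply: GM => //; exact: GV.
by rewrite homeoM -(homeo_lt f) homeoKV.
Qed.

Let G_le f g x y : G f -> G g -> J x -> J y -> f x <= g x -> f y <= g y.
Proof. by move=> Gf Gg Jx Jy; rewrite !leNgt; apply: contra; exact: G_lt. Qed.

Let G_eq f g x y : G f -> G g -> J x -> J y -> f x = g x -> f y = g y.
Proof. by move=> Gf Gg Jx Jy E; apply/le_anti/andP; split; apply: (@G_le _ _ x) => //; rewrite E. Qed.

Let GXS f n : G f -> G (f ^+ n.+1)%g.
Proof. by move=> Gf; elim: n => // n IH; rewrite expgS; exact: GM. Qed.

Let G1 f : G f -> G 1%g.
Proof. by move=> Gf; rewrite -(mulgV f); apply: GM => //; exact: GV. Qed.

Let GX f n : G f -> G (f ^+ n)%g.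
Proof. by move=> Gf; case: n => [|n]; [exact: G1 Gf|exact: GXS]. Qed.

Let G_arch f x y : G f -> J x -> J y -> x < f x -> exists n, y < (f ^+ n)%g x.
Proof.
move=> Gf Jx Jy xf; apply: contrapT => /forallNP H.
have {}H n : (f ^+ n)%g x <= y by move: (H n) => /negP; rewrite -leNgt.
pose S := [set (f ^+ n)%g x | n in [set: nat]].
have hS : has_sup S by split; [exists x, 0%N|exists y => _ [n _ <-]].
set s := sup S.
have Ss n : (f ^+ n)%g x <= s by apply: sup_upper_bound => //; exists n.
have Js : J s.
  by apply: (Jitv Jx Jy); rewrite (Ss 0%N) /=; apply: ge_sup; [case: hS|move=> _ [n _ <-]].
have : f s <= s.
  rewrite -(homeo_le (f^-1)%g) homeoK; apply: ge_sup; first by case: hS.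
  by move=> _ [n _ <-]; rewrite -(homeo_le f) homeoKV -homeoM -expgS.
by rewrite leNgt (@G_pos _ x).
Qed.

Let G_bracket f g x : G f -> G g -> J x -> x < f x -> x < g x ->
  exists n, (f ^+ n)%g x <= g x /\ g x < (f ^+ n.+1)%g x.
Proof.
move=> Gf Gg Jx xf xg.
have H := G_arch Gf Jx (GJ Gg Jx) xf; case: (ex_minnP H) => -[|n] h1 h2.
  by move: h1; rewrite expg0 homeo1 ltNge ltW.
by exists n; split=> //; rewrite leNgt; apply/negP => /h2; rewrite ltnn.
Qed.

(** The classical proof that Archimedean ordered groups are abelian, applied to the commutator g of
    a and c, which would be positive if the inequality failed. *)
Let G_comm_lt a c x : G a -> G c -> J x -> x < a x -> x < c x -> a (c x) <= c (a x).
Proof.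
move=> Ga Gc Jx xa xc; case: leP => // lt; exfalso.
pose g := (a * c * (c * a)^-1)%g.
have Gca : G (c * a)%g by exact: GM.
have Gg : G g by apply: GM (GV Gca); exact: GM.
have gE y : g (c (a y)) = a (c y) by rewrite /g homeoM -(homeoM c a) homeoK.
have Jca : J (c (a x)) by do !apply: GJ.
have xg : x < g x by apply: (@G_pos _ (c (a x))) => //; rewrite gE.
(* If some positive f has f^2 <= g, write f^n <= a < f^(n+1) and f^k <= c < f^(k+1). Then f^(n+k+2)
   <= g c a = a c < f^(n+k+2) at x. *)
have [[f [Gf xf ffg]]|nof] := pselect (exists f, [/\ G f, x < f x & f (f x) <= g x]).
- have [n [na an]] := G_bracket Gf Ga Jx xf xa.
  have [k [kc ck]] := G_bracket Gf Gc Jx xf xc.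
  have Ja := GJ Ga Jx; have Jc := GJ Gc Jx.
  have u1 : a (c x) < (f ^+ n.+1)%g (c x) by apply: (@G_lt _ _ x) => //; exact: GX.
  have u2 : (f ^+ n.+1)%g (c x) < (f ^+ n.+1)%g ((f ^+ k.+1)%g x) by rewrite homeo_lt.
  have l1 : (f ^+ k)%g (a x) <= c (a x) by apply: (@G_le _ _ x) => //; exact: GX.
  have l2 : (f ^+ k)%g ((f ^+ n)%g x) <= (f ^+ k)%g (a x) by rewrite homeo_le.
  have l3 : (f * f)%g (c (a x)) <= g (c (a x)) by apply: (@G_le _ _ x) => //; exact: GM.
  have l4 : (f * f)%g ((f ^+ k)%g ((f ^+ n)%g x)) <= (f * f)%g (c (a x)).
    by rewrite homeo_le; exact: le_trans l2 l1.
  have := le_lt_trans (le_trans l4 l3) (le_lt_trans _ (lt_trans u1 u2)).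
  rewrite gE lexx => /(_ isT); rewrite homeoM !homeoX -!iterD.
  have -> : (n.+1 + k.+1)%N = (k + n).+2 by rewrite addSn addnS addnC.
  by rewrite !iterS ltxx.
- have big f : G f -> x < f x -> g x < f (f x).
    by move=> Gf xf; rewrite ltNge; apply/negP => ff; apply: nof; exists f.
  (* Otherwise g is the least positive element: for 0 < k < g both k and k^-1 g are positive and
     have squares above g, so each would exceed the other. Hence a and c agree with powers of g. *)
  have minimal k : G k -> x < k x -> k x < g x -> False.
    move=> Gk xk kg; have Gk' : G (k^-1 * g)%g by apply: GM => //; exact: GV.
    have xk' : x < (k^-1 * g)%g x by rewrite homeoM -(homeo_lt k) homeoKV.
    have := big _ Gk xk; rewrite -(homeo_lt (k^-1)%g) homeoK -homeoM => k'k.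
    have := big _ Gk' xk'; rewrite -{1}(homeoKV k (g x)) -homeoM => kk'.
    have : k x < (k^-1 * g)%g x.
      by apply: (@G_lt _ _ ((k^-1 * g)%g x)) => //; exact: GJ.
    by rewrite ltNge ltW.
  have pow f : G f -> x < f x -> exists n, f x = (g ^+ n)%g x.
    move=> Gf xf; have [n [nf fn]] := G_bracket Gg Gf Jx xg xf; exists n.
    apply/le_anti; rewrite nf andbT leNgt; apply/negP => nf'.
    have Gn := GX n Gg.
    apply: (@minimal ((g ^+ n)^-1 * f)%g); first by apply: GM => //; exact: GV.
    - by rewrite homeoM -(homeo_lt (g ^+ n)%g) homeoKV.
    - by rewrite homeoM -(homeo_lt (g ^+ n)%g) homeoKV -homeoM -expgSr.
  have [n an] := pow _ Ga xa; have [k ck] := pow _ Gc xc.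
  have E1 : a (c x) = (g ^+ n)%g (c x) by apply: (@G_eq _ _ x) => //; [exact: GX|exact: GJ].
  have E2 : c (a x) = (g ^+ k)%g (a x) by apply: (@G_eq _ _ x) => //; [exact: GX|exact: GJ].
  by move: lt; rewrite E1 E2 an ck !homeoX -!iterD addnC ltxx.
Qed.

Lemma hoelder a c x : G a -> G c -> J x -> a (c x) = c (a x).
Proof.
have pos a' c' y : G a' -> G c' -> J y -> y < a' y -> y < c' y -> a' (c' y) = c' (a' y).
  by move=> Ga Gc Jy ya yc; apply/le_anti/andP; split; exact: G_comm_lt.
have half a' c' y : G a' -> G c' -> J y -> y < a' y -> a' (c' y) = c' (a' y).
  move=> Ga Gc Jy ya; case: (ltgtP y (c' y)) => [|cy|/esym cy]; first exact: pos.
  - have Jc := GJ Gc Jy; have := @pos a' (c'^-1)%g (c' y) Ga (GV Gc) Jc.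
    rewrite homeoK => /(_ _ _)/(congr1 c'); rewrite homeoKV => <- //.
    by apply: (@G_pos _ y).
  - by rewrite cy (free Gc Jy (GJ Ga Jy) cy).
move=> Ga Gc Jx; case: (ltgtP x (a x)) => [|ax|/esym ax]; first exact: half.
- have Ja := GJ Ga Jx; have := @half (a^-1)%g c (a x) (GV Ga) Gc Ja.
  by rewrite homeoK => /(_ ax)/(congr1 a); rewrite homeoKV => ->.
- by rewrite ax (free Ga Jx (GJ Gc Jx) ax).
Qed.

End Hoelder.

(** * Disjointness of the supports of u and v *)

Section DisjointSupports.
Variables (R : realType) (T : homeo R -> Prop).
Hypotheses (TM : forall f g, T f -> T g -> T (f * g)%g) (T1 : T 1%g).
Hypotheses (TV : forall f, T f -> T (f^-1)%g).
Hypotheses (Tper : forall f, T f -> per f) (Tuc : forall f, T f -> uc f).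
Hypotheses (Tbv : forall f, T f -> bv f).
Implicit Types (f g h : homeo R) (x y z l : R).

Definition aperiodic f := forall n z (k : int), (0 < n)%N -> (f ^+ n)%g z <> z + k%:~R.

Variables A B C : homeo R.
Hypotheses (TA : T A) (TB : T B) (TC : T C).
Hypotheses (AB : commute A B) (BC : commute B C).
Hypothesis perA : (exists z, A z = z) \/ aperiodic A.
Hypothesis perC : (exists z, C z = z) \/ aperiodic C.

Let G g := exists w, g = ev A B C w.

Let GM f g : G f -> G g -> G (f * g)%g.
Proof. by move=> [w ->] [w' ->]; exists (WM w w'). Qed.
Let GV f : G f -> G (f^-1)%g.
Proof. by move=> [w ->]; exists (WI w). Qed.
Let GA : G A. Proof. by exists WU. Qed.
Let GC : G C. Proof. by exists WT. Qed.

Let GT g : G g -> T g.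
Proof.
move=> [w ->]; elim: w => //= [w1 H1 w2 H2|w1 H1]; first exact: TM.
exact: TV.
Qed.

Let GB g : G g -> commute B g.
Proof.
move=> [w ->]; elim: w => /= [||||w1 H1 w2 H2|w1 H1].
- exact: commute_sym AB.
- exact: commute_refl.
- exact: BC.
- exact: commute1.
- exact: commuteM H1 H2.
- exact: commuteV H1.
Qed.

Let v := (A * C * (A^-1 * C^-1))%g.

Let v_fix x : A (C ((A^-1)%g ((C^-1)%g x))) = C (A ((A^-1)%g ((C^-1)%g x))) -> v x = x.
Proof. by move=> E; rewrite /v !homeoM E !homeoKV. Qed.

(** All words in A, B, C commute with B. A word with a fixed point that is not the identity has a
    gap, whose ends would be periodic under B modulo integers. So the group acts freely on the line
    and is abelian by Hölder. *)
Lemma commutator_trivial : aperiodic B -> v = 1%g.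
Proof.
move=> apB; apply: homeoP => x; apply: v_fix.
apply: (@hoelder R G setT) => //.
move=> g y z Gg _ _ gy; apply: contrapT => gz.
have [a [b [az zb ba ga [gb nf]]]] := homeo_gap (Tper (GT Gg)) (ex_intro _ y gy) gz.
have [n [k [n0 E _]]] := gap_periodic TM T1 TV Tper Tuc Tbv TB (GT Gg) (GB Gg)
  (lt_trans az zb) ba ga gb nf.
exact: apB E.
Qed.

(** Let (l, r) be the gap of B around x. Its ends are periodic, hence fixed, under A and C. The
    words act freely on (l, r): an end inside (l, r) of a gap of some word would be fixed by B.
    Hölder's theorem then applies on (l, r). *)
Lemma commutator_fix x : (exists z, B z = z) -> B x <> x -> v x = x.
Proof.
move=> Bfix Bx; have [l [r [lx xr rl Bl [Br nB]]]] := homeo_gap (Tper TB) Bfix Bx.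
have lr := lt_trans lx xr.
have fixlr f : T f -> commute B f -> (exists z, f z = z) \/ aperiodic f -> f l = l /\ f r = r.
  move=> Tf Bf perf.
  have [n [k [n0 fl fr]]] := gap_periodic TM T1 TV Tper Tuc Tbv Tf TB (commute_sym Bf) lr rl Bl Br nB.
  have [[z fz]|ap] := perf; last by have := ap n l k n0 fl.
  have k0 : k = 0 by apply: fix_int_eq0 fl; [exact/perX/Tper|exact: homeoX_fix fz].
  by move: fl fr; rewrite k0 !addr0; split; exact: homeoX_fix_inv n0 _.
have [Al Ar] : A l = l /\ A r = r by apply: fixlr => //; exact: commute_sym.
have [Cl Cr] : C l = l /\ C r = r by exact: fixlr.
have Glr g : G g -> g l = l /\ g r = r.
  move=> [w ->]; elim: w => //= [w1 [H1 H1'] w2 [H2 H2']|w1 [H1 H1']].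
    by rewrite H2 H2'.
  by split; exact: (homeoV_fix (f := ev A B C w1)).
pose J := [set y | l < y /\ y < r].
have GJ g y : G g -> J y -> J (g y).
  by move=> /Glr[gl gr] [ly yr]; split; [rewrite -gl|rewrite -gr]; rewrite homeo_lt.
have Jitv : is_interval J.
  by move=> y z [? ?] [? ?] t /andP[? ?]; split; lra.
have free g y z : G g -> J y -> J z -> g y = y -> g z = z.
  move=> Gg [ly yr] [lz zr] gy; apply: contrapT => gz.
  have [gl gr] := Glr g Gg.
  have [a [b [az zb ba ga [gb nf]]]] := homeo_gap (Tper (GT Gg)) (ex_intro _ y gy) gz.
  have la : l <= a by case: leP => // al; case: (nf l al (lt_trans lz zb)).
  have br : b <= r by case: leP => // rb; case: (nf r (lt_trans az zr) rb).
  have [n [k [n0 Ba Bb]]] := gap_periodic TM T1 TV Tper Tuc Tbv TB (GT Gg) (GB Gg)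
    (lt_trans az zb) ba ga gb nf.
  have k0 : k = 0.
    by apply: fix_int_eq0 Ba; [exact/perX/Tper|apply: homeoX_fix; exact: Bl].
  move: Ba Bb; rewrite k0 !addr0 => /(homeoX_fix_inv n0) Ba /(homeoX_fix_inv n0) Bb.
  case: (leP y a) => [ya|ay].
    by apply: (nB a) => //; [exact: lt_le_trans ya|exact: lt_trans zr].
  case: (leP b y) => [by_|yb]; last by case: (nf y).
  by apply: (nB b) => //; [exact: lt_trans zb|exact: le_lt_trans yr].
have Jx : J x by [].
apply: v_fix; apply: (hoelder GM GV Jitv GJ free) => //.
by do 2![apply: (GJ); first exact: GV].
Qed.

End DisjointSupports.

(** * The two-jumps lemma *)

Section TwoJumps.
Variable R : realType.
Implicit Types (f g u v t : homeo R) (x y z : R).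

Lemma homeo_cont_fix f (x0 : R) : f x0 = x0 -> forall e : R, 0 < e ->
  exists2 d : R, 0 < d & forall x, `|x - x0| < d -> `|f x - x0| < e.
Proof.
move=> fx e e0; pose p := (f^-1)%g (x0 - e); pose q := (f^-1)%g (x0 + e).
have px : p < x0 by rewrite -(homeo_lt f) /p homeoKV fx; lra.
have xq : x0 < q by rewrite -(homeo_lt f) /q homeoKV fx; lra.
exists (Num.min (x0 - p) (q - x0)); first by rewrite lt_min !subr_gt0 px.
move=> x; rewrite lt_min !ltr_norml => /andP[/andP[a1 a2] /andP[b1 b2]].
have h1 : f p < f x by rewrite homeo_lt; lra.
have h2 : f x < f q by rewrite homeo_lt; lra.
by move: h1 h2; rewrite /p /q !homeoKV => ? ?; apply/andP; split; lra.
Qed.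

Definition hmirror_fun f x := - f (- x).
Lemma hmirrorK f : cancel (hmirror_fun f) (hmirror_fun (f^-1)%g).
Proof. by move=> x; rewrite /hmirror_fun opprK homeoK opprK. Qed.
Lemma hmirrorKV f : cancel (hmirror_fun (f^-1)%g) (hmirror_fun f).
Proof. by move=> x; rewrite /hmirror_fun opprK homeoKV opprK. Qed.
Lemma hmirror_mono f : {mono Bijn (hmirrorK f) (hmirrorKV f) : x y / x <= y}.
Proof. by move=> x y /=; rewrite lerN2 homeo_le lerN2. Qed.
Definition hmirror f := Homeo (hmirror_mono f).

Lemma hmirror_sdiff f s l : sdiff setT f s l -> sdiff setT (hmirror f) (- s) l.
Proof.
by move=> /sdiff_mirror; apply: sdiff_restrict; exists 1.
Qed.

(* Kim and Koberda's two-jumps lemma: f y, y and g y are ordered with f y fixed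
   by g and g y fixed by f, so the slope of f or of g between them is at least 2,
   whereas both derivatives are 1 at an accumulation point of such configurations. *)
Lemma two_jumps_left f g (x0 : R) lf lg : sdiff setT f x0 lf -> sdiff setT g x0 lg ->
  f x0 = x0 -> g x0 = x0 -> exists2 e : R, 0 < e & forall y, `|f y - x0| < e ->
  g (f y) = f y -> f (g y) = g y -> g y <> y -> f y < y -> False.
Proof.
move=> Df Dg fx gx; have h0 : 0 < 1 / 2 :> R by rewrite divr_gt0.
have [d1 d10 C1] := sdiff_chord Df h0; have [d2 d20 C2] := sdiff_chord Dg h0.
pose d := Num.min d1 d2; have d0 : 0 < d by rewrite lt_min d10.
have [L1 L2] : d <= d1 /\ d <= d2 by rewrite !ge_min !lexx orbT.
clearbody d; have [d3 d30 G3] := homeo_cont_fix gx d0.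
have d40 : 0 < Num.min d d3 by rewrite lt_min d0.
have [M1 M3] : Num.min d d3 <= d /\ Num.min d d3 <= d3 by rewrite !ge_min !lexx orbT.
have [d5 d50 F5] := homeo_cont_fix (homeoV_fix fx) d40.
exists (Num.min d d5); first by rewrite lt_min d0.
move=> y; rewrite lt_min => /andP[fyd /F5]; rewrite homeoK => yd gfy fgy gy fy.
have nx : nbd setT x0 d (f y) by [].
have ny : nbd setT x0 d y by split=> //; exact: lt_le_trans M1.
have ng : nbd setT x0 d (g y) by split=> //; apply: G3; exact: lt_le_trans M3.
have n0 : nbd setT x0 d x0 by split=> //; rewrite subrr normr0.
have yg : y < g y.
  case: (ltgtP y (g y)) => [//|gy'|/esym/gy//]; exfalso.
  have h1 : f (g y) < f y by rewrite homeo_lt.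
  have h2 : g (f y) < g y by rewrite homeo_lt.
  by move: h1 h2; rewrite fgy gfy; lra.
have {}C1 a b a' b' : nbd setT x0 d a -> nbd setT x0 d b -> a < b -> nbd setT x0 d a' ->
    nbd setT x0 d b' -> a' < b' -> (f b - f a) * (b' - a') <= (1 + 1 / 2) * ((f b' - f a') * (b - a)).
  by move=> *; apply: C1 => //; apply: nbdS L1.
have {}C2 a b a' b' : nbd setT x0 d a -> nbd setT x0 d b -> a < b -> nbd setT x0 d a' ->
    nbd setT x0 d b' -> a' < b' -> (g b - g a) * (b' - a') <= (1 + 1 / 2) * ((g b' - g a') * (b - a)).
  by move=> *; apply: C2 => //; apply: nbdS L2.
have cancel (p a b c : R) : 0 < p -> a * p <= c * (p * b) -> a <= c * b.
  by move=> p0; rewrite (mulrCA c) (mulrC a) ler_pM2l.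
case: (ltgtP x0 y) => [xy|yx|E]; last by move: fy; rewrite -E fx ltxx.
(* f has slope 1 along [x0, g y] and g along [x0, f y], as the ends are fixed. So g y - f y is at
   most 3/2 of g y - y and at most 3/2 of y - f y, while these two lengths add up to g y - f y. *)
- have xfy : x0 < f y by rewrite -{1}fx homeo_lt.
  have xg : x0 < g y by exact: lt_trans yg.
  have := C1 y (g y) x0 (g y) ny ng yg n0 ng xg.
  have := C2 (f y) y x0 (f y) nx ny fy n0 nx xfy.
  rewrite fgy gfy fx gx => /cancel H2 /cancel H1; move: H1 H2; rewrite !subr_gt0.
  by move=> /(_ xg) H1 /(_ xfy) H2; lra.
- have gyx : g y < x0 by rewrite -gx homeo_lt.
  have fyx : f y < x0 by exact: lt_trans yx.
  have := C1 y (g y) (g y) x0 ny ng yg ng n0 gyx.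
  have := C2 (f y) y (f y) x0 nx ny fy nx n0 fyx.
  rewrite fgy gfy fx gx => /cancel H2 /cancel H1; move: H1 H2; rewrite !subr_gt0.
  by move=> /(_ gyx) H1 /(_ fyx) H2; lra.
Qed.

(** If g moves x0, then f y, a fixed point of g, stays away from x0. If y < f y, mirroring the line
    reduces to the other order. *)
Lemma two_jumps f g (x0 : R) lf lg : sdiff setT f x0 lf -> sdiff setT g x0 lg ->
  f x0 = x0 -> exists2 e : R, 0 < e & forall y, `|f y - x0| < e ->
  g (f y) = f y -> f (g y) = g y -> f y <> y -> g y <> y -> False.
Proof.
move=> Df Dg fx; have [gx|gx] := pselect (g x0 = x0); last first.
  have n0 : 0 < `|g x0 - x0| / 2.
    by rewrite divr_gt0 // normr_gt0 subr_eq0; apply/eqP.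
  have [d d0 G] := sdiff_cont I Dg n0.
  exists (Num.min d (`|g x0 - x0| / 2)); first by rewrite lt_min d0.
  move=> y; rewrite lt_min => /andP[yd yn] gfy _ _ _.
  have /G : nbd setT x0 d (f y) by [].
  rewrite gfy => H; have := ler_distD (f y) (g x0) x0.
  by rewrite (distrC (g x0) (f y)); lra.
have [e1 e10 H1] := two_jumps_left Df Dg fx gx.
have mf : hmirror f (- x0) = - x0 by rewrite /= /hmirror_fun opprK fx.
have mg : hmirror g (- x0) = - x0 by rewrite /= /hmirror_fun opprK gx.
have [e2 e20 H2] := two_jumps_left (hmirror_sdiff Df) (hmirror_sdiff Dg) mf mg.
exists (Num.min e1 e2); first by rewrite lt_min e10.
move=> y; rewrite lt_min => /andP[y1 y2] gfy fgy fy gy.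
case: (ltgtP (f y) y) fy => // fy _; first exact: (H1 y).
apply: (H2 (- y)); rewrite /= /hmirror_fun ?opprK ?gfy ?fgy //.
- by rewrite addrC distrC.
- by move=> /oppr_inj.
- by rewrite ltrN2.
Qed.

Section Theta.
Variable (T : homeo R -> Prop).
Hypotheses (TM : forall f g, T f -> T g -> T (f * g)%g).
Hypotheses (TV : forall f, T f -> T (f^-1)%g).
Hypothesis (Tsd : forall f s, T f -> exists l, sdiff setT f s l).
Variables u v t : homeo R.
Hypotheses (Tu : T u) (Tv : T v) (Tt : T t).
Hypothesis disj : forall x, u x <> x -> v x = x.

Let c := (t * u * t^-1)%g.
Let d := (t * v * t^-1)%g.
Let al := (c * u * c^-1)%g.
Let psi := (v * al * (v^-1 * al^-1))%g.

Let disj' x : v x <> x -> u x = x.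
Proof. by move=> vx; apply: contrapT => /disj. Qed.

Let disj_cd x : d x <> x -> c x = x.
Proof.
rewrite /d /c !homeoM => H; rewrite disj' ?homeoKV // => E.
by apply: H; rewrite E homeoKV.
Qed.

(** Disjointness of the supports gives c x = x where d moves x. If psi moved x, then either v and
    c^-1 form a two-jumps configuration at z = v^-1 x, or u and c form one at y = u^-1 x; both are
    excluded near x0. *)
Let psi_fix (x0 : R) : u x0 = x0 -> v x0 = x0 -> exists2 e : R, 0 < e &
  forall x, `|x - x0| < e -> d x <> x -> psi x = x.
Proof.
move=> ux vx; have Tc : T c by apply: TM (TV Tt); exact: TM.
have [l1 D1] := Tsd x0 Tu; have [l2 D2] := Tsd x0 Tc.
have [l3 D3] := Tsd x0 Tv; have [l4 D4] := Tsd x0 (TV Tc).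
have [e1 e10 H1] := two_jumps D1 D2 ux; have [e2 e20 H2] := two_jumps D3 D4 vx.
exists (Num.min e1 e2); first by rewrite lt_min e10.
move=> x; rewrite lt_min => /andP[x1 x2] /disj_cd cx.
have cVx : (c^-1)%g x = x by exact: homeoV_fix.
have alE y : al y = c (u ((c^-1)%g y)) by [].
have alVE y : (al^-1)%g y = c ((u^-1)%g ((c^-1)%g y)).
  by rewrite /al !invMg invgK.
have psiE : psi x = v (al ((v^-1)%g ((al^-1)%g x))) by [].
rewrite psiE alVE cVx.
have [ux'|ux'] := pselect (u x = x).
- rewrite (homeoV_fix ux') cx.
  have [vx'|vx'] := pselect (v x = x).
    by rewrite (homeoV_fix vx') alE cVx ux' cx.
  set z := (v^-1)%g x; have vz : v z = x by rewrite homeoKV.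
  have [alz|alz] := pselect (al z = z); first by rewrite alz.
  exfalso; have uz : u ((c^-1)%g z) <> (c^-1)%g z.
    by move=> E; apply: alz; rewrite alE E homeoKV.
  have vzz : v z <> z by move=> E; apply: vx'; rewrite -vz !E.
  apply: (H2 z); rewrite ?vz //; first exact: disj.
  - by move=> E; apply: vzz; rewrite vz.
  - by move=> E; apply: uz; rewrite E disj'.
- set y := (u^-1)%g x; have uy : u y = x by rewrite homeoKV.
  have uyy : u y <> y by move=> E; apply: ux'; rewrite -uy !E.
  have [cy|cy] := pselect (c y = y).
    rewrite cy (homeoV_fix (disj uyy)) alE.
    by rewrite (homeoV_fix cy) uy cx disj.
  have [vcy|vcy] := pselect (v (c y) = c y).
    by rewrite (homeoV_fix vcy) alE homeoK uy cx disj.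
  exfalso; apply: (H1 y); rewrite ?uy //; first exact: disj'.
  by move=> E; apply: uyy; rewrite uy.
Qed.

(** Near x0 the points moved by d are fixed by psi, so d and psi have disjoint supports there. As
    both fix x0, points close enough to it remain in the neighbourhood during the four factors of
    the commutator. *)
Lemma theta_trivial_near (x0 : R) : u x0 = x0 -> v x0 = x0 -> t x0 = x0 ->
  exists2 e : R, 0 < e & forall x, `|x - x0| < e -> ev u v t theta_word x = x.
Proof.
move=> ux vx tx; have [e1 e10 H1] := psi_fix ux vx.
have cx : c x0 = x0 by rewrite /c !homeoM (homeoV_fix tx) ux tx.
have dx : d x0 = x0 by rewrite /d !homeoM (homeoV_fix tx) vx tx.
have alx : al x0 = x0 by rewrite -[LHS]/(c (u ((c^-1)%g x0))) (homeoV_fix cx) ux cx.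
have px : psi x0 = x0.
  rewrite -[LHS]/(v (al ((v^-1)%g ((al^-1)%g x0)))).
  by rewrite (homeoV_fix alx) (homeoV_fix vx) alx vx.
have [e2 e20 H2] := homeo_cont_fix (homeoV_fix dx) e10.
have [e3 e30 H3] := homeo_cont_fix (homeoV_fix px) e10.
exists (Num.min e1 (Num.min e2 e3)); first by rewrite !lt_min e10 e20.
move=> x; rewrite !lt_min => /and3P[x1 x2 x3].
rewrite -[LHS]/(psi (d ((psi^-1)%g ((d^-1)%g x)))).
have [dxx|dxx] := pselect (d x = x).
- rewrite (homeoV_fix dxx); set z := (psi^-1)%g x.
  have pz : psi z = x by rewrite homeoKV.
  have [->//|dz] := pselect (d z = z).
  have E := H1 z (H3 _ x3) dz.
  by exfalso; apply: dz; rewrite -E pz.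
- set w := (d^-1)%g x; have dw : d w = x by rewrite homeoKV.
  have dww : d w <> w by move=> E; apply: dxx; rewrite -dw !E.
  by rewrite (homeoV_fix (H1 w (H2 _ x2) dww)) dw H1.
Qed.

End Theta.
End TwoJumps.

(** * A trivial word on one component *)

Section Component.
Variables (R : realType) (T : homeo R -> Prop).
Hypotheses (TM : forall f g, T f -> T g -> T (f * g)%g) (T1 : T 1%g).
Hypotheses (TV : forall f, T f -> T (f^-1)%g).
Hypotheses (Tper : forall f, T f -> per f) (Tbv : forall f, T f -> bv f).
Hypothesis (Tsd : forall f s, T f -> exists l, sdiff setT f s l).
Implicit Types (f g h : homeo R) (x y z l : R) (Z : set R).

Let Tuc f : T f -> uc f.
Proof. by move=> Tf; apply: sdiff_uc => [|s]; [exact: Tper|exact: Tsd]. Qed.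

Lemma disjoint_supports_commute (J : set R) f g x :
  (forall y, J y -> J ((f^-1)%g y)) -> (forall y, J y -> J ((g^-1)%g y)) ->
  (forall y, J y -> f y = y \/ g y = y) -> J x -> (f * g * (f^-1 * g^-1))%g x = x.
Proof.
move=> Jf Jg fg Jx; rewrite !homeoM.
have [gx|gx] := pselect (g x = x).
- rewrite (homeoV_fix gx); set w := (f^-1)%g x; have fw : f w = x by rewrite homeoKV.
  have [E|->//] := fg w (Jf _ Jx); have : w = x by rewrite -E.
  by move=> ->; rewrite gx -{1}fw E; move: fw; rewrite E => ->.
- set w := (g^-1)%g x; have gw : g w = x by rewrite homeoKV.
  have [fw|E] := fg w (Jg _ Jx).
    by rewrite (homeoV_fix fw) gw; have [] := fg x Jx.
  by case: gx; rewrite -gw !E.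
Qed.

Section FixedPoint.
Variables (u v t : homeo R) (p : R).
Hypotheses (Tu : T u) (Tv : T v) (Tt : T t).
Hypothesis disj : forall x, u x <> x -> v x = x.
Hypotheses (up : u p = p) (vp : v p = p) (tp : t p = p).

Let E w := ev u v t w.

Let TE w : T (E w).
Proof.
rewrite /E; elim: w => //= [w1 H1 w2 H2|w1 H1]; [exact: TM|exact: TV].
Qed.

Let fix_all z := forall w, E w z = z.

Let fix_all_gen z : u z = z -> v z = z -> t z = z -> fix_all z.
Proof.
move=> uz vz tz w; rewrite /E; elim: w => //= [w1 H1 w2 H2|w1 H1]; first by rewrite H2.
exact: homeoV_fix H1.
Qed.

Let invariant Z := forall w x, Z x -> Z (E w x).
(** Invariance is what lets commutators and conjugates of words be formed on Z separately from the
    rest of the line. *)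
Let small Z := invariant Z /\ exists w, rhoy w != 1%g /\ forall x, Z x -> E w x = x.

Let smallU Z1 Z2 : small Z1 -> small Z2 -> small (Z1 `|` Z2).
Proof.
move=> [i1 [w1 [r1 f1]]] [i2 [w2 [r2 f2]]]; split.
  by move=> w x [/i1|/i2] => H; [left|right].
have r1A : rhoy w1 \in ('Alt_('I_5))%g by rewrite rhoyE rho_Alt.
have r2A : rhoy w2 \in ('Alt_('I_5))%g by rewrite rhoyE rho_Alt.
have [f fA nc] := alt5_conj_noncomm r1A r2A r1 r2.
have [wf wfE] := rhoy_surj fA.
exists (wcomm w1 (wconj wf w2)); split.
  by move: nc; rewrite -wfE.
have g2 x : Z2 x -> E (wconj wf w2) x = x.
  move=> Zx; rewrite -[LHS]/(E wf (E w2 (E (WI wf) x))) f2; last exact: i2.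
  exact: homeoKV.
move=> x Zx; rewrite -[LHS]/((E w1 * E (wconj wf w2) * ((E w1)^-1 * (E (wconj wf w2))^-1))%g x).
apply: (@disjoint_supports_commute (Z1 `|` Z2)) => //.
- by move=> y [/(i1 (WI w1))|/(i2 (WI w1))] ?; [left|right].
- by move=> y [/(i1 (WI (wconj wf w2)))|/(i2 (WI (wconj wf w2)))] ?; [left|right].
- by move=> y [/f1|/g2]; [left|right].
Qed.

(* A point fixed by the kernel of rhoy is fixed by all words, since w ^+ 60 lies in the kernel. *)
Let kernel_push l r y z : l < y -> y < r -> l < z -> z < r ->
  (forall x, l < x -> x < r -> ~ fix_all x) -> exists2 w, rhoy w = 1%g & z < E w y.
Proof.
move=> ly yr lz zr nf; apply: contrapT => H.
have {}H w : rhoy w = 1%g -> E w y <= z.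
  by move=> rw; rewrite leNgt; apply/negP => yz; apply: H; exists w.
pose S := [set x | exists2 w, rhoy w = 1%g & x = E w y].
have Sy : S y by exists W1.
have hS : has_sup S by split; [exists y|exists z => _ [w rw ->]; exact: H].
set s := sup S.
have ys : y <= s by exact: sup_upper_bound.
have sz : s <= z by apply: ge_sup; [exists y|move=> _ [w rw ->]; exact: H].
have up_ w : rhoy w = 1%g -> s <= E w s.
  move=> rw; apply: ge_sup; first by exists y.
  move=> _ [w' rw' ->]; rewrite -(homeo_le ((E w)^-1)%g) homeoK.
  apply: sup_upper_bound => //; exists (WM (WI w) w') => //.
  by rewrite /rhoy /= -/(rhoy w) -/(rhoy w') rw rw' invg1 mulg1.
have ker_fix w : rhoy w = 1%g -> E w s = s.
  move=> rw; apply/le_anti; rewrite up_ // andbT.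
  rewrite -(homeo_le ((E w)^-1)%g) homeoK; apply: (up_ (WI w)).
  by rewrite /rhoy /= -/(rhoy w) rw invg1.
apply: (nf s); [exact: lt_le_trans ys|exact: le_lt_trans zr|] => w.
apply: (@homeoX_fix_inv _ _ #[rhoy w]%g); first exact: order_gt0.
by rewrite -(ev_wpow u v t) ker_fix // /rhoy ev_wpow -/(rhoy w) expg_order.
Qed.

Let gap_small l r : l < r -> fix_all l -> fix_all r ->
  (forall x, l < x -> x < r -> ~ fix_all x) -> small [set x | l < x /\ x < r].
Proof.
move=> lr fl fr nf.
have inv w x : l < x /\ x < r -> l < E w x /\ E w x < r.
  by move=> [lx xr]; rewrite -{1}(fl w) -{1}(fr w) !homeo_lt.
split; first by move=> w x; exact: inv.
have [el el0 Hl] := theta_trivial_near TM TV Tsd Tu Tv Tt disj (fl WU) (fl WV) (fl WT).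
have [er er0 Hr] := theta_trivial_near TM TV Tsd Tu Tv Tt disj (fr WU) (fr WV) (fr WT).
pose m := (l + r) / 2.
have [lm mr] : l < m /\ m < r by rewrite /m; split; lra.
pose l' := Num.min (l + el / 2) m; pose r' := Num.max (r - er / 2) m.
have ll' : l < l' by rewrite lt_min lm andbT ltrDl divr_gt0.
have r'r : r' < r by rewrite gt_max mr andbT ltrBlDr ltrDl divr_gt0.
have l'm : l' <= m by rewrite ge_min lexx orbT.
have mr' : m <= r' by rewrite le_max lexx orbT.
have l'e : l' <= l + el / 2 by rewrite ge_min lexx.
have r'e : r - er / 2 <= r' by rewrite le_max lexx.
have th x : l < x /\ x < r -> E theta_word x = x \/ l' < x /\ x < r'.
  move=> [lx xr]; case: (leP x l') => [xl|lx'].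
    by left; apply: Hl; rewrite ltr_norml; apply/andP; split; lra.
  case: (leP r' x) => [rx|xr']; last by right.
  by left; apply: Hr; rewrite ltr_norml; apply/andP; split; lra.
have XA : rhoy theta_word \in ('Alt_('I_5))%g by rewrite rhoyE rho_Alt.
have [f fA nc] := alt5_conj_noncomm XA XA rhoy_theta_neq1 rhoy_theta_neq1.
have [wf wfE] := rhoy_surj fA.
(* Inside the gap the support of theta lies in [l', r']. A kernel word carries l' beyond wf^-1 r',
   so g = wf wk carries l' beyond r' and has the image f prescribed in A_5: theta and its conjugate
   by g have disjoint supports, but do not commute in A_5. *)
have [|lz zr] := inv (WI wf) r'; first by split=> //; lra.
have [||wk rk push] := @kernel_push l r l' _ _ _ lz zr nf; [by []|lra|].
pose g := WM wf wk.
have rg : rhoy g = f by rewrite /rhoy /= -/(rhoy wf) -/(rhoy wk) rk mulg1 wfE.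
exists (wcomm theta_word (wconj g theta_word)); split; first by move: nc; rewrite -rg.
have gK y : E g (E (WI g) y) = y by exact: homeoKV.
have gl : r' < E g l' by rewrite -(homeo_lt ((E wf)^-1)%g) (homeoK (E wf)).
move=> x xlr.
apply: (@disjoint_supports_commute [set x | l < x /\ x < r] (E theta_word) (E (wconj g theta_word))) => //.
- by move=> y; exact: (inv (WI theta_word)).
- by move=> y; exact: (inv (WI (wconj g theta_word))).
- move=> y ylr; have [->|[ly yr]] := th y ylr; [by left|right].
  have gy : E (WI g) y < l' by rewrite -(homeo_lt (E g)) gK; exact: lt_trans yr gl.
  have [gy1 gy2] := inv (WI g) y ylr.
  rewrite -[LHS]/(E g (E theta_word (E (WI g) y))).
  have [->|[]] := th _ (conj gy1 gy2); first exact: gK.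
  by rewrite ltNge ltW.
Qed.

(** One period [p, p + 1] is covered by neighbourhoods of common fixed points, where theta is
    trivial, and by gaps, which are small; by compactness finitely many gaps are involved, and their
    union Z is small. *)
Lemma trivial_word_fixed : exists2 w, rhoy w != 1%g & E w = 1%g.
Proof.
have fp : fix_all p by exact: fix_all_gen.
have fp1 : fix_all (p + 1) by move=> w; rewrite (Tper (TE w)) fp.
pose P (a b : R) := exists2 Z, small Z & forall x, a <= x -> x <= b -> Z x \/ E theta_word x = x.
have small0 : small set0.
  by split=> [w x //|]; exists theta_word; split=> //; exact: rhoy_theta_neq1.
have [Z sZ HZ] : P p (p + 1).
  apply: local_to_global; first by rewrite lerDl.
  - move=> a b c _ _ _ _ [Z1 s1 H1] [Z2 s2 H2]; exists (Z1 `|` Z2); first exact: smallU.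
    move=> x ax xc; case: (leP x b) => [xb|/ltW bx].
      by have [?|?] := H1 x ax xb; [left; left|right].
    by have [?|?] := H2 x bx xc; [left; right|right].
  - move=> q _; have [fq|fq] := pselect (fix_all q).
      have [e e0 He] := theta_trivial_near TM TV Tsd Tu Tv Tt disj (fq WU) (fq WV) (fq WT).
      exists e => // a b _ _ _ qa bq; exists set0 => // x ax xb; right.
      by apply: He; rewrite ltr_norml; apply/andP; split; lra.
    pose H h := exists w, h = E w.
    have fH z : fixes H z <-> fix_all z.
      by split=> [fz w|fz h [w ->]]; [apply: fz; exists w|exact: fz].
    have [||||l [r [lq qr _ fl [fr nf]]]] := @fixes_gap _ H q.
    + by move=> h [w ->]; exact: Tper.
    + by move=> h [w ->]; exists (WI w).
    + by exists p; apply/fH.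
    + by move/fH.
    have sm : small [set x | l < x /\ x < r].
      apply: gap_small; [exact: lt_trans qr|exact/fH|exact/fH|].
      by move=> x lx xr /fH; exact: nf.
    exists (Num.min (q - l) (r - q)); first by rewrite lt_min !subr_gt0 lq.
    have [L1 L2] : Num.min (q - l) (r - q) <= q - l /\ Num.min (q - l) (r - q) <= r - q.
      by rewrite !ge_min !lexx orbT.
    move=> a b _ _ _ qa bq; exists [set x | l < x /\ x < r] => // x ax xb; left.
    by split; lra.
(* The rest of the period is invariant, being the complement of an invariant set between two fixed
   points, and theta is trivial on it. *)
have sZ' : small [set x | [/\ p <= x, x <= p + 1 & ~ Z x]].
  split; last first.
    exists theta_word; split; first exact: rhoy_theta_neq1.
    by move=> x [px xp nZ]; have [] := HZ x px xp.
  move=> w x [px xp nZ]; split; first by rewrite -(fp w) homeo_le.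
    by rewrite -(fp1 w) homeo_le.
  move=> Zx.
  by apply: nZ; have [i _] := sZ; have := i (WI w) _ Zx; rewrite [E (WI w) _](homeoK (E w)).
have [_ [w [rw H]]] := smallU sZ sZ'.
exists w => //; apply: homeoP => x.
have [k /andP[k1 k2]] := int_translate x p.
apply: (addIr (k%:~R)); rewrite -(perZ (Tper (TE w))) H //.
have [Zx|nZ] := pselect (Z (x + k%:~R)); [by left|right; split=> //; exact: ltW].
Qed.

End FixedPoint.

(** If B is aperiodic the word v is trivial, if B is the identity the word u is; both go to [sx].
    Otherwise an end p of a gap of B becomes the required common fixed point. *)
Theorem trivial_word (A B C t : homeo R) : T A -> T B -> T C -> T t ->
  commute A B -> commute B C ->
  (exists z, A z = z) \/ aperiodic A -> (exists z, B z = z) \/ aperiodic B ->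
  (exists z, C z = z) \/ aperiodic C ->
  exists2 w, rho w != 1%g & ev B (A * C * (A^-1 * C^-1))%g t w = 1%g.
Proof.
move=> TA TB TC Tt AB BC pA pB pC.
have sx1 : sx != 1%g by apply: (perm5_neq1 lperm_sx).
have [[z Bz]|apB] := pB; last first.
  by exists WV; [exact: sx1|exact: (commutator_trivial TM T1 TV Tper Tuc Tbv TA TB TC AB BC apB)].
set v := (A * C * (A^-1 * C^-1))%g.
have disj x : B x <> x -> v x = x.
  by move=> Bx; apply: (commutator_fix TM T1 TV Tper Tuc Tbv TA TB TC AB BC pA pC _ Bx); exists z.
have [[x Bx]|B1] := pselect (exists x, B x <> x); last first.
  by exists WU; [exact: sx1|apply: homeoP => x]; apply: contrapT => Bx; apply: B1; exists x.
have Tv : T v by apply: TM; apply: TM => //; exact: TV.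
have [p [r [px xr _ Bp [Br nf]]]] := homeo_gap (Tper TB) (ex_intro _ z Bz) Bx.
(* v is the identity on the gap that begins at p, so it cannot move p: the image of p or its
   preimage would lie above points of the gap close to p. *)
have vp : v p = p.
  case: (ltgtP p (v p)) => // vp; exfalso.
  - pose y := Num.min ((p + v p) / 2) x.
    have py : p < y by rewrite lt_min px andbT; lra.
    have yv : y < v p by rewrite gt_min; apply/orP; left; lra.
    have yr : y < r by rewrite gt_min xr orbT.
    have := disj y (nf y py yr); have : v p < v y by rewrite homeo_lt.
    by move=> + E; rewrite E => ?; lra.
  - have pv : p < (v^-1)%g p by rewrite -(homeo_lt v) homeoKV.
    pose y := Num.min ((p + (v^-1)%g p) / 2) x.
    have py : p < y by rewrite lt_min px andbT; lra.
    have yv : y < (v^-1)%g p by rewrite gt_min; apply/orP; left; lra.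
    have yr : y < r by rewrite gt_min xr orbT.
    have := disj y (nf y py yr); have : v y < p by rewrite -(homeoKV v p) homeo_lt.
    by move=> + E; rewrite E => ?; lra.
(* t^-1 p is fixed by B or by v, so one of the two conjugates by t fixes p; [rho] does not
   distinguish them. *)
have [s [rs t'p Tt']] : exists s, [/\ rho s = sy, ev B v t s p = p & T (ev B v t s)].
  have [Bt|/disj vt] := pselect (B ((t^-1)%g p) = (t^-1)%g p).
  - exists (wconj WT WU); split=> //; first by rewrite /= Bt; exact: homeoKV.
    by apply: TM; [exact: TM|exact: TV].
  - exists (wconj WT WV); split=> //; first by rewrite -[LHS]/(t (v ((t^-1)%g p))) vt; exact: homeoKV.
    by apply: TM; [exact: TM|exact: TV].
have [w rw Ew] := trivial_word_fixed TB Tv Tt' disj Bp vp t'p.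
exists (wsubst s w); last by rewrite ev_wsubst.
by rewrite /rho ev_wsubst -/(rho s) rs.
Qed.

End Component.

(** * Maps read in charts *)

Section MeanValue.
Variable R : realType.
Implicit Types (A : set R) (h g : R -> R) (x y z s : R).

Lemma nbhsRP x (P : set R) : nbhs x P <-> exists2 d : R, 0 < d & forall z, `|z - x| < d -> P z.
Proof.
split=> [/nbhs_ballP[d d0 H]|[d d0 H]].
  by exists d => // z zx; apply: H; rewrite /ball /= distrC.
by apply/nbhs_ballP; exists d => // z; rewrite /ball /= distrC => /H.
Qed.

Definition qdiff A h g s := forall e : R, 0 < e -> exists2 d : R, 0 < d &
  forall z, A z -> `|z - s| < d -> z != s -> `|diff_quot h s z - g s| < e.

Lemma qdiff_opp A h g s : qdiff A h g s -> qdiff A (\- h) (\- g) s.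
Proof.
move=> D e /D[d d0 {}D]; exists d => // z Az zs zs'; have := D z Az zs zs'.
by rewrite /diff_quot /= -normrN; congr (`|_| < e); ring.
Qed.

(** Bounds on slopes are inherited by unions of adjacent intervals, and on a short interval
    containing s the derivative at s yields the bound U + e. *)
Lemma mean_value_le A h g x y (U : R) : x <= y ->
  (forall z, x <= z -> z <= y -> A z) ->
  (forall z, x <= z -> z <= y -> qdiff A h g z) -> (forall z, x <= z -> z <= y -> g z <= U) ->
  h y - h x <= U * (y - x).
Proof.
move=> xy IA D gU; suff H e : 0 < e -> h y - h x <= (U + e) * (y - x).
  apply/ler_addgt0Pr => e e0; have [E|xy'] := eqVneq x y; first by rewrite E; lra.
  have yx0 : 0 < y - x by rewrite subr_gt0 lt_neqAle xy'.
  have := H (e / (y - x)) (divr_gt0 e0 yx0).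
  by rewrite mulrDl divfK ?lt0r_neq0.
move=> e0; apply: (@local_to_global_at _ (fun p q => h q - h p <= (U + e) * (q - p))) => //.
  by move=> p q r *; lra.
move=> s /andP[xs sy]; have [d d0 {}D] := D s xs sy _ e0.
have slope z : x <= z -> z <= y -> `|z - s| < d -> z != s -> (h z - h s) / (z - s) <= U + e.
  move=> xz zy zs zs'; have := D z (IA z xz zy) zs zs'; have := gU s xs sy.
  by rewrite /diff_quot ltr_norml => ? /andP[_]; lra.
exists d => // p q xp ps sq qy ps' qs'.
have H1 : h s - h p <= (U + e) * (s - p).
  have [->|nps] := eqVneq p s; first by rewrite !subrr mulr0.
  have sp0 : 0 < s - p by rewrite subr_gt0 lt_neqAle nps.
  have := slope p xp (le_trans ps sy) _ nps.
  rewrite distrC gtr0_norm // => /(_ _).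
  rewrite -(opprB s p) -(opprB (h s) (h p)) invrN mulrNN ler_pdivrMr //.
  by apply; lra.
have H2 : h q - h s <= (U + e) * (q - s).
  have [->|nqs] := eqVneq q s; first by rewrite !subrr mulr0.
  have sq0 : 0 < q - s by rewrite subr_gt0 lt_neqAle eq_sym nqs.
  have := slope q (le_trans xs sq) qy _ nqs.
  by rewrite gtr0_norm // ler_pdivrMr // => /(_ _); apply; lra.
lra.
Qed.

Lemma mean_value_ge A h g x y (U : R) : x <= y ->
  (forall z, x <= z -> z <= y -> A z) ->
  (forall z, x <= z -> z <= y -> qdiff A h g z) -> (forall z, x <= z -> z <= y -> U <= g z) ->
  U * (y - x) <= h y - h x.
Proof.
move=> xy IA D gU.
have := @mean_value_le A (\- h) (\- g) x y (- U) xy IA _ _.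
rewrite /= => H; rewrite -lerN2 -mulNr.
have -> : - (h y - h x) = - h y - - h x by ring.
by apply: H => z xz zy; [apply: qdiff_opp; exact: D|rewrite lerN2; exact: gU].
Qed.

(** The passage from derivatives to chords: the mean value inequalities turn the continuity of g
    into a strict derivative, and its bounded variation into a bound on ratios of slopes. *)
Lemma tame_of_derivative I A h g s : is_interval I -> A `<=` I -> A s ->
  (exists2 d : R, 0 < d & nbd I s d `<=` A) ->
  (forall z, A z -> qdiff A h g z) ->
  (forall e : R, 0 < e -> exists2 d : R, 0 < d & forall z, nbd A s d z -> `|g z - g s| < e) ->
  0 < g s ->
  (forall a b, a <= b -> `[a, b] `<=` A -> bounded_variation a b g) -> tame I h s.
Proof.
move=> iI AI As [d0 d00 IA] D gc gs0 BV.
have IA' : A `<=` I := AI.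
have within d x y z : d <= d0 -> nbd I s d x -> nbd I s d y -> x <= z -> z <= y ->
    A z /\ nbd I s d z.
  move=> dd nx ny xz zy; have nz : nbd I s d z by apply: (nbd_itv iI nx ny); rewrite xz.
  by split=> //; apply: IA; exact: nbdS dd.
split.
  exists (g s); split=> // e e0; have [d d10 G] := gc _ e0.
  have L : Num.min d0 d <= d0 /\ Num.min d0 d <= d by rewrite !ge_min !lexx orbT.
  exists (Num.min d0 d); first by rewrite lt_min d00.
  move=> x y nx ny xy; have xy' := ltW xy.
  have W z : x <= z -> z <= y -> A z /\ `|g z - g s| < e.
    move=> xz zy; have [Az nz] := within _ _ _ _ L.1 nx ny xz zy; split=> //; apply: G; split=> //.
    by apply: lt_le_trans L.2; case: nz.
  have H1 := @mean_value_le A h g x y (g s + e) xy' (fun z a b => (W z a b).1)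
    (fun z a b => D z (W z a b).1).
  have H2 := @mean_value_ge A h g x y (g s - e) xy' (fun z a b => (W z a b).1)
    (fun z a b => D z (W z a b).1).
  rewrite ler_norml; apply/andP; split.
  - suff /H2 : forall z, x <= z -> z <= y -> g s - e <= g z by lra.
    by move=> z a b; have [_] := W z a b; rewrite ltr_norml => /andP[? _]; lra.
  - suff /H1 : forall z, x <= z -> z <= y -> g z <= g s + e by lra.
    by move=> z a b; have [_] := W z a b; rewrite ltr_norml => /andP[_ ?]; lra.
have ns : nbd I s d0 s by split; [exact: IA'|rewrite subrr normr0].
(* Variation is available only on compact intervals in A. Take a to the left of s, or a = s if I has
   no point there; b is chosen likewise. *)
have [a [d1 [d10 as_ Ia na]]] : exists a (d : R), [/\ 0 < d, a <= s,
    forall x, nbd I s d x -> a <= x & nbd I s d0 a].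
  have [[z [nz zs]]|H] := pselect (exists z, nbd I s d0 z /\ z < s).
    exists z, (s - z); split; [by rewrite subr_gt0|exact: ltW| |by []].
    by move=> x [_]; rewrite ltr_norml => /andP[? _]; lra.
  exists s, d0; split=> // x nx; rewrite leNgt; apply/negP => xs.
  by apply: H; exists x.
have [b [d2 [d20 sb Ib nb]]] : exists b (d : R), [/\ 0 < d, s <= b,
    forall x, nbd I s d x -> x <= b & nbd I s d0 b].
  have [[z [nz zs]]|H] := pselect (exists z, nbd I s d0 z /\ s < z).
    exists z, (z - s); split; [by rewrite subr_gt0|exact: ltW| |by []].
    by move=> x [_]; rewrite ltr_norml => /andP[_ ?]; lra.
  exists s, d0; split=> // x nx; rewrite leNgt; apply/negP => xs.
  by apply: H; exists x.
have ab : a <= b by exact: le_trans sb.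
have /(BV a b ab) : `[a, b] `<=` A.
  move=> z; rewrite /= in_itv /= => /andP[az zb].
  by have [] := within d0 a b z (lexx _) na nb az zb.
move=> /(bounded_variationP _ ab) fTV.
pose tv x := fine (total_variation a x g).
have fin x : a <= x -> x <= b -> total_variation a x g \is a fin_num.
  move=> ax xb; rewrite ge0_fin_numE ?total_variation_ge0 //.
  apply: (@le_lt_trans _ _ (total_variation a b g)); last first.
    by rewrite -ge0_fin_numE ?total_variation_ge0.
  by rewrite (total_variationD g ax xb) leeDl // total_variation_ge0.
have tvP x y : a <= x -> x <= y -> y <= b -> `|g y - g x| <= tv y - tv x.
  move=> ax xy yb; have ay := le_trans ax xy; have xb := le_trans xy yb.
  have fxy : total_variation x y g \is a fin_num.
    have := fin y ay yb; rewrite (total_variationD g ax xy) fin_numD => /andP[]//.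
  have -> : tv y = tv x + fine (total_variation x y g).
    by rewrite /tv (total_variationD g ax xy) fineD ?fin.
  rewrite addrAC subrr add0r -lee_fin fineK //; exact: total_variation_ge.
have gs2 : 0 < g s / 2 by rewrite divr_gt0.
have [d3 d30 G] := gc _ gs2.
pose d := Num.min (Num.min d0 d1) (Num.min d2 d3).
have dd0 : 0 < d by rewrite !lt_min d00 d10 d20.
have [L0 L1 L2 L3] : [/\ d <= d0, d <= d1, d <= d2 & d <= d3].
  by rewrite /d !ge_min !lexx ?orbT.
(* Near s one has g >= g s / 2, so log g varies at most 2 / g s times as much as g. *)
clearbody d; exists d => //; exists (fun x => 2 / g s * tv x).
have nab x : nbd I s d x -> a <= x /\ x <= b.
  by move=> nx; split; [apply: Ia; exact: nbdS L1|apply: Ib; exact: nbdS L2].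
have c0 : 0 < 2 / g s by rewrite divr_gt0.
split.
  move=> x y /nab[ax xb] /nab[ay yb] xy; rewrite ler_pM2l // -subr_ge0.
  exact: le_trans (tvP x y ax xy yb).
move=> p q x y x' y' np nq px xy yq px' xy' yq'.
have [ap pb] := nab p np; have [aq qb] := nab q nq.
pose w := tv q - tv p.
have W z : p <= z -> z <= q -> A z /\ g s / 2 <= g z.
  move=> pz zq; have [Az nz] := within d p q z L0 np nq pz zq; split=> //.
  have /G : nbd A s d3 z by split=> //; apply: lt_le_trans L3; case: nz.
  by rewrite ltr_norml => /andP[+ _]; clear; lra.
have osc z z' : p <= z -> z <= q -> p <= z' -> z' <= q -> `|g z - g z'| <= w.
  move=> pz zq pz' zq'; rewrite /w.
  have [zb zb'] : z <= b /\ z' <= b := conj (le_trans zq qb) (le_trans zq' qb).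
  have [az az'] : a <= z /\ a <= z' := conj (le_trans ap pz) (le_trans ap pz').
  have mono x1 y1 : a <= x1 -> x1 <= y1 -> y1 <= b -> tv x1 <= tv y1.
    by move=> h1 h2 h3; rewrite -subr_ge0; exact: le_trans (tvP _ _ h1 h2 h3).
  have m1 := mono p z ap pz zb; have m2 := mono z q az zq qb.
  have m3 := mono p z' ap pz' zb'; have m4 := mono z' q az' zq' qb.
  case: (leP z z') => [zz'|/ltW zz'].
    by rewrite distrC; apply: le_trans (tvP z z' az zz' zb') (lerB m4 m1).
  by apply: le_trans (tvP z' z az' zz' zb) (lerB m2 m3).
have X0 : 0 < y - x by rewrite subr_gt0.
have X0' : 0 < y' - x' by rewrite subr_gt0.
have inI z : x' <= z -> z <= y' -> p <= z /\ z <= q.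
  by move=> h1 h2; exact: conj (le_trans px' h1) (le_trans h2 yq').
have inI' z : x <= z -> z <= y -> p <= z /\ z <= q.
  by move=> h1 h2; exact: conj (le_trans px h1) (le_trans h2 yq).
set H := h y - h x; set H' := h y' - h x'.
(* w bounds the oscillation of g on [p, q], so no value of g is below the mean slope over [x, y] by
   more than w. By [low] this additive error amounts to a factor 1 + 2 w / g s, at most the
   exponential. *)
have key : (H / (y - x) - w) * (y' - x') <= H'.
  apply: (@mean_value_ge A h g) => [|z z1 z2|z z1 z2|z z1 z2]; first exact: ltW.
  - by have [z3 z4] := inI z z1 z2; have [] := W z z3 z4.
  - by have [z3 z4] := inI z z1 z2; apply: D; have [] := W z z3 z4.
  have [z3 z4] := inI z z1 z2.
  suff : H <= (g z + w) * (y - x) by rewrite -ler_pdivrMr //; lra.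
  apply: (@mean_value_le A h g) => [|t t1 t2|t t1 t2|t t1 t2]; first exact: ltW.
  - by have [t3 t4] := inI' t t1 t2; have [] := W t t3 t4.
  - by have [t3 t4] := inI' t t1 t2; apply: D; have [] := W t t3 t4.
  have [t3 t4] := inI' t t1 t2.
  by have := osc t z t3 t4 z3 z4; rewrite ler_norml => /andP[_]; clear; lra.
have low : g s / 2 * (y' - x') <= H'.
  apply: (@mean_value_ge A h g) => [|z z1 z2|z z1 z2|z z1 z2]; first exact: ltW.
  - by have [z3 z4] := inI z z1 z2; have [] := W z z3 z4.
  - by have [z3 z4] := inI z z1 z2; apply: D; have [] := W z z3 z4.
  by have [z3 z4] := inI z z1 z2; have [] := W z z3 z4.
have w0 : 0 <= w.
  by have := osc p p (lexx _) (ltW (le_lt_trans px (lt_le_trans xy yq))) (lexx _)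
     (ltW (le_lt_trans px (lt_le_trans xy yq))); rewrite subrr normr0.
have H'0 : 0 < H' by apply: lt_le_trans low; rewrite mulr_gt0.
have key' : H * (y' - x') <= (H' + w * (y' - x')) * (y - x).
  have := ler_wpM2r (ltW X0) key.
  have -> : (H / (y - x) - w) * (y' - x') * (y - x) = H * (y' - x') - w * (y' - x') * (y - x).
    by field; exact: lt0r_neq0.
  by lra.
have low' : w * (y' - x') <= 2 / g s * w * H'.
  have := ler_wpM2l (mulr_ge0 (ltW c0) w0) low.
  have -> // : 2 / g s * w * (g s / 2 * (y' - x')) = w * (y' - x').
  by field; exact: lt0r_neq0.
rewrite -mulrBr -/w.
have e1 := expR_ge1Dx (2 / g s * w).
have := ler_wpM2r (mulr_ge0 (ltW H'0) (ltW X0)) e1.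
have := ler_wpM2r (ltW X0) low'.
lra.
Qed.

End MeanValue.

Section Charts.
Variables (R : realType) (M : topologicalType).
Implicit Types (c d : chart R M) (f : M -> M).

Definition cimg c : set R := chart_fun c @` chart_dom c.

Lemma cimg_itv c : is_interval (cimg c).
Proof. exact: chart_interval. Qed.

Lemma cimgK c z : cimg c z -> chart_dom c (chart_inv c z) /\ chart_fun c (chart_inv c z) = z.
Proof. by move=> [p cp <-]; rewrite chart_funK. Qed.

Lemma cimg_fun c p : chart_dom c p -> cimg c (chart_fun c p).
Proof. by move=> cp; exists p. Qed.

Lemma chart_inv_near c p (O : set M) : chart_dom c p -> nbhs p O ->
  exists2 d : R, 0 < d & forall z, nbd (cimg c) (chart_fun c p) d z -> O (chart_inv c z).
Proof.
move=> cp; rewrite -{1}(chart_funK cp) => pO.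
have /subspace_continuousP/(_ _ (cimg_fun cp)) := @chart_inv_continuous _ _ c.
move=> /(_ _ pO) /nbhsRP[d d0 H]; exists d => // z [Iz zd].
exact: H.
Qed.

Lemma chart_fun_near c p (P : set R) : chart_dom c p -> nbhs (chart_fun c p) P ->
  \forall q \near p, chart_dom c q /\ P (chart_fun c q).
Proof.
move=> cp cP; have oc := @chart_dom_open _ _ c.
have /subspace_continuousP/(_ _ cp)/(_ _ cP) := @chart_fun_continuous _ _ c.
move=> H1; have {}H1 : nbhs p [set q | chart_dom c q -> P (chart_fun c q)] by exact: H1.
have H2 : nbhs p (chart_dom c) by exact: open_nbhs_nbhs.
have S : [set q | chart_dom c q -> P (chart_fun c q)] `&` chart_dom c `<=`
    [set q | chart_dom c q /\ P (chart_fun c q)] by move=> q [Hq cq]; split=> //; exact: Hq.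
exact: (@filterS _ _ (nbhs_filter p) _ _ S (filterI H1 H2)).
Qed.

Lemma local_expr_tame c d f p : C1_on (local_dom c d f) (local_expr c d f) ->
  increasing_on (local_dom c d f) (local_expr c d f) ->
  deriv_BV_on (local_dom c d f) (local_expr c d f) -> continuous f ->
  chart_dom c p -> chart_dom d (f p) ->
  tame (cimg c) (local_expr c d f) (chart_fun c p).
Proof.
move=> [Dh Cg] inc BV cf cp dfp; set A := local_dom c d f in Dh Cg inc BV *.
set h := local_expr c d f in Dh Cg inc BV *.
have As : A (chart_fun c p) by exists p.
have nO : nbhs p (f @^-1` chart_dom d).
  by apply: cf; apply: open_nbhs_nbhs; split=> //; exact: chart_dom_open.
apply: (@tame_of_derivative _ _ A h (deriv_in A h)) => //.
- exact: cimg_itv.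
- by move=> _ [q [cq _] <-]; exact: cimg_fun.
- have [e e0 H] := chart_inv_near cp nO; exists e => // z nz.
  have [cz Ez] := cimgK nz.1; exists (chart_inv c z) => //; split=> //; exact: H.
- move=> z Az e e0; have /cvgrPdist_lt/(_ _ e0) := Dh z Az.
  move=> /nbhsRP[k k0 H]; exists k => // y Ay yk yz; rewrite distrC; exact: H.
- move=> e e0; have /subspace_continuousP/(_ _ As)/cvgrPdist_lt/(_ _ e0) := Cg.
  by move=> /nbhsRP[k k0 H]; exists k => // z [Az zk]; rewrite distrC; exact: H.
- exact: inc.
Qed.

End Charts.

(** * Arcs, loops and the classification of components *)

Section Arcs.
Variables (R : realType) (M : topologicalType) (hM : hausdorff_space M).
Variable at_ : set (chart R M).
Hypothesis trans : forall c d p, at_ c -> at_ d -> chart_dom c p -> chart_dom d p ->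
  tame (cimg c) (chart_fun d \o chart_inv c) (chart_fun c p).
Implicit Types (A B : set R) (g : R -> M) (c d : chart R M).

(** One chart is enough: [regular_chart] passes to the others. Since [tame] includes a positive
    derivative, such curves follow the orientation of the atlas. *)
Definition regular A g (s : R) := exists2 c, at_ c &
  (exists2 e : R, 0 < e & forall x, nbd A s e x -> chart_dom c (g x)) /\
  tame A (chart_fun c \o g) s.

Lemma regular_restrict A B g g' s : is_interval B ->
  (exists2 e : R, 0 < e & forall x, B x -> `|x - s| < e -> A x /\ g' x = g x) ->
  regular A g s -> regular B g' s.
Proof.
move=> iB [e e0 BA] [c ac [[k k0 D] tm]]; exists c => //; split.
  exists (Num.min e k); first by rewrite lt_min e0.
  move=> x [Bx]; rewrite lt_min => /andP[xe xk]; have [Ax ->] := BA x Bx xe.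
  exact: D.
apply: tame_restrict tm => //; exists e => // x Bx xe /=.
by have [Ax ->] := BA x Bx xe.
Qed.

Lemma nbd_center A s (e : R) : A s -> 0 < e -> nbd A s e s.
Proof. by move=> As e0; split=> //; rewrite subrr normr0. Qed.

Lemma regular_cont A g s (O : set M) : A s -> regular A g s -> nbhs (g s) O ->
  exists2 e : R, 0 < e & forall x, nbd A s e x -> O (g x).
Proof.
move=> As [c ac [[e e0 D] [[l sd] _]]] Og.
have cs := D s (nbd_center As e0).
have [k k0 H] := chart_inv_near cs Og.
have [j j0 J] := sdiff_cont As sd k0.
exists (Num.min e j); first by rewrite lt_min e0.
move=> x [Ax]; rewrite lt_min => /andP[xe xj].
have cx : chart_dom c (g x) by exact: D.
rewrite -(chart_funK cx); apply: H; split; [exact: cimg_fun|exact: J].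
Qed.

Lemma regular_chart A g s d : is_interval A -> A s -> regular A g s -> at_ d ->
  chart_dom d (g s) -> (exists2 e : R, 0 < e & forall x, nbd A s e x -> chart_dom d (g x)) /\
  tame A (chart_fun d \o g) s.
Proof.
move=> iA As rg ad ds.
have [e e0 De] : exists2 e : R, 0 < e & forall x, nbd A s e x -> chart_dom d (g x).
  apply: regular_cont => //; apply: open_nbhs_nbhs; split=> //; exact: chart_dom_open.
split; first by exists e.
have [c ac [[k k0 D] tm]] := rg; have cs := D s (nbd_center As k0).
have tc : tame A ((chart_fun d \o chart_inv c) \o (chart_fun c \o g)) s.
  apply: (tame_comp (B := cimg c)) tm _ => //; first exact: cimg_itv.
    by exists k => // x /D/cimg_fun.
  exact: trans.
apply: tame_restrict tc => //; exists k => // x Ax xk; split=> //=.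
by rewrite chart_funK //; exact: D.
Qed.

Definition image_of g (L : R) : set M := g @` seg 0 L.
Definition arc g (L : R) := [/\ 0 < L, forall s, seg 0 L s -> regular (seg 0 L) g s &
  forall s t, seg 0 L s -> seg 0 L t -> g s = g t -> s = t].
Definition loop g (L : R) := [/\ 0 < L, forall s, seg 0 L s -> regular (seg 0 L) g s,
  g 0 = g L & forall s t, 0 <= s -> s < L -> 0 <= t -> t < L -> g s = g t -> s = t].

Lemma sub_seg_regular (p q p' q' : R) g : p <= p' -> q' <= q ->
  (forall s, seg p q s -> regular (seg p q) g s) ->
  forall s, seg p' q' s -> regular (seg p' q') g s.
Proof.
move=> pp qq H s /andP[ps sq]; apply: (@regular_restrict (seg p q) _ g) => //.
- exact: seg_itv.
- by exists 1 => // x /andP[? ?] _; split=> //; apply/andP; split; lra.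
- by apply: H; apply/andP; split; lra.
Qed.

Lemma regular_closed (p q : R) g : (forall s, seg p q s -> regular (seg p q) g s) ->
  closed (g @` seg p q).
Proof.
move=> H; apply: compact_closed => //.
have E : seg p q = [set` `[p, q]].
  by apply/seteqP; split=> x; rewrite /seg /= in_itv.
apply: continuous_compact; last by rewrite E; exact: segment_compact.
apply/subspace_continuousP => s sA O /(regular_cont sA (H s sA))[e e0 He].
apply/nbhsRP; exists e => // z zs Az; exact: He.
Qed.

(** The images of the parts of [p, q] at distance at least e from y are compact, hence closed, and
    miss g y. *)
Lemma regular_inverse (p q y e : R) g : (forall s, seg p q s -> regular (seg p q) g s) ->
  (forall z, seg p q z -> g z = g y -> z = y) -> 0 < e ->
  nbhs (g y) [set m | forall z, seg p q z -> g z = m -> `|z - y| < e].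
Proof.
move=> H inj e0.
pose q' := Num.min q (y - e); pose p' := Num.max p (y + e).
have q'q : q' <= q by rewrite ge_min lexx.
have pp' : p <= p' by rewrite le_max lexx.
have C1 : closed (g @` seg p q').
  by apply: regular_closed; apply: sub_seg_regular H.
have C2 : closed (g @` seg p' q).
  by apply: regular_closed; apply: sub_seg_regular H.
have N (C : set M) : closed C -> ~ C (g y) -> nbhs (g y) (~` C).
  by move=> cC nC; apply: open_nbhs_nbhs; split=> //; exact: closed_openC.
have N1 : nbhs (g y) (~` (g @` seg p q')).
  apply: N => // -[z /andP[pz zq] /inj E].
  have : z = y by apply: E; apply/andP; split=> //; exact: le_trans q'q.
  have : q' <= y - e by rewrite ge_min lexx orbT.
  by move=> ? zy; lra.
have N2 : nbhs (g y) (~` (g @` seg p' q)).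
  apply: N => // -[z /andP[pz zq] /inj E].
  have : z = y by apply: E; apply/andP; split=> //; exact: le_trans pz.
  have : y + e <= p' by rewrite le_max lexx orbT.
  by move=> ? zy; lra.
apply: filterS (filterI N1 N2) => m [n1 n2] z /andP[pz zq] gz.
rewrite ltr_norml; apply/andP; split; rewrite ltNge; apply/negP => yz.
- by apply: n1; exists z => //; apply/andP; split=> //; rewrite le_min zq; lra.
- by apply: n2; exists z => //; apply/andP; split=> //; rewrite ge_max pz; lra.
Qed.

Section Extension.
Variables (g : R -> M) (L : R) (c : chart R M).
Hypotheses (arcg : arc g L) (ac : at_ c) (cL : chart_dom c (g L)).
Let q := chart_fun c (g L).

Let L0 : 0 < L. Proof. by case: arcg. Qed.
Let regg s : seg 0 L s -> regular (seg 0 L) g s. Proof. by case: arcg => _ + _; exact. Qed.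
Let LL : seg 0 L L. Proof. by apply/andP; split=> //; exact: ltW. Qed.

(** Beyond L the curve runs through the chart at the constant speed l, its own derivative at L, so
    the two pieces fit together at L. *)
Lemma arc_extend z : cimg c z -> q < z ->
  (forall w, q < w -> w < z -> ~ image_of g L (chart_inv c w)) ->
  exists g' L', [/\ L < L', forall s, s <= L -> g' s = g s,
    forall s, seg 0 L' s -> regular (seg 0 L') g' s, g' L' = chart_inv c z &
    (forall s t, 0 <= s -> s < L' -> 0 <= t -> t < L' -> g' s = g' t -> s = t) /\
    (~ image_of g L (chart_inv c z) -> forall s, 0 <= s -> s < L' -> g' s <> g' L')].
Proof.
move=> Iz qz free.
have [[e e0 De] [[l sd] bn]] := regular_chart (@seg_itv _ 0 L) LL (regg LL) ac cL.
have l0 : 0 < l by case: sd.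
pose L' := L + (z - q) / l.
have LL' : L < L' by rewrite ltrDl divr_gt0 // subr_gt0.
pose g' s := if s <= L then g s else chart_inv c (l * s + (q - l * L)).
have g'L s : s <= L -> g' s = g s by rewrite /g' => ->.
have wL s : L <= s -> s <= L' -> q <= l * s + (q - l * L) /\ l * s + (q - l * L) <= z.
  move=> Ls sL'; have H1 : l * L <= l * s by rewrite ler_pM2l.
  have H2 : l * s <= l * L' by rewrite ler_pM2l.
  have H3 : l * L' = l * L + (z - q) by rewrite /L'; field; exact: lt0r_neq0.
  by split; lra.
have wLs s : L < s -> s < L' -> q < l * s + (q - l * L) /\ l * s + (q - l * L) < z.
  move=> Ls sL'; have H1 : l * L < l * s by rewrite ltr_pM2l.
  have H2 : l * s < l * L' by rewrite ltr_pM2l.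
  have H3 : l * L' = l * L + (z - q) by rewrite /L'; field; exact: lt0r_neq0.
  by split; lra.
have Iw w : q <= w -> w <= z -> cimg c w.
  by move=> qw wz; apply: (cimg_itv (cimg_fun cL) Iz); rewrite -/q qw wz.
have g'R s : L < s -> s <= L' ->
    chart_dom c (g' s) /\ chart_fun c (g' s) = l * s + (q - l * L).
  move=> Ls sL'; rewrite /g' leNgt Ls /=; have [w1 w2] := wL s (ltW Ls) sL'.
  by have [] := cimgK (Iw _ w1 w2).
have g'R' s : L <= s -> s <= L' -> chart_fun c (g' s) = l * s + (q - l * L).
  rewrite le_eqVlt => /orP[/eqP<- _|Ls sL']; last by have [] := g'R s Ls sL'.
  by rewrite g'L // -/q; ring.
have L'E : l * L' + (q - l * L) = z by rewrite /L'; field; exact: lt0r_neq0.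
exists g', L'; split=> //.
- move=> s /andP[s0 sL']; case: (ltgtP s L) => [sL|Ls|sE].
  + apply: (@regular_restrict (seg 0 L) _ g); first exact: seg_itv.
      exists (L - s); first by rewrite subr_gt0.
      move=> x /andP[x0 _]; rewrite ltr_norml => /andP[_ xs]; split; last by apply: g'L; lra.
      by apply/andP; split=> //; lra.
    by apply: regg; apply/andP; split=> //; exact: ltW.
  + have Ls0 : 0 < s - L by rewrite subr_gt0.
    have near x : seg 0 L' x -> `|x - s| < s - L -> L < x /\ x <= L'.
      by move=> /andP[_ xL']; rewrite ltr_norml => /andP[? _]; split=> //; lra.
    exists c => //; split.
      by exists (s - L) => // x [/near H /H[Lx xL']]; have [] := g'R x Lx xL'.
    apply: (@tame_restrict _ setT _ (fun x => l * x + (q - l * L))).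
    - exact: seg_itv.
    - by exists (s - L) => // x /near H /H[Lx xL'] /=; rewrite g'R' // ltW.
    - exact: tame_affine.
  + exists c => //; split.
      exists e => // x [/andP[x0 xL'] xe]; case: (leP x L) => [xL|Lx].
        by rewrite g'L //; apply: De; split; [apply/andP|rewrite -sE].
      by have [] := g'R x Lx xL'.
    rewrite sE; apply: (@tame_glue _ _ _ L l).
    - exact: seg_itv.
    - by apply/andP; split; exact: ltW.
    - apply: sdiff_restrict sd; exists 1 => // x [/andP[x0 _] xL] _ /=.
      by rewrite g'L //; split=> //; apply/andP.
    - apply: (@sdiff_restrict _ setT _ (fun x => l * x + (q - l * L))); last exact: sdiff_affine.
      by exists 1 => // x [/andP[_ xL'] Lx] _ /=; rewrite g'R'.
    - apply: bvnear_restrict bn; first exact/belowA_itv/seg_itv.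
      by exists 1 => // x [/andP[x0 _] xL] _ /=; rewrite g'L //; split=> //; apply/andP.
    - apply: (@bvnear_restrict _ setT _ (fun x => l * x + (q - l * L))).
      + exact/aboveA_itv/seg_itv.
      + by exists 1 => // x [/andP[_ xL'] Lx] _ /=; rewrite g'R'.
      + exact: bvnear_affine.
- by rewrite /g' leNgt LL' /= L'E.
- have inj s t : L < s -> s <= L' -> L < t -> t <= L' -> g' s = g' t -> s = t.
    move=> Ls sL' Lt tL' E; have := congr1 (chart_fun c) E.
    rewrite (g'R s Ls sL').2 (g'R t Lt tL').2 => /addIr.
    by apply: mulfI; exact: lt0r_neq0.
  have mixed s t : 0 <= s -> s <= L -> L < t -> t < L' -> g' s <> g' t.
    move=> s0 sL Lt tL'; rewrite g'L // /g' leNgt Lt /= => E.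
    have [w1 w2] := wLs t Lt tL'.
    by apply: (free _ w1 w2); exists s => //; apply/andP.
  have [_ _ injg] := arcg.
  split.
    move=> s t s0 sL' t0 tL' E; case: (leP s L) => sL; case: (leP t L) => tL.
    + by apply: injg; [apply/andP|apply/andP|rewrite -!g'L].
    + by have := mixed s t s0 sL tL tL'; rewrite E.
    + by have := mixed t s t0 tL sL sL'; rewrite E.
    + by apply: inj => //; exact: ltW.
  move=> nz s s0 sL' E; case: (leP s L) => sL.
    apply: nz; exists s; first by apply/andP.
    by rewrite -g'L // E /g' leNgt LL' /= L'E.
  have : s = L' by apply: inj => //; exact: ltW.
  by move=> sE; move: sL'; rewrite sE ltxx.
Qed.

(** Follow the chart from g L towards b. If the arc is not met again, it extends to b; otherwise let
    z0 be the first coordinate at which it is met, and the extension up to z0 closes the arc to a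
    loop. *)
Lemma arc_extend_or_loop b : cimg c b -> q < b ->
  (exists g' L', [/\ arc g' L', image_of g L `<=` image_of g' L',
     image_of g' L' (chart_inv c b) & ~ image_of g L (chart_inv c b)]) \/
  (exists g' L', loop g' L' /\ image_of g L `<=` image_of g' L').
Proof.
move=> Ib qb; have [_ _ injg] := arcg.
have seg0 : seg 0 L 0 by rewrite /seg /= lexx ltW.
have sub g' L' : L <= L' -> (forall s, s <= L -> g' s = g s) -> image_of g L `<=` image_of g' L'.
  move=> LL' gg _ [s /andP[s0 sL] <-]; exists s; last exact: gg.
  by apply/andP; split=> //; exact: le_trans LL'.
pose Z := [set z | [/\ q < z, z <= b & image_of g L (chart_inv c z)]].
have Iw w : q <= w -> w <= b -> cimg c w.
  by move=> qw wb; apply: (cimg_itv (cimg_fun cL) Ib); rewrite -/q qw wb.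
have [[z1 Zz1]|noZ] := pselect (exists z, Z z); last first.
  left; have nb w : q < w -> w <= b -> ~ image_of g L (chart_inv c w).
    by move=> qw wb im; apply: noZ; exists w.
  have [|g' [L' [LL' gg reg' E [inj' last']]]] := @arc_extend b Ib qb.
    by move=> w qw wb; apply: nb => //; exact: ltW.
  have nimb := nb b qb (lexx _).
  have L'0 : 0 < L' by exact: lt_trans LL'.
  exists g', L'; split=> //.
  - split=> // s t /andP[s0 sL'] /andP[t0 tL'] Est.
    move: sL' tL'; rewrite !le_eqVlt => /orP[/eqP sE|sL'] /orP[/eqP tE|tL'].
    + by rewrite sE.
    + by case: (last' nimb t t0 tL'); rewrite -sE.
    + by case: (last' nimb s s0 sL'); rewrite -tE.
    + exact: inj'.
  - by apply: sub => //; exact: ltW.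
  - by exists L' => //; apply/andP; split=> //; exact: ltW.
right.
have clI : closed (image_of g L) by exact: regular_closed.
have hZ : has_inf Z by split; [exists z1|exists q => z [/ltW]].
set z0 := inf Z.
have z0le z : Z z -> z0 <= z by apply: ge_inf; case: hZ.
(* Near g L the arc consists of parameters close to L only, and these have coordinates at most q. *)
have qz0 : q < z0.
  have [[e e0 De] [[l sd] bn]] := regular_chart (@seg_itv _ 0 L) LL (regg LL) ac cL.
  have [k k0 K] := sdiff_incr sd.
  have N := @regular_inverse 0 L L k g regg (fun z sz E => injg z L sz LL E) k0.
  have [j j0 J] := chart_inv_near cL N.
  have [[_ z1b _] qz1] : Z z1 /\ q < z1 by split=> //; case: Zz1.
  apply: (@lt_le_trans _ _ (q + j)); first by rewrite ltrDl.
  apply: lb_le_inf; first by exists z1.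
  move=> z [qz zb [s sL gs]]; rewrite leNgt; apply/negP => zj.
  have Iz := Iw z (ltW qz) zb.
  have : `|s - L| < k.
    apply: (J z) gs => //; split=> //.
    by rewrite -/q ltr_norml; apply/andP; split; lra.
  move=> sk; have [E1 E2] := cimgK Iz.
  have zE : chart_fun c (g s) = z by rewrite gs.
  have [sL'|sE] : s < L \/ s = L.
    by case/andP: sL => _; rewrite le_eqVlt => /orP[/eqP|]; [right|left].
  - have := K s L (conj sL sk) (nbd_center LL k0) sL' => /=.
    by rewrite zE -/q ltNge ltW.
  - by move: zE; rewrite sE -/q => zE; move: qz; rewrite zE ltxx.
have z0b : z0 <= b by apply: le_trans (z0le _ Zz1) _; case: Zz1.
have Iz0 := Iw z0 (ltW qz0) z0b.
have imz0 : image_of g L (chart_inv c z0).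
  apply: contrapT => nim; have [d0 E0] := cimgK Iz0.
  have N : nbhs (chart_inv c z0) (~` image_of g L).
    by apply: open_nbhs_nbhs; split=> //; exact: closed_openC.
  have [j j0 J] := chart_inv_near d0 N.
  have [z Zz zj] := inf_adherent j0 hZ.
  have [qz zb imz] := Zz; apply: (J z) imz; split; first exact: Iw (ltW qz) zb.
  have zz := z0le z Zz; rewrite E0 ltr_norml; apply/andP; split; first lra.
  by move: zj; rewrite -/z0; lra.
have [|g' [L' [LL' gg reg' E [inj' _]]]] := @arc_extend z0 Iz0 qz0.
  move=> w qw wz0 imw; have /z0le : Z w.
    by split=> //; exact: le_trans (ltW wz0) z0b.
  by rewrite leNgt wz0.
exists g', L'; split; last by apply: sub => //; exact: ltW.
have L'0 : 0 < L' by exact: lt_trans LL'.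
split=> //; rewrite E gg ?ltW //; have [s0 ss0 gs0] := imz0.
(* The arc is met at its origin: if s0 > 0, its points just before s0 would have coordinates between
   q and z0, because it increases in the chart. *)
suff -> : (0 : R) = s0 by [].
apply/esym/le_anti; case/andP: (ss0) => -> sL; rewrite andbT leNgt; apply/negP => s00.
have [dz0 Ez0] := cimgK Iz0; rewrite -gs0 in dz0 Ez0.
have [[e e0 De] [[l sd] bn]] := regular_chart (@seg_itv _ 0 L) ss0 (regg ss0) ac dz0.
have [k k0 K] := sdiff_incr sd.
have zq0 : 0 < z0 - q by rewrite subr_gt0.
have [j j0 J] := sdiff_cont ss0 sd zq0.
pose r := Num.min s0 (Num.min e (Num.min k j)) / 2.
have r0 : 0 < r by rewrite divr_gt0 // !lt_min s00 e0 k0.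
have [R1 R2 R3 R4] : [/\ r < s0, r < e, r < k & r < j].
  rewrite /r; have H x : 0 < x -> Num.min s0 (Num.min e (Num.min k j)) <= x ->
     Num.min s0 (Num.min e (Num.min k j)) / 2 < x by move=> ? ?; lra.
  by split; apply: H; rewrite // !ge_min lexx ?orbT.
have n x : x < s0 + r -> s0 - r <= x -> x <= s0 -> seg 0 L x.
  by move=> _ h1 h2; apply/andP; split; [apply: le_trans h1; rewrite subr_ge0 ltW|exact: le_trans h2 (proj2 (andP ss0))].
pose s := s0 - r.
have ns (m : R) : r < m -> nbd (seg 0 L) s0 m s.
  move=> rm; split; first by apply: n; rewrite /s; lra.
  by rewrite /s ltr_norml; apply/andP; split; lra.
have H1 : chart_fun c (g s) < z0.
  have := K s s0 (ns _ R3) (nbd_center ss0 k0) => /=; rewrite Ez0; apply.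
  by rewrite /s; lra.
have H2 : q < chart_fun c (g s).
  have := J s (ns _ R4) => /=; rewrite Ez0 ltr_norml => /andP[? _]; lra.
have dgs : chart_dom c (g s) by apply: De; exact: ns.
have /z0le : Z (chart_fun c (g s)).
  split=> //; first exact: le_trans (ltW H1) z0b.
  by rewrite chart_funK //; exists s => //; have [] := ns _ R2.
by rewrite leNgt H1.
Qed.

End Extension.
End Arcs.

(** * Reversal of orientation *)

Section Mirror.
Variables (R : realType) (M : topologicalType).
Implicit Types (c d : chart R M) (f : M -> M).

Section MirrorChart.
Variable c : chart R M.
Let mfun (p : M) : R := - chart_fun c p.
Let minv (y : R) : M := chart_inv c (- y).

Let mfunK p : chart_dom c p -> minv (mfun p) = p.
Proof. by move=> cp; rewrite /minv /mfun opprK chart_funK. Qed.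

Let mimg z : (mfun @` chart_dom c) z -> cimg c (- z).
Proof. by move=> [p cp <-]; rewrite /mfun opprK; exact: cimg_fun. Qed.

Let mfun_cont : {within chart_dom c, continuous mfun}.
Proof.
apply/subspace_continuousP => p cp; apply: cvgN.
by have /subspace_continuousP := @chart_fun_continuous _ _ c; exact.
Qed.

Let minv_cont : {within mfun @` chart_dom c, continuous minv}.
Proof.
apply/subspace_continuousP => _ [p cp <-] O pO.
have {}pO : nbhs p O by rewrite -(mfunK cp).
have [d d0 H] := chart_inv_near cp pO.
apply/nbhsRP; exists d => // z zd /mimg Iz; apply: H; split=> //.
by move: zd; rewrite /mfun -normrN opprD !opprK.
Qed.

Let mitv : is_interval (mfun @` chart_dom c).
Proof.
move=> x y /mimg Ix /mimg Iy z /andP[xz zy].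
have [p cp E] : cimg c (- z) by apply: (cimg_itv Iy Ix); rewrite !lerN2 zy.
by exists p => //; rewrite /mfun E opprK.
Qed.

Let mnondeg : exists p q, [/\ chart_dom c p, chart_dom c q & mfun p < mfun q].
Proof.
have [p [q [cp cq pq]]] := @chart_nondegenerate _ _ c.
by exists q, p; split=> //; rewrite ltrN2.
Qed.

(** Arcs are extended forwards only; the initial end is treated by reversing the arc together with
    the atlas. *)
Definition mirror : chart R M := Chart (@chart_dom_open _ _ c) mfunK mfun_cont minv_cont mitv mnondeg.

End MirrorChart.

Lemma cimg_mirror c z : cimg (mirror c) z <-> cimg c (- z).
Proof.
split=> [[p cp <-]|[p cp E]]; first by rewrite /= opprK; exact: cimg_fun.
by exists p => //=; rewrite E opprK.
Qed.

Definition mirror_atlas (at_ : set (chart R M)) : set (chart R M) := mirror @` at_.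

Definition tame_map (at_ : set (chart R M)) f := forall c d p, at_ c -> at_ d ->
  chart_dom c p -> chart_dom d (f p) -> tame (cimg c) (local_expr c d f) (chart_fun c p).

Lemma tame_map_mirror at_ f : tame_map at_ f -> tame_map (mirror_atlas at_) f.
Proof.
move=> tf _ _ p [c ac <-] [d ad <-] /= cp dfp.
apply: tame_restrict (tame_mirror (tf c d p ac ad cp dfp)); first exact: cimg_itv.
by exists 1 => // x /cimg_mirror.
Qed.

Definition opposite (a1 a2 : set (chart R M)) := forall c, a1 c -> exists2 d, a2 d &
  chart_dom d = chart_dom c /\ forall p, chart_fun d p = - chart_fun c p.

Lemma mirror_opposite at_ : opposite at_ (mirror_atlas at_).
Proof. by move=> c ac; exists (mirror c) => //; exists c. Qed.

Lemma opposite_mirror at_ : opposite (mirror_atlas at_) at_.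
Proof. by move=> _ [c ac <-]; exists c => //; split=> // p /=; rewrite opprK. Qed.

Lemma arc_reverse a1 a2 (g : R -> M) L : opposite a1 a2 -> arc a1 g L ->
  arc a2 (fun s => g (L - s)) L.
Proof.
move=> opp [L0 reg inj]; split=> //; last first.
  move=> s t /andP[s0 sL] /andP[t0 tL] E.
  have : L - s = L - t by apply: inj E; apply/andP; split; lra.
  by move=> ?; lra.
move=> s /andP[s0 sL].
have sS : seg 0 L (L - s) by apply/andP; split; lra.
have [c ac [[e e0 De] tm]] := reg _ sS; have [d ad [dE fE]] := opp c ac.
have dist x : `|L - x - (L - s)| = `|x - s| by rewrite distrC; congr (`|_|); ring.
exists d => //; split.
  exists e => // x [/andP[x0 xL] xe]; rewrite dE; apply: De; split; last by rewrite dist.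
  by apply/andP; split; lra.
have tm' := tame_mirror tm.
have E : - (L - s) = 1 * s + (- L) by ring.
rewrite E in tm'.
have tc : tame (seg 0 L) ((fun x => - (chart_fun c \o g) (- x)) \o (fun x => 1 * x + (- L))) s.
  apply: (@tame_comp _ _ [set x | seg 0 L (- x)] (fun x => 1 * x + (- L))) => //.
  - exact: seg_itv.
  - move=> x y /andP[? ?] /andP[? ?] z /andP[? ?]; apply/andP; split; lra.
  - by apply/andP.
  - by exists 1 => // x [/andP[? ?] _]; apply/andP; split; lra.
  - exact: tame_affine.
apply: tame_restrict tc; first exact: seg_itv.
exists 1 => // x Sx _; split=> //=; rewrite fE; congr (- chart_fun c (g _)); ring.
Qed.

Lemma image_reverse (g : R -> M) L : image_of (fun s => g (L - s)) L = image_of g L.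
Proof.
apply/seteqP; split=> _ [s /andP[s0 sL] <-].
  by exists (L - s) => //; apply/andP; split; lra.
by exists (L - s); [apply/andP; split; lra|rewrite opprB addrC subrK].
Qed.

End Mirror.

Section Classification.
Variables (R : realType) (M : topologicalType) (hM : hausdorff_space M).
Hypothesis cM : compact [set: M].
Implicit Types (atl : set (chart R M)) (g : R -> M).

(** If there were no finite subcover, the sets containing the complement of a finite union of the U
    p would form a proper filter; a cluster point p is excluded by U p. *)
Lemma compact_finite_cover (U : M -> set M) : (forall p, open (U p)) ->
  (forall p, U p p) -> exists D : seq M, forall q, exists2 p, p \in D & U p q.
Proof.
move=> oU Up; apply: contrapT => nD.
pose F : set_system M := [set A | exists D : seq M, forall q,
  (forall p, p \in D -> ~ U p q) -> A q].
have FF : ProperFilter F.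
  split.
    move=> [D H]; apply: nD; exists D => q; apply: contrapT => nq.
    by apply: (H q) => p pD Uq; apply: nq; exists p.
  split.
  - by exists [::].
  - move=> A B [D HA] [D' HB]; exists (D ++ D') => q nq; split.
      by apply: HA => p pD; apply: nq; rewrite mem_cat pD.
    by apply: HB => p pD; apply: nq; rewrite mem_cat pD orbT.
  - by move=> A B AB [D HA]; exists D => q /HA/AB.
have [p [_ cl]] := cM FF filterT.
have [|q [nq Uq]] := cl (~` U p) (U p) _ (open_nbhs_nbhs (conj (oU p) (Up p))); last exact: nq.
by exists [:: p] => q; apply; rewrite inE.
Qed.

(** E measures progress: an end of an arc either is a boundary end or can be continued within one
    chart to a point of the finite set E. *)
Lemma finite_endpoints atl : (forall p, exists2 c, atl c & chart_dom c p) ->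
  exists E : seq M, forall q, exists2 c, atl c & chart_dom c q /\
   ((forall z, cimg c z -> z <= chart_fun c q) \/
    (exists b, [/\ cimg c b, chart_fun c q < b & chart_inv c b \in E])).
Proof.
move=> cover.
have loc p : exists U : set M * M, [/\ open U.1, U.1 p & forall q, U.1 q ->
   exists2 c, atl c & chart_dom c q /\ ((forall z, cimg c z -> z <= chart_fun c q) \/
    (exists b, [/\ cimg c b, chart_fun c q < b & chart_inv c b = U.2]))].
  have [c ac cp] := cover p.
  have [[b [Ib pb]]|nb] := pselect (exists b, cimg c b /\ chart_fun c p < b).
    have N : nbhs p [set q | chart_dom c q /\ chart_fun c q < b].
      apply: (chart_fun_near (P := [set x | x < b])) => //.
      exact: lt_nbhsl.
    exists ([set q | chart_dom c q /\ chart_fun c q < b]^°, chart_inv c b); split.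
    - exact: open_interior.
    - exact: N.
    - move=> q /interior_subset[cq qb]; exists c => //; split=> //; right.
      by exists b.
  exists (chart_dom c, p); split=> //; first exact: chart_dom_open.
  have max z : cimg c z -> z <= chart_fun c p.
    by move=> Iz; rewrite leNgt; apply/negP => zp; apply: nb; exists z.
  move=> q cq; exists c => //; split=> //.
  have := max _ (cimg_fun cq); rewrite le_eqVlt => /orP[/eqP ->|qp]; first by left.
  by right; exists (chart_fun c p); rewrite chart_funK //; split=> //; exact: cimg_fun.
pose U p := projT1 (cid (loc p)).
have UP p : [/\ open (U p).1, (U p).1 p & forall q, (U p).1 q ->
   exists2 c, atl c & chart_dom c q /\ ((forall z, cimg c z -> z <= chart_fun c q) \/
    (exists b, [/\ cimg c b, chart_fun c q < b & chart_inv c b = (U p).2]))].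
  exact: projT2 (cid (loc p)).
have [||D DM] := @compact_finite_cover (fun p => (U p).1).
- by move=> p; have [] := UP p.
- by move=> p; have [] := UP p.
exists [seq (U p).2 | p <- D] => q; have [p pD qU] := DM q.
have [_ _ /(_ q qU)[c ac [cq H]]] := UP p; exists c => //; split=> //.
case: H => [|[b [Ib qb E]]]; [by left|right; exists b; split=> //].
by rewrite E; apply/mapP; exists p.
Qed.

Lemma count_lt (T : eqType) (a b : pred T) (s : seq T) x : subpred a b -> x \in s ->
  b x -> ~~ a x -> (count a s < count b s)%N.
Proof.
move=> ab + bx ax; elim: s => //= y s IH; rewrite inE => /orP[/eqP <-|/IH H].
  by rewrite bx (negPf ax) add0n add1n ltnS; exact: sub_count.
by rewrite -addnS leq_add //; case: (boolP (a y)) => // /ab ->.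
Qed.

Lemma initial_arc atl x0 : (forall p, exists2 c, atl c & chart_dom c p) ->
  exists g L, arc atl g L /\ image_of g L x0.
Proof.
move=> cover; have [c ac cx] := cover x0.
have [y1 [y2 [I1 I2 y12 yx]]] : exists y1 y2, [/\ cimg c y1, cimg c y2, y1 < y2 &
   y1 <= chart_fun c x0 /\ chart_fun c x0 <= y2].
  have [p [q [cp cq pq]]] := @chart_nondegenerate _ _ c.
  have Ix := cimg_fun cx; have Ip := cimg_fun cp; have Iq := cimg_fun cq.
  case: (leP (chart_fun c x0) (chart_fun c p)) => [xp|px].
    by exists (chart_fun c x0), (chart_fun c q); split=> //; [|split]; lra.
  case: (leP (chart_fun c x0) (chart_fun c q)) => [xq|qx].
    by exists (chart_fun c p), (chart_fun c q); split=> //; split=> //; exact: ltW.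
  by exists (chart_fun c p), (chart_fun c x0); split=> //; split; lra.
pose g s := chart_inv c (1 * s + y1).
have gE s : seg 0 (y2 - y1) s -> chart_dom c (g s) /\ chart_fun c (g s) = 1 * s + y1.
  move=> /andP[s0 sL]; apply: cimgK; apply: (cimg_itv I1 I2); apply/andP; split; lra.
exists g, (y2 - y1); split; last first.
  exists (chart_fun c x0 - y1); first by apply/andP; split; lra.
  by rewrite /g mul1r subrK chart_funK.
split; first by rewrite subr_gt0.
- move=> s sS; exists c => //; split.
    by exists 1 => // x [/gE[]].
  apply: (@tame_restrict _ setT _ (fun x => 1 * x + y1)); [exact: seg_itv| |exact: tame_affine].
  by exists 1 => // x /gE[_ E] _.
- move=> s t /gE[_ E1] /gE[_ E2] E; move: E1; rewrite E E2 => /addIr.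
  by rewrite !mul1r.
Qed.

Definition right_end atl g L := exists2 c, atl c &
  chart_dom c (g L) /\ forall z, cimg c z -> z <= chart_fun c (g L).
Definition left_end atl g := exists2 c, atl c &
  chart_dom c (g 0) /\ forall z, cimg c z -> chart_fun c (g 0) <= z.

(** If an arc cannot be extended at either end it is an interval component. Otherwise it closes to a
    loop, which belongs to the mirrored atlas when the closing happens at the initial end. *)
Lemma classification atl x0 : (forall p, exists2 c, atl c & chart_dom c p) ->
  tame_map atl id ->
  (exists g L, [/\ arc atl g L, image_of g L x0, right_end atl g L & left_end atl g]) \/
  (exists a g L, [/\ a = atl \/ a = mirror_atlas atl, loop a g L & image_of g L x0]).
Proof.
move=> cover tid; set am := mirror_atlas atl.
have tidm : tame_map am id by exact: tame_map_mirror.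
have coverm p : exists2 c, am c & chart_dom c p.
  by have [c ac cp] := cover p; exists (mirror c) => //; exists c.
have [E1 H1] := finite_endpoints cover; have [E2 H2] := finite_endpoints coverm.
pose E := E1 ++ E2.
pose cnt (I : set M) := count (fun e => `[<I e>]) E.
have cnt_lt (I J : set M) e : I `<=` J -> e \in E -> J e -> ~ I e -> (cnt I < cnt J)%N.
  move=> IJ eE Je nIe; apply: (count_lt (x := e)) => //.
  - by move=> y /asboolP/IJ ?; apply/asboolP.
  - exact/asboolP.
  - exact/asboolPn.
pose P n := `[< exists g L, [/\ arc atl g L, image_of g L x0 & cnt (image_of g L) = n] >].
have exP : exists n, P n.
  have [g [L [a x]]] := initial_arc x0 cover.
  by exists (cnt (image_of g L)); apply/asboolP; exists g, L.
have bdP n : P n -> (n <= size E)%N.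
  by move=> /asboolP[g [L [_ _ <-]]]; exact: count_size.
case: (ex_maxnP exP bdP) => n /asboolP[g [L [ag xg cg]]] maxn.
have maximal g' L' e : arc atl g' L' -> image_of g L `<=` image_of g' L' -> e \in E ->
    image_of g' L' e -> ~ image_of g L e -> False.
  move=> ag' sub eE g'e nge; have /maxn : P (cnt (image_of g' L')).
    by apply/asboolP; exists g', L'; split=> //; exact: sub.
  by rewrite leqNgt -cg; have -> := cnt_lt _ _ e sub eE g'e nge.
(* An arc through as many points of the finite set E as possible has no extension. *)
have [[a [g' [L' [aE lp sub]]]]|noloop] := pselect (exists a g' L',
   [/\ a = atl \/ a = am, loop a g' L' & image_of g L `<=` image_of g' L']).
  by right; exists a, g', L'; split=> //; exact: sub.
left; exists g, L; split=> //.
- have [c ac [cL [mx|[b [Ib Lb bE]]]]] := H1 (g L); first by exists c.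
  exfalso; have [[g' [L' [ag' sub e1 e2]]]|[g' [L' [lp sub]]]] :=
    arc_extend_or_loop hM tid ag ac cL Ib Lb.
    by apply: (maximal g' L' (chart_inv c b)) => //; rewrite mem_cat bE.
  by apply: noloop; exists atl, g', L'; split=> //; left.
- pose gr s := g (L - s).
  have agr : arc am gr L by apply: arc_reverse ag; exact: mirror_opposite.
  have [c ac [cL [mx|[b [Ib Lb bE]]]]] := H2 (gr L).
    case: ac cL mx => d ad <- /=; rewrite /gr subrr => d0 mx; exists d => //; split=> // z Iz.
    have /mx : cimg (mirror d) (- z) by apply/cimg_mirror; rewrite opprK.
    by rewrite lerN2.
  exfalso; have [[g' [L' [ag' sub e1 e2]]]|[g' [L' [lp sub]]]] :=
    arc_extend_or_loop hM tidm agr ac cL Ib Lb.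
    have agr' := arc_reverse (@opposite_mirror _ _ atl) ag'.
    rewrite image_reverse in sub e2.
    by apply: (maximal _ L' (chart_inv c b) agr'); rewrite ?image_reverse // mem_cat bE orbT.
  apply: noloop; exists am, g', L'; split=> //; first by right.
  by rewrite image_reverse in sub.
Qed.

End Classification.

(** * Lifts to the line *)

Section RealMaps.
Variable R : realType.
Implicit Types (A B : set R) (h k m G : R -> R) (s l : R) (F : homeo R).

Lemma homeo_cont F s (e : R) : 0 < e -> exists2 d : R, 0 < d & forall x, `|x - s| < d -> `|F x - F s| < e.
Proof.
move=> e0; pose p := (F^-1)%g (F s - e); pose q := (F^-1)%g (F s + e).
have px : p < s by rewrite -(homeo_lt F) /p homeoKV; lra.
have xq : s < q by rewrite -(homeo_lt F) /q homeoKV; lra.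
exists (Num.min (s - p) (q - s)); first by rewrite lt_min !subr_gt0 px.
move=> x; rewrite lt_min !ltr_norml => /andP[/andP[a1 a2] /andP[b1 b2]].
have h1 : F p < F x by rewrite homeo_lt; lra.
have h2 : F x < F q by rewrite homeo_lt; lra.
by move: h1 h2; rewrite /p /q !homeoKV => ? ?; apply/andP; split; lra.
Qed.

Lemma homeo_of G : (forall x y, x < y -> G x < G y) -> (forall y, exists x, G x = y) ->
  exists F, forall x, F x = G x.
Proof.
move=> inc /choice[H GH].
have inj : injective G.
  move=> x y E; case: (ltgtP x y) => // /inc; by rewrite E ltxx.
have HG : cancel G H by move=> x; apply: inj; rewrite GH.
have mono : {mono Bijn HG GH : x y / x <= y}.
  move=> x y /=; case: (leP x y) => [|yx]; last by rewrite leNgt inc.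
  by rewrite le_eqVlt => /orP[/eqP->|/inc/ltW]; rewrite ?lexx.
by exists (Homeo mono).
Qed.

Lemma floor_frac (x : R) : exists (n : int) (y : R), [/\ x = y + n%:~R, 0 <= y & y < 1].
Proof.
have [k /andP[k0 k1]] := int_translate x 0.
exists (- k), (x + k%:~R); split=> //; first by rewrite mulrNz addrK.
by rewrite add0r in k1.
Qed.

Lemma int_frac_unique (x y : R) (n m : int) : 0 <= x -> x < 1 -> 0 <= y -> y < 1 ->
  x + n%:~R = y + m%:~R -> x = y /\ n = m.
Proof.
move=> x0 x1 y0 y1 E.
have H1 : (n - m)%:~R < 1%:~R :> R by rewrite intrB mulr1z; lra.
have H2 : (-1)%:~R < (n - m)%:~R :> R by rewrite intrB mulrNz mulr1z; lra.
have nm : n = m by move: H1 H2; rewrite !ltr_int; lia.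
by split=> //; move: E; rewrite nm; lra.
Qed.

Lemma int_frac_lt (x y : R) (n m : int) : 0 <= x -> x < 1 -> 0 <= y -> y < 1 ->
  x + n%:~R < y + m%:~R -> n < m \/ (n = m /\ x < y).
Proof.
move=> x0 x1 y0 y1 E.
have H1 : n%:~R < (m + 1)%:~R :> R by rewrite intrD mulr1z; lra.
move: H1; rewrite ltr_int ltzD1 le_eqVlt => /orP[/eqP nm|]; last by left.
by right; split=> //; move: E; rewrite nm; lra.
Qed.

Lemma periodic_homeo G (g0 : R) : (forall x y, 0 <= x -> x < y -> y <= 1 -> G x < G y) ->
  G 0 = g0 -> G 1 = g0 + 1 -> (forall y, g0 <= y -> y < g0 + 1 -> exists x, [/\ 0 <= x, x < 1 & G x = y]) ->
  exists F, per F /\ forall (n : int) x, 0 <= x -> x <= 1 -> F (x + n%:~R) = G x + n%:~R.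
Proof.
move=> inc G0 G1 sur.
have /choice[fl Hfl] : forall x : R, exists n : int, 0 <= x - n%:~R < 1.
  by move=> x; have [n [y [-> y0 y1]]] := floor_frac x; exists n; rewrite addrK y0.
pose H x := G (x - (fl x)%:~R) + (fl x)%:~R.
have HE (n : int) x : 0 <= x -> x < 1 -> H (x + n%:~R) = G x + n%:~R.
  move=> x0 x1; have /andP[y0 y1] := Hfl (x + n%:~R).
  have [|E1 E2] := int_frac_unique x0 x1 y0 y1 (n := n) (m := fl (x + n%:~R)).
    by rewrite subrK.
  by rewrite /H -E1 -E2.
have HE1 (n : int) : H (1 + n%:~R) = G 1 + n%:~R.
  have -> : 1 + n%:~R = 0 + (n + 1)%:~R :> R by rewrite intrD mulr1z; lra.
  by rewrite HE // G0 G1 intrD mulr1z; lra.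
have incH x y : x < y -> H x < H y.
  have [n [x' [-> x0 x1]]] := floor_frac x; have [m [y' [-> y0 y1]]] := floor_frac y.
  move=> /(int_frac_lt x0 x1 y0 y1); rewrite !HE // => -[nm|[-> xy]]; last first.
    by rewrite ltrD2r inc // ltW.
  have nm' : n%:~R + 1 <= m%:~R :> R.
    by have := lezD1 n m; rewrite nm -(ler_int R) intrD mulr1z.
  have Gx : G x' < g0 + 1 by rewrite -G1 inc.
  have Gy : g0 <= G y'.
    by move: y0; rewrite -G0 le_eqVlt => /orP[/eqP<-//|y0]; rewrite ltW // inc // ltW.
  by lra.
have surH y : exists x, H x = y.
  have [n /andP[n1 n2]] := int_translate y g0.
  have [x [x0 x1 Gx]] := sur _ n1 n2.
  by exists (x + (- n)%:~R); rewrite HE // Gx mulrNz addrK.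
have [F FE] := homeo_of incH surH; exists F.
have FE' (n : int) x : 0 <= x -> x <= 1 -> F (x + n%:~R) = G x + n%:~R.
  by move=> x0; rewrite FE le_eqVlt => /orP[/eqP->|x1]; rewrite ?HE1 ?HE.
split=> // x; have [n [y [-> y0 y1]]] := floor_frac x.
have E : y + n%:~R + 1 = y + (n + 1)%:~R by rewrite intrD mulr1z addrA.
by rewrite E (FE' (n + 1)) ?(ltW y1) // (FE' n) ?(ltW y1) // intrD mulr1z addrA.
Qed.

Lemma sdiff_shift A h s l (n b : R) : sdiff A h s l ->
  sdiff [set x | A (x - n)] (fun x => h (x - n) + b) (s + n) l.
Proof.
move=> [l0 D]; split=> // e /D[d d0 {}D]; exists d => // x y [Ax xd] [Ay yd] xy.
have N z : `|z - (s + n)| < d -> `|z - n - s| < d by rewrite opprD addrA addrAC.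
have /= := D (x - n) (y - n) (conj Ax (N _ xd)) (conj Ay (N _ yd)).
rewrite ltrD2r => /(_ xy).
have -> : y - n - (x - n) = y - x by ring.
by have -> : h (y - n) + b - (h (x - n) + b) = h (y - n) - h (x - n) by ring.
Qed.

Lemma bvnear_shift A h s (n b : R) : bvnear A h s ->
  bvnear [set x | A (x - n)] (fun x => h (x - n) + b) (s + n).
Proof.
move=> [d d0 [m [nm C]]]; exists d => //; exists (fun x => m (x - n)).
have N z : `|z - (s + n)| < d -> `|z - n - s| < d by rewrite opprD addrA addrAC.
split.
  move=> x y [Ax xd] [Ay yd] xy; apply: nm; try by split=> //; exact: N.
  by rewrite lerD2r.
move=> p q x y x' y' [Ap pd] [Aq qd] px xy yq px' xy' yq'.
have := C (p - n) (q - n) (x - n) (y - n) (x' - n) (y' - n) (conj Ap (N _ pd)) (conj Aq (N _ qd)).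
rewrite !lerD2r !ltrD2r => /(_ px xy yq px' xy' yq').
have -> : y - n - (x - n) = y - x by ring.
have -> : y' - n - (x' - n) = y' - x' by ring.
have -> : h (y - n) + b - (h (x - n) + b) = h (y - n) - h (x - n) by ring.
by have -> : h (y' - n) + b - (h (x' - n) + b) = h (y' - n) - h (x' - n) by ring.
Qed.

Lemma tame_shift A h s (n b : R) : tame A h s ->
  tame [set x | A (x - n)] (fun x => h (x - n) + b) (s + n).
Proof. by move=> [[l D] B]; split; [exists l; exact: sdiff_shift|exact: bvnear_shift]. Qed.

Lemma tame_sides A B (k0 k1 K : R -> R) (z l e : R) : 0 < e ->
  sdiff A k0 z l -> bvnear A k0 z -> sdiff B k1 z l -> bvnear B k1 z ->
  (forall x, x <= z -> z - x < e -> A x /\ K x = k0 x) ->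
  (forall x, z <= x -> x - z < e -> B x /\ K x = k1 x) -> tame setT K z.
Proof.
move=> e0 D0 B0 D1 B1 K0 K1.
have lo : exists2 d : R, 0 < d & forall x, belowA setT z x -> `|x - z| < d -> A x /\ K x = k0 x.
  by exists e => // x [_ xz]; rewrite distrC ger0_norm ?subr_ge0 //; exact: K0.
have hi : exists2 d : R, 0 < d & forall x, aboveA setT z x -> `|x - z| < d -> B x /\ K x = k1 x.
  by exists e => // x [_ xz]; rewrite ger0_norm ?subr_ge0 //; exact: K1.
have iT : is_interval [set: R] by [].
apply: (@tame_glue _ _ _ z l) => //.
- exact: sdiff_restrict lo D0.
- exact: sdiff_restrict hi D1.
- by apply: bvnear_restrict lo B0; exact: belowA_itv.
- by apply: bvnear_restrict hi B1; exact: aboveA_itv.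
Qed.

Lemma tame_join (k0 k1 K : R -> R) (n b0 b1 l e : R) : 0 < e ->
  sdiff (seg 0 1) k0 1 l -> bvnear (seg 0 1) k0 1 ->
  sdiff (seg 0 1) k1 0 l -> bvnear (seg 0 1) k1 0 ->
  (forall x, x <= n -> n - x < e -> K x = k0 (x - (n - 1)) + b0) ->
  (forall x, n <= x -> x - n < e -> K x = k1 (x - n) + b1) -> tame setT K n.
Proof.
move=> e0 D0 B0 D1 B1 K0 K1.
have D0' := sdiff_shift (n - 1) b0 D0; have B0' := bvnear_shift (n - 1) b0 B0.
have D1' := sdiff_shift n b1 D1; have B1' := bvnear_shift n b1 B1.
have En : 1 + (n - 1) = n by ring.
rewrite En in D0' B0'; rewrite add0r in D1' B1'.
have d0 : 0 < Num.min 1 e by rewrite lt_min ltr01.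
apply: (tame_sides d0 D0' B0' D1' B1') => x xn; rewrite lt_min => /andP[? ?].
- by split; [apply/andP; split; lra|exact: K0].
- by split; [apply/andP; split; lra|exact: K1].
Qed.

(* The quadratic map s (a + (1 - a) s) of [0, 1] has derivatives a and 2 - a at
   the ends; it serves to match the derivatives of a loop at its base point. *)
Definition quad (a s : R) := s * (a + (1 - a) * s).

Lemma quad_sdiff (a s : R) : 0 < a -> a < 2 -> 0 <= s -> s <= 1 ->
  sdiff (seg 0 1) (quad a) s (a + (1 - a) * (2 * s)).
Proof.
move=> a0 a2 s0 s1; split; first by nra.
move=> e e0; exists (e / 2); first by rewrite divr_gt0.
move=> x y [_ xs] [_ ys] xy; have -> : quad a y - quad a x - (a + (1 - a) * (2 * s)) * (y - x) =
  (1 - a) * ((x - s) + (y - s)) * (y - x) by rewrite /quad; ring.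
rewrite normrM (gtr0_norm (_ : 0 < y - x)) ?subr_gt0 //; apply: ler_wpM2r.
  by rewrite subr_ge0 ltW.
rewrite normrM; have h1 : `|1 - a| <= 1 by rewrite ler_norml; apply/andP; split; lra.
have h2 : `|x - s + (y - s)| <= e.
  by apply: le_trans (ler_normD _ _) _; lra.
by rewrite -[e]mul1r ler_pM.
Qed.

Lemma quad_bvnear (a s : R) : 0 < a -> a < 2 -> bvnear (seg 0 1) (quad a) s.
Proof.
(* w is the least derivative of [quad a] on [0, 1]. Its second derivative is at most 2 in absolute
   value, so 2 / w is a Lipschitz constant for the logarithm of the derivative. *)
move=> a0 a2; pose w := Num.min a (2 - a).
have w0 : 0 < w by rewrite lt_min a0; lra.
have [wa wb] : w <= a /\ w <= 2 - a by rewrite !ge_min !lexx orbT.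
exists 1 => //; exists (fun x => 2 / w * x); split.
  by move=> x y _ _ xy; rewrite ler_pM2l // divr_gt0.
move=> p q x y x' y' [/andP[p0 p1] _] [/andP[q0 q1] _] px xy yq px' xy' yq'.
have X0 : 0 < y - x by rewrite subr_gt0.
have X0' : 0 < y' - x' by rewrite subr_gt0.
have E u v : quad a v - quad a u = (a + (1 - a) * (u + v)) * (v - u) by rewrite /quad; ring.
rewrite !E; set t := a + (1 - a) * (x + y); set t' := a + (1 - a) * (x' + y').
have t'w : w <= t'.
  rewrite /t'; have [a1|a1] := leP a 1.
    have : 0 <= (1 - a) * (x' + y') by apply: mulr_ge0; lra.
    by lra.
  have : (a - 1) * (x' + y') <= (a - 1) * 2 by rewrite ler_wpM2l; lra.
  by lra.
have tt : t <= t' + 2 * (q - p).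
  have h1 : `|1 - a| <= 1 by rewrite ler_norml; apply/andP; split; lra.
  have h2 : `|(x + y) - (x' + y')| <= 2 * (q - p).
    by rewrite ler_norml; apply/andP; split; lra.
  have : `|(1 - a) * ((x + y) - (x' + y'))| <= 1 * (2 * (q - p)) by rewrite normrM ler_pM.
  by rewrite ler_norml => /andP[_]; rewrite /t /t'; lra.
rewrite -mulrBr; have e1 := expR_ge1Dx (2 / w * (q - p)).
have tE : t <= expR (2 / w * (q - p)) * t'.
  apply: le_trans (ler_wpM2r _ e1); last by lra.
  have pq : 0 <= q - p by lra.
  have : 2 / w * (q - p) * w <= 2 / w * (q - p) * t'.
    by rewrite ler_wpM2l // mulr_ge0 // divr_ge0 // ltW.
  have -> : 2 / w * (q - p) * w = 2 * (q - p) by field; exact: lt0r_neq0.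
  by lra.
have := ler_wpM2r (mulr_ge0 (ltW X0) (ltW X0')) tE; lra.
Qed.

Lemma quad_incr (a x y : R) : 0 < a -> a < 2 -> 0 <= x -> x < y -> y <= 1 -> quad a x < quad a y.
Proof.
move=> a0 a2 x0 xy y1; rewrite -subr_gt0.
have -> : quad a y - quad a x = (a + (1 - a) * (x + y)) * (y - x) by rewrite /quad; ring.
rewrite mulr_gt0 ?subr_gt0 //.
have [a1|a1] := leP a 1.
  have : 0 <= (1 - a) * (x + y) by apply: mulr_ge0; lra.
  by lra.
have : (a - 1) * (x + y) <= (a - 1) * 2 by rewrite ler_wpM2l; lra.
by lra.
Qed.

Lemma locally_increasing (k : R -> R) (a b : R) : a < b ->
  (forall s, a <= s -> s <= b -> exists2 d : R, 0 < d & forall x y, a <= x -> y <= b ->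
    `|x - s| < d -> `|y - s| < d -> x < y -> k x < k y) -> k a < k b.
Proof.
move=> ab loc; apply: (@local_to_global _ (fun p q => p < q -> k p < k q) a b) => //.
- exact: ltW.
- move=> p q r _ pq qr _ H1 H2 pr; move: pq qr; rewrite !le_eqVlt.
  move=> /orP[/eqP pq|pq] /orP[/eqP qr|qr].
  + by move: pr; rewrite pq qr ltxx.
  + by rewrite pq; exact: H2.
  + by rewrite -qr; exact: H1.
  + exact: lt_trans (H1 pq) (H2 qr).
- move=> s /andP[as_ sb]; have [d d0 H] := loc s as_ sb; exists d => // p q ap pq qb sp qs lpq.
  by apply: H => //; rewrite ltr_norml; apply/andP; split; lra.
Qed.

End RealMaps.

Section Lifts.
Variables (R : realType) (M : topologicalType).
Implicit Types (A B : set R) (g p : R -> M) (c d : chart R M) (f : M -> M).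

(** In charts p o F = f o g is tame and so is p, hence F is tame by division. *)
Lemma lift_tame (at_ : set (chart R M)) A B g p (F : R -> R) f s :
  is_interval A -> is_interval B -> A s ->
  regular at_ A g s -> regular at_ B p (F s) -> tame_map at_ f ->
  (forall e : R, 0 < e -> exists2 d : R, 0 < d & forall x, nbd A s d x -> B (F x) /\ `|F x - F s| < e) ->
  (forall x, A x -> p (F x) = f (g x)) -> tame A F s.
Proof.
move=> iA iB As [c ac [[e e0 Ce] tc]] [d ad [[k k0 Dk] td]] tf FC pF.
have Bs : B (F s) by have [j j0 /(_ s (nbd_center As j0))[]] := FC 1 ltr01.
apply: (tame_div iA iB As FC td).
have cs := Ce s (nbd_center As e0); have ds := Dk _ (nbd_center Bs k0).
have tl : tame (cimg c) (local_expr c d f) (chart_fun c (g s)).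
  by apply: tf => //; rewrite -pF.
have tcomp : tame A (local_expr c d f \o (chart_fun c \o g)) s.
  apply: (@tame_comp _ _ (cimg c)) tc tl => //; first exact: cimg_itv.
  by exists e => // x /Ce/cimg_fun.
apply: tame_restrict tcomp => //; exists e => // x Ax xe; split=> //.
by rewrite /local_expr /= chart_funK ?pF //; exact: Ce.
Qed.

Section Images.
Variable at_ : set (chart R M).
Hypothesis trans : tame_map at_ id.

Lemma regular_ivt c g (a b v : R) : at_ c -> a <= b ->
  (forall s, seg a b s -> regular at_ (seg a b) g s) ->
  (forall s, seg a b s -> chart_dom c (g s)) ->
  chart_fun c (g a) <= v -> v <= chart_fun c (g b) ->
  exists2 x, seg a b x & chart_fun c (g x) = v.
Proof.
move=> ac ab reg dom va vb.
have E : seg a b = [set` `[a, b]].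
  by apply/seteqP; split=> x; rewrite /seg /= in_itv.
have [||x xs xv] := @IVT _ (chart_fun c \o g) a b v ab.
- apply/subspace_continuousP => s; rewrite -E => ss.
  have [_ [[l sd] _]] := regular_chart trans (@seg_itv _ a b) ss (reg s ss) ac (dom s ss).
  apply/cvgrPdist_lt => e e0; have [d d0 D] := sdiff_cont ss sd e0.
  apply/nbhsRP; exists d => // z zs zA; rewrite distrC; exact: D.
- by rewrite ge_min le_max /= va vb orbT.
- by exists x => //; rewrite E.
Qed.

(* At an end of the parameter interval the image is still a neighbourhood if
   the chart ends there as well. *)
Lemma regular_nbhs c g (a b s : R) : at_ c -> seg a b s ->
  (forall s, seg a b s -> regular at_ (seg a b) g s) -> chart_dom c (g s) ->
  (a = s -> forall z, cimg c z -> chart_fun c (g s) <= z) ->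
  (s = b -> forall z, cimg c z -> z <= chart_fun c (g s)) ->
  nbhs (g s) (g @` seg a b).
Proof.
move=> ac ss reg cs mn mx.
have [[e e0 De] [[l sd] _]] := regular_chart trans (@seg_itv _ a b) ss (reg s ss) ac cs.
have [k k0 K] := sdiff_incr sd.
have [as_ sb] : a <= s /\ s <= b by apply/andP.
pose r := Num.min e k / 2.
have r0 : 0 < r by rewrite divr_gt0 // lt_min e0.
have [re rk] : r < e /\ r < k.
  have H x : 0 < x -> Num.min e k <= x -> r < x by move=> ? ?; rewrite /r; lra.
  by split; apply: H; rewrite // !ge_min lexx ?orbT.
pose p := Num.max a (s - r); pose q := Num.min b (s + r).
have [pa pr ps] : [/\ a <= p, s - r <= p & p <= s].
  by rewrite !le_max !lexx orbT ge_max as_; split=> //; lra.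
have [qb qr sq] : [/\ q <= b, q <= s + r & s <= q].
  by rewrite !ge_min !lexx orbT le_min sb; split=> //; lra.
have near x (m : R) : r < m -> seg p q x -> nbd (seg a b) s m x.
  move=> rm /andP[px xq]; split; first by apply/andP; split; lra.
  by rewrite ltr_norml; apply/andP; split; lra.
have pp : seg p q p by apply/andP; split=> //; lra.
have qq : seg p q q by apply/andP; split=> //; lra.
have sS : seg p q s by apply/andP.
(* At an end of the parameter interval the condition is void; there the chart itself ends, by [mn]
   or [mx]. *)
pose P1 : set R := [set v | a < s -> chart_fun c (g p) < v].
pose P2 : set R := [set v | s < b -> v < chart_fun c (g q)].
have N1 : nbhs (chart_fun c (g s)) P1.
  have [las|sa] := ltP a s; last by apply: filterS filterT => v _ h; move: sa; rewrite leNgt h.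
  have : chart_fun c (g p) < chart_fun c (g s).
    by apply: K; [exact: near|exact: near|rewrite gt_max las; lra].
  by move=> /lt_nbhsr; apply: filterS => v vs _.
have N2 : nbhs (chart_fun c (g s)) P2.
  have [las|sa] := ltP s b; last by apply: filterS filterT => v _ h; move: sa; rewrite leNgt h.
  have : chart_fun c (g s) < chart_fun c (g q).
    by apply: K; [exact: near|exact: near|rewrite lt_min las; lra].
  by move=> /lt_nbhsl; apply: filterS => v vs _.
apply: filterS (chart_fun_near cs (filterI N1 N2)) => m [cm [m1 m2]].
have := @regular_ivt c g p q (chart_fun c m) ac (le_trans ps sq).
case.
- exact: (sub_seg_regular pa qb reg).
- by move=> x /(near x e re)/De.
- move: as_; rewrite le_eqVlt => /orP[/eqP E|/m1/ltW //].
  have -> : p = s by apply/le_anti; rewrite ps -E pa.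
  by apply: mn => //; exact: cimg_fun.
- move: sb; rewrite le_eqVlt => /orP[/eqP E|/m2/ltW //].
  have -> : q = s by apply/le_anti; rewrite sq andbT E qb.
  by apply: mx => //; exact: cimg_fun.
move=> x sx xE; exists x.
  by case/andP: sx => ? ?; apply/andP; split; lra.
have /De cx := near x e re sx.
by rewrite -(chart_funK cx) xE chart_funK.
Qed.

End Images.

(* The line maps onto a component of M, as its universal covering for a circle
   and as the covering of its double for an interval. *)
Definition component_cover (at_ : set (chart R M)) p :=
  [/\ continuous p, forall x, nbhs (p x) (range p), forall x, p (x + 1) = p x,
    forall F : homeo R, per F -> (forall x, p (F x) = p x) ->
      exists k : int, forall x, F x = x + k%:~R &
    forall f, continuous f -> injective f -> tame_map at_ f -> f @` range p = range p ->
      exists F : homeo R, [/\ per F, forall s, tame setT F s & forall x, p (F x) = f (p x)]].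

Lemma periodic_extension (g : R -> M) : g 0 = g 1 ->
  exists p : R -> M, forall (n : int) x, 0 <= x -> x <= 1 -> p (x + n%:~R) = g x.
Proof.
move=> g01.
have /choice[fl Hfl] : forall x : R, exists n : int, 0 <= x - n%:~R < 1.
  by move=> x; have [n [y [-> y0 y1]]] := floor_frac x; exists n; rewrite addrK y0.
exists (fun x => g (x - (fl x)%:~R)) => n x x0.
have HE (m : int) y : 0 <= y -> y < 1 -> g (y + m%:~R - (fl (y + m%:~R))%:~R) = g y.
  move=> y0 y1; have /andP[z0 z1] := Hfl (y + m%:~R).
  have [|<- //] := int_frac_unique y0 y1 z0 z1 (n := m) (m := fl (y + m%:~R)).
  by rewrite subrK.
rewrite le_eqVlt => /orP[/eqP ->|x1]; last exact: HE.
have -> : 1 + n%:~R = 0 + (n + 1)%:~R :> R by rewrite intrD mulr1z; lra.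
by rewrite HE.
Qed.

Lemma periodic_int p (n : int) x : (forall x, p (x + 1) = p x) -> p (x + n%:~R) = p x.
Proof.
move=> pp; have H (k : nat) y : p (y + k%:~R) = p y.
  by elim: k => [|k IH]; rewrite ?addr0 // -addn1 PoszD intrD addrA pp.
case: n => k //; rewrite NegzE -(H k.+1 (x + _)) mulrNz.
by congr p; rewrite subrK.
Qed.

End Lifts.

Section Rigid.
Variable R : realType.
Implicit Types (F H : homeo R).

Lemma per_translation F (k : int) : per F -> F 0 = k%:~R ->
  (forall H, per H -> H 0 = 0 -> (forall x, exists n : int, H x = F x + n%:~R) ->
    forall x, 0 <= x -> x < 1 -> H x = x) ->
  forall x, F x = x + k%:~R.
Proof.
move=> pF F0 rig.
have [||H HE] := @homeo_of R (fun x => F x + (- k)%:~R).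
- by move=> x y xy; rewrite ltrD2r homeo_lt.
- move=> y; exists ((F^-1)%g (y + k%:~R)); rewrite homeoKV mulrNz addrK //.
have pH : per H by move=> x; rewrite !HE pF; ring.
have H0 : H 0 = 0 by rewrite HE F0 mulrNz subrr.
have {}rig := rig H pH H0 (fun x => ex_intro _ _ (HE x)).
have K x : H x = x by have [n [y [-> y0 y1]]] := floor_frac x; rewrite perZ // rig.
by move=> x; rewrite -[in RHS](K x) HE mulrNz subrK.
Qed.

Lemma quad_onto (a v : R) : 0 <= v -> v <= 1 -> exists2 s : R, seg 0 1 s & quad a s = v.
Proof.
move=> v0 v1; have [||s sS E] := @IVT R (quad a) 0 1 v ler01.
- apply: continuous_subspaceT => x; rewrite /quad.
  apply: cvgM; first exact: cvg_id.
  by apply: cvgD; [exact: cvg_cst|apply: cvgM; [exact: cvg_cst|exact: cvg_id]].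
- have -> : quad a 0 = 0 by rewrite /quad mul0r.
  have -> : quad a 1 = 1 by rewrite /quad; ring.
  by rewrite ge_min le_max v0 v1 orbT.
- by exists s.
Qed.

End Rigid.

(** * Coverings of circle components *)

Section Circle.
Variables (R : realType) (M : topologicalType) (hM : hausdorff_space M).
Variable at_ : set (chart R M).
Hypothesis trans : tame_map at_ id.

(* A reparametrization makes the two ends of the loop fit smoothly. *)
Lemma closed_loop g L : loop at_ g L -> exists h : R -> M,
  [/\ h 0 = h 1, image_of g L `<=` h @` seg 0 1,
    forall s, seg 0 1 s -> regular at_ (seg 0 1) h s,
    forall s t, 0 <= s -> s < 1 -> 0 <= t -> t < 1 -> h s = h t -> s = t
  & exists c, exists2 l, at_ c &
    [/\ exists2 e : R, 0 < e & forall x, nbd (seg 0 1) 0 e x \/ nbd (seg 0 1) 1 e x -> chart_dom c (h x),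
     sdiff (seg 0 1) (chart_fun c \o h) 0 l & sdiff (seg 0 1) (chart_fun c \o h) 1 l]].
Proof.
move=> [L0 reg g0L inj].
have S0 : seg 0 L 0 by rewrite /seg /= lexx ltW.
have SL : seg 0 L L by rewrite /seg /= lexx ltW.
have [c ac [[e e0 De] [[l0 D0] B0]]] := reg 0 S0.
have c0 := De 0 (nbd_center S0 e0).
have cL : chart_dom c (g L) by rewrite -g0L.
have [[e' e'0 De'] [[l1 D1] B1]] := regular_chart trans (@seg_itv _ 0 L) SL (reg L SL) ac cL.
have [l00 l10] : 0 < l0 /\ 0 < l1 by case: D0; case: D1.
(* The solution of l0 a = l1 (2 - a), which equates the two derivatives at the base point after
   reparametrization. *)
pose a := 2 * l1 / (l0 + l1).
have l01 : 0 < l0 + l1 by rewrite addr_gt0.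
have a0 : 0 < a by rewrite divr_gt0 // mulr_gt0.
have a2 : a < 2 by rewrite ltr_pdivrMr //; lra.
pose q s := L * quad a s + 0.
have q0 : q 0 = 0 by rewrite /q /quad mul0r mulr0 addr0.
have q1 : q 1 = L by rewrite /q /quad; ring.
have qlt s t : 0 <= s -> s < t -> t <= 1 -> q s < q t.
  by move=> s0 st t1; rewrite /q ltrD2r ltr_pM2l // quad_incr.
have qle s t : 0 <= s -> s <= t -> t <= 1 -> q s <= q t.
  by move=> s0; rewrite le_eqVlt => /orP[/eqP->//|st t1]; exact/ltW/qlt.
have qS s : seg 0 1 s -> seg 0 L (q s).
  by move=> /andP[s0 s1]; apply/andP; rewrite -{1}q0 -q1 !qle.
have q_near s : exists2 d : R, 0 < d & forall x, nbd (seg 0 1) s d x -> seg 0 L (q x).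
  by exists 1 => // x [/qS].
have sq s : seg 0 1 s -> sdiff (seg 0 1) q s (L * (a + (1 - a) * (2 * s))).
  move=> ss; have /andP[s0 s1] := ss.
  apply: (sdiff_comp (B := setT) (k := fun x => L * x + 0)) => //; first by exists 1.
    exact: quad_sdiff.
  exact: sdiff_affine.
have tq s : seg 0 1 s -> tame (seg 0 1) q s.
  move=> ss; have /andP[s0 s1] := ss.
  apply: (tame_comp (B := setT) (k := fun x => L * x + 0)) => //.
  - exact: seg_itv.
  - by exists 1.
  - by split; [exists (a + (1 - a) * (2 * s)); exact: quad_sdiff|exact: quad_bvnear].
  - exact: tame_affine.
have qcont s (k : R) : seg 0 1 s -> 0 < k -> exists2 d : R, 0 < d & forall x, nbd (seg 0 1) s d x -> nbd (seg 0 L) (q s) k (q x).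
  move=> ss k0; have [d d0 H] := sdiff_cont ss (sq s ss) k0; exists d => // x nx.
  by split; [apply: qS; case: nx|exact: H].
have s0 : seg 0 1 (0 : R) by rewrite /seg /= lexx ler01.
have s1 : seg 0 1 (1 : R) by rewrite /seg /= lexx ler01.
exists (g \o q); split.
- by rewrite /= q0 q1.
- move=> _ [t /andP[t0 tL] <-].
  have [||s ss E] := @quad_onto R a (t / L); first by rewrite divr_ge0 // ltW.
    by rewrite ler_pdivrMr // mul1r.
  exists s => //; rewrite /q /= E addr0; congr g; field; exact: lt0r_neq0.
- move=> s ss; have [d ad [[k k0 Dk] td]] := reg _ (qS s ss).
  have [j j0 J] := qcont s k ss k0; exists d => //; split.
    by exists j => // x /J/Dk.
  apply: (tame_comp (B := seg 0 L) (g := q) (k := chart_fun d \o g)) => //; try exact: seg_itv.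
  exact: tq.
- move=> s t ? ? ? ? /inj E.
  have H x : 0 <= x -> x < 1 -> 0 <= q x /\ q x < L.
    by move=> x0 x1; rewrite -{1}q0 -q1 qle ?qlt // ltW.
  have {E} E : q s = q t by apply: E; apply H.
  by case: (ltgtP s t) => // st; [have := @qlt s t|have := @qlt t s]; rewrite E ltxx => H'; exfalso; have := H'; lra.
- have [j j0 J] := qcont 0 e s0 e0; have [j' j'0 J'] := qcont 1 e' s1 e'0.
  rewrite q0 in J; rewrite q1 in J'.
  exists c, (l0 * (L * a)) => //; split.
  + exists (Num.min j j'); first by rewrite lt_min j0.
    move=> x [] nx.
      by apply: De; apply: J; apply: nbdS nx _; rewrite ge_min lexx.
    by apply: De'; apply: J'; apply: nbdS nx _; rewrite ge_min lexx orbT.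
  + have -> : L * a = L * (a + (1 - a) * (2 * 0)) by ring.
    apply: (sdiff_comp (B := seg 0 L) (g := q) (k := chart_fun c \o g)) => //; first exact: sq.
    by rewrite q0.
  + have -> : l0 * (L * a) = l1 * (L * (a + (1 - a) * (2 * 1))).
      by rewrite /a; field; exact: lt0r_neq0.
    apply: (sdiff_comp (B := seg 0 L) (g := q) (k := chart_fun c \o g)) => //; first exact: sq.
    by rewrite q1.
Qed.

End Circle.

Section CircleCover.
Variables (R : realType) (M : topologicalType) (hM : hausdorff_space M).
Variable at_ : set (chart R M).
Hypothesis trans : tame_map at_ id.
Implicit Types (h p : R -> M) (f : M -> M).

Lemma intr_small (k : int) : (k%:~R : R) < 1 -> -1 < (k%:~R : R) -> k = 0.
Proof.
have -> : 1 = 1%:~R :> R by [].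
by rewrite -mulrNz !ltr_int; lia.
Qed.

Lemma regular_setT_sub p A s : is_interval A -> regular at_ setT p s -> regular at_ A p s.
Proof. by move=> iA; apply: regular_restrict => //; exists 1. Qed.

Lemma periodic_regular h p : (forall s, seg 0 1 s -> regular at_ (seg 0 1) h s) ->
  (exists c, exists2 l, at_ c &
    [/\ exists2 e : R, 0 < e & forall x, nbd (seg 0 1) 0 e x \/ nbd (seg 0 1) 1 e x -> chart_dom c (h x),
     sdiff (seg 0 1) (chart_fun c \o h) 0 l & sdiff (seg 0 1) (chart_fun c \o h) 1 l]) ->
  (forall (n : int) x, 0 <= x -> x <= 1 -> p (x + n%:~R) = h x) ->
  forall s, regular at_ setT p s.
Proof.
move=> reg [c [l ac [[e e0 De] D0 D1]]] pE s.
have S0 : seg 0 1 (0 : R) by rewrite /seg /= lexx ler01.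
have S1 : seg 0 1 (1 : R) by rewrite /seg /= lexx ler01.
have pE' (n : int) x : n%:~R <= x -> x <= n%:~R + 1 -> p x = h (x - n%:~R).
  by move=> ? ?; rewrite -[in LHS](subrK n%:~R x) pE //; lra.
have [n [y [-> y0 y1]]] := floor_frac s.
move: y0; rewrite le_eqVlt => /orP[/eqP <-|y0]; last first.
  have [d ad [[k k0 Dk] td]] := reg y (introT andP (conj (ltW y0) (ltW y1))).
  have inside x : `|x - (y + n%:~R)| < Num.min k (Num.min y (1 - y)) ->
      nbd (seg 0 1) y k (x - n%:~R) /\ p x = h (x - n%:~R).
    have E : x - (y + n%:~R) = x - n%:~R - y by ring.
    rewrite E !lt_min => /andP[xk]; rewrite !ltr_norml => /andP[/andP[x1 x2] /andP[x3 x4]].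
    have [u0 u1] : 0 <= x - n%:~R /\ x - n%:~R <= 1 by split; lra.
    split; first by split=> //; apply/andP.
    by rewrite -[in LHS](subrK n%:~R x) pE.
  have m0 : 0 < Num.min k (Num.min y (1 - y)) by rewrite !lt_min k0 y0 subr_gt0.
  exists d => //; split.
    by exists (Num.min k (Num.min y (1 - y))) => // x [_ /inside[/Dk dx ->]].
  apply: tame_restrict (tame_shift n%:~R 0 td) => //.
  exists (Num.min k (Num.min y (1 - y))) => // x _ /inside[[xS _] xE].
  by split=> //=; rewrite xE addr0.
rewrite add0r.
have Enm : (n - 1)%:~R = n%:~R - 1 :> R by rewrite intrB mulr1z.
have lo x : x <= n%:~R -> n%:~R - x < 1 -> p x = h (x - (n%:~R - 1)).
  by move=> ? ?; rewrite (pE' (n - 1)) Enm //; lra.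
have hi x : n%:~R <= x -> x - n%:~R < 1 -> p x = h (x - n%:~R).
  by move=> ? ?; apply: pE'; lra.
have c0 : chart_dom c (h 0) by apply: De; left; exact: nbd_center.
have c1 : chart_dom c (h 1) by apply: De; right; exact: nbd_center.
have [_ [_ B0]] := regular_chart trans (@seg_itv _ 0 1) S0 (reg 0 S0) ac c0.
have [_ [_ B1]] := regular_chart trans (@seg_itv _ 0 1) S1 (reg 1 S1) ac c1.
exists c => //; split.
  exists (Num.min e 1); first by rewrite lt_min e0 ltr01.
  move=> x [_]; rewrite lt_min !ltr_norml => /andP[/andP[x1 x2] /andP[x3 x4]].
  have [xn|nx] := leP x n%:~R.
    rewrite lo //; last lra; apply: De; right; split; first by apply/andP; split; lra.
    by rewrite ltr_norml; apply/andP; split; lra.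
  rewrite hi //; try lra; apply: De; left; split; first by apply/andP; split; lra.
  by rewrite ltr_norml; apply/andP; split; lra.
apply: (tame_join (k0 := chart_fun c \o h) (k1 := chart_fun c \o h) (b0 := 0) (b1 := 0) ltr01 D1 B1 D0 B0).
- by move=> x xn nx /=; rewrite lo // addr0.
- by move=> x xn nx /=; rewrite hi // addr0.
Qed.

Lemma regular_range_nbhs p : (forall s, regular at_ setT p s) -> forall x, nbhs (p x) (range p).
Proof.
move=> rp x; have [c ac [[e e0 De] _]] := rp x.
have cx : chart_dom c (p x) by apply: De; exact: nbd_center.
have N : nbhs (p x) (p @` seg (x - 1) (x + 1)).
  apply: (regular_nbhs trans ac _ _ cx).
  - by apply/andP; split; lra.
  - by move=> s _; apply: regular_setT_sub => //; exact: seg_itv.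
  - by move=> E; exfalso; lra.
  - by move=> E; exfalso; lra.
by apply: filterS N => _ [y _ <-]; exists y.
Qed.

Lemma regular_continuous p : (forall s, regular at_ setT p s) -> continuous p.
Proof.
move=> rp x O /(regular_cont I (rp x))[e e0 H].
by apply/nbhs_ballP; exists e => // z; rewrite /ball /= distrC => zx; apply: H.
Qed.

(** Choose y0 over f (p 0) and, for 0 <= x < 1, the unique point of [y0, y0 + 1) over f (p x). This
    is continuous inside (0, 1) as p is a local homeomorphism, hence tame and increasing there, and
    extends periodically. *)
Lemma circle_lift p f : (forall s, regular at_ setT p s) -> (forall x, p (x + 1) = p x) ->
  (forall x y, p x = p y -> exists k : int, x = y + k%:~R) ->
  continuous f -> injective f -> tame_map at_ f -> f @` range p = range p ->
  exists F : homeo R, [/\ per F, forall s, tame setT F s & forall x, p (F x) = f (p x)].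
Proof.
move=> rp pp pinj cf injf tf onf.
have pint (n : int) x : p (x + n%:~R) = p x by exact: periodic_int.
have pin x : range p (p x) by exists x.
have [y0 py0] : exists y, p y = f (p 0).
  have : (f @` range p) (f (p 0)) by exists (p 0).
  by rewrite onf => -[y _ E]; exists y.
have inj01 (u x y : R) : u <= x -> x < u + 1 -> u <= y -> y < u + 1 -> p x = p y -> x = y.
  move=> x0 x1 y0' y1 /pinj[k E].
  by rewrite E (@intr_small k) ?addr0; lra.
have /choice[G0 G0P] : forall x, exists y, [/\ y0 <= y, y < y0 + 1 & p y = f (p x)].
  move=> x; have : (f @` range p) (f (p x)) by exists (p x).
  rewrite onf => -[y _ Ey]; have [k /andP[k0 k1]] := int_translate y y0.
  by exists (y + k%:~R); rewrite pint.
pose G x := if x < 1 then G0 x else y0 + 1.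
have GE x : x < 1 -> G x = G0 x by rewrite /G => ->.
have G1 : G 1 = y0 + 1 by rewrite /G ltxx.
have G0E : G 0 = y0.
  rewrite GE //; have [a1 a2 a3] := G0P 0; apply: (inj01 y0) => //; last by rewrite a3.
  by lra.
have pG x : 0 <= x -> x <= 1 -> p (G x) = f (p x).
  move=> x0; rewrite le_eqVlt => /orP[/eqP ->|x1]; last by rewrite GE //; case: (G0P x).
  by rewrite G1 pp py0 -[1]add0r pp.
have Gin x : 0 < x -> x < 1 -> y0 < G x /\ G x < y0 + 1.
  move=> x0 x1; rewrite GE //; have [a b c] := G0P x; split=> //.
  rewrite lt_neqAle a andbT; apply/eqP => E; move: c; rewrite -E py0 => /injf/pinj[k Ek].
  have k0 : k = 0 by apply: intr_small; lra.
  by move: x0; rewrite Ek k0 addr0 ltxx.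
pose A : set R := [set x | 0 < x /\ x < 1].
have iA : is_interval A.
  by move=> x y [? ?] [? ?] z /andP[? ?]; split; lra.
have reg01 s : seg y0 (y0 + 1) s -> regular at_ (seg y0 (y0 + 1)) p s.
  by move=> _; apply: regular_setT_sub => //; exact: seg_itv.
have tG s : A s -> tame A G s.
  move=> [s0 s1]; have [g0 g1] := Gin s s0 s1.
  apply: (lift_tame (B := setT) (g := p) (p := p) (f := f)) => //.
  - exact: regular_setT_sub.
  - move=> e e0.
    have uniq z : seg y0 (y0 + 1) z -> p z = p (G s) -> z = G s.
      move=> /andP[z0]; rewrite le_eqVlt => /orP[/eqP ->|z1]; last first.
        by apply: (inj01 y0) => //; exact: ltW.
      rewrite pp => E; suff yG : y0 = G s by move: g0; rewrite -yG ltxx.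
      by apply: (inj01 y0) => //; [rewrite ltrDl|exact: ltW].
    have N := regular_inverse hM reg01 uniq e0; rewrite pG ?ltW // in N.
    have cfp : {for p s, continuous f} by exact: cf.
    have [d d0 D] := regular_cont I (rp s) (cfp _ N).
    exists d => // x [[x0 x1] xd]; split=> //; have [gx0 gx1] := Gin x x0 x1.
    apply: (D x); first by split.
      by apply/andP; split; exact: ltW.
    by apply: pG; exact: ltW.
  - by move=> x [x0 x1]; apply: pG; exact: ltW.
have incA x y : 0 < x -> x < y -> y < 1 -> G x < G y.
  move=> x0 xy y1; apply: locally_increasing => // s xs sy.
  have As : A s by split; lra.
  have [[l sd] _] := tG s As; have [d d0 D] := sdiff_incr sd; exists d => // u v xu vy us vs uv.
  by apply: D => //; split=> //; split; lra.
have incG x y : 0 <= x -> x < y -> y <= 1 -> G x < G y.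
  rewrite le_eqVlt => /orP[/eqP <-|x0] xy; rewrite le_eqVlt => /orP[/eqP yE|y1].
  - by rewrite G0E yE G1; lra.
  - by rewrite G0E; have [] := Gin y xy y1.
  - by rewrite yE G1; have [] := Gin x x0; [lra|].
  - exact: incA.
have [|F [pF FE]] := periodic_homeo incG G0E G1.
  move=> y y_0 y_1; have : range p (p y) by [].
  rewrite -onf => -[_ [x _ <-] Ex].
  have [n [u [xE u0 u1]]] := floor_frac x; exists u; split=> //.
  rewrite GE //; have [a b cE] := G0P u; apply: (inj01 y0) => //.
  by rewrite cE -Ex xE pint.
have pFE x : p (F x) = f (p x).
  by have [n [u [-> u0 u1]]] := floor_frac x; rewrite FE ?(ltW u1) // !pint pG // ltW.
exists F; split=> // s.
apply: (lift_tame (B := setT) (g := p) (p := p) (f := f)) => //.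
move=> e e0; have [d d0 D] := homeo_cont F s e0; exists d => // x [_ xd]; split=> //; exact: D.
Qed.

Lemma circle_cover g L : loop at_ g L ->
  exists p, component_cover at_ p /\ image_of g L `<=` range p.
Proof.
move=> /(closed_loop trans)[h [h01 im reg inj ends]].
have [p pE] := periodic_extension h01; exists p.
have rp := periodic_regular reg ends pE.
have pp x : p (x + 1) = p x.
  have [n [y [-> y0 y1]]] := floor_frac x.
  have -> : y + n%:~R + 1 = y + (n + 1)%:~R by rewrite intrD mulr1z addrA.
  by rewrite !pE // ltW.
have pinj x y : p x = p y -> exists k : int, x = y + k%:~R.
  have [n [u [-> u0 u1]]] := floor_frac x; have [m [v [-> v0 v1]]] := floor_frac y.
  rewrite !pE ?(ltW u1) ?(ltW v1) // => /inj -> //; exists (n - m).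
  by rewrite intrB; ring.
split; last first.
  move=> _ /im[t /andP[t0 t1] <-]; exists t => //.
  by rewrite -[t]addr0 -[0](mulr0z 1) pE // mulr0z addr0.
split=> //.
- exact: regular_continuous.
- exact: regular_range_nbhs.
- move=> F pF pFE; have [k Fk] := pinj _ _ (pFE 0).
  exists k; rewrite add0r in Fk; apply: per_translation => // H pH H0 HF x x0 x1.
  have [n HE] := HF x; have pH1 : p (H x) = p x by rewrite HE periodic_int // pFE.
  have [j jE] := pinj _ _ pH1.
  have Hx0 : 0 <= H x by rewrite -H0 homeo_le.
  have Hx1 : H x < 1 by rewrite -[1]add0r -H0 -pH add0r homeo_lt.
  by rewrite jE (@intr_small j) ?addr0; lra.
- by move=> f cf injf tf onf; exact: circle_lift.
Qed.

End CircleCover.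

(** * Coverings of interval components by doubling *)

Section Fold.
Variable R : realType.

(** [fold] is the distance to the nearest integer. It folds the line onto [0, 1/2] and plays the
    role of the covering map for the double of an interval. *)
Lemma fold_exists : exists fold : R -> R, forall x,
  (exists k : int, fold x = `|x - k%:~R|) /\ forall k : int, fold x <= `|x - k%:~R|.
Proof.
suff /choice[fold H] : forall x : R, exists t, (exists k : int, t = `|x - k%:~R|) /\
    forall k : int, t <= `|x - k%:~R| by exists fold.
move=> x; have [n [y [-> y0 y1]]] := floor_frac x.
have E1 : `|y + n%:~R - n%:~R| = y by rewrite addrK ger0_norm.
have E2 : `|y + n%:~R - (n + 1)%:~R| = 1 - y.
  have -> : y + n%:~R - (n + 1)%:~R = - (1 - y) by rewrite intrD mulr1z; ring.
  by rewrite normrN ger0_norm //; lra.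
exists (Num.min y (1 - y)); split.
  by case: leP => _; [exists n|exists (n + 1)].
move=> k; rewrite ge_min; have [kn|nk] := leP k n.
  apply/orP; left; have : (k%:~R : R) <= n%:~R by rewrite ler_int.
  by move=> kn'; rewrite ger0_norm; lra.
apply/orP; right; have : (n + 1)%:~R <= (k%:~R : R) by rewrite ler_int lezD1.
by rewrite intrD mulr1z => kn'; rewrite ler0_norm; lra.
Qed.

Variable fold : R -> R.
Hypothesis foldP : forall x,
  (exists k : int, fold x = `|x - k%:~R|) /\ forall k : int, fold x <= `|x - k%:~R|.

Lemma fold_ge0 x : 0 <= fold x.
Proof. by have [[k ->] _] := foldP x. Qed.

Lemma fold_half x : fold x <= 1 / 2.
Proof.
have [n [y [E y0 y1]]] := floor_frac x.
have [_ H] := foldP x; have := H n; have := H (n + 1).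
rewrite E addrK (ger0_norm y0).
have -> : y + n%:~R - (n + 1)%:~R = - (1 - y) by rewrite intrD mulr1z; ring.
by rewrite normrN ger0_norm; lra.
Qed.

Lemma fold_lip x y : `|fold x - fold y| <= `|x - y|.
Proof.
have H u v : fold u - fold v <= `|u - v|.
  have [[k Ek] _] := foldP v; have [_ /(_ k) ku] := foldP u; rewrite Ek.
  have : `|u - k%:~R| <= `|u - v| + `|v - k%:~R| by exact: ler_distD.
  by lra.
by rewrite ler_norml lerNl opprB distrC H distrC H.
Qed.

Lemma fold_int n x : fold (x + n%:~R) = fold x.
Proof.
have H u m : fold (u + m%:~R) <= fold u.
  have [[k ->] _] := foldP u; have [_ /(_ (k + m))] := foldP (u + m%:~R).
  by rewrite intrD (_ : u + m%:~R - (k%:~R + m%:~R) = u - k%:~R) //; ring.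
apply/le_anti; rewrite H /=; have := H (x + n%:~R) (- n).
by rewrite mulrNz addrK.
Qed.

Lemma fold_opp x : fold (- x) = fold x.
Proof.
have H u : fold (- u) <= fold u.
  have [[k ->] _] := foldP u; have [_ /(_ (- k))] := foldP (- u).
  by rewrite mulrNz -opprD normrN.
by apply/le_anti; rewrite H /=; have := H (- x); rewrite opprK.
Qed.

Lemma fold_id x : 0 <= x -> x <= 1 / 2 -> fold x = x.
Proof.
move=> x0 x1; have [[k E] H] := foldP x.
apply/le_anti; have := H 0; rewrite subr0 (ger0_norm x0) => -> /=; rewrite E.
have [k0|k0] := leP k 0.
  have : (k%:~R : R) <= 0 by rewrite lerz0.
  by move=> ?; apply: le_trans (ler_norm _); lra.
have : (1%:~R : R) <= k%:~R by rewrite ler_int.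
by rewrite mulr1z => ?; rewrite ler0_norm; lra.
Qed.

Lemma fold_compl x : 1 / 2 <= x -> x <= 1 -> fold x = 1 - x.
Proof.
move=> x0 x1; rewrite -fold_opp -(fold_int 1) mulr1z addrC fold_id //; lra.
Qed.

Lemma fold_eq x y : fold x = fold y ->
  exists k : int, x = y + k%:~R \/ x = - y + k%:~R.
Proof.
have [[k ->] _] := foldP x; have [[j ->] _] := foldP y.
move=> /eqP; rewrite eqr_norm2 => /orP[] /eqP E.
  by exists (k - j); left; rewrite intrB; lra.
by exists (k + j); right; rewrite intrD; lra.
Qed.

(** Only x and 1 - x are possible values of H x. They agree at 1/2, so 1/2 is fixed, and the
    monotonicity of H excludes 1 - x elsewhere. *)
Lemma fold_homeo_id (H : homeo R) : per H -> H 0 = 0 ->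
  (forall x, fold (H x) = fold x) -> forall x, 0 <= x -> x < 1 -> H x = x.
Proof.
move=> pH H0 HF.
have alt x : 0 <= x -> x < 1 -> H x = x \/ H x = 1 - x.
  move=> x0 x1; have Hx0 : 0 <= H x by rewrite -H0 homeo_le.
  have Hx1 : H x < 1 by rewrite -[1]add0r -H0 -pH add0r homeo_lt.
  have [k [E|E]] := fold_eq (HF x).
    by left; rewrite E (@intr_small R k) ?addr0; lra.
  move: x0; rewrite le_eqVlt => /orP[/eqP<-|x0]; first by left.
  right; have E1 : (k - 1)%:~R = k%:~R - 1 :> R by rewrite intrB mulr1z.
  have k1 : k - 1 = 0 by apply: (@intr_small R); rewrite E1; lra.
  by move: E1; rewrite k1 mulr0z E; lra.
have Hh : H (1 / 2) = 1 / 2 by case: (alt (1 / 2)); lra.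
move=> x x0 x1; have [//|E] := alt x x0 x1.
case: (ltgtP x (1 / 2)) => [xh|hx|->//].
- by have : H x < H (1 / 2); [rewrite homeo_lt|rewrite Hh; lra].
- by have : H (1 / 2) < H x; [rewrite homeo_lt|rewrite Hh; lra].
Qed.

(** F is k on [0, 1/2], continued by reflection in the points of (1/2)Z. At these points F is tame
    because the one-sided derivatives agree by symmetry. *)
Lemma double_homeo (k : R -> R) : (forall s, seg 0 (1 / 2) s -> tame (seg 0 (1 / 2)) k s) ->
  (forall x y, 0 <= x -> x < y -> y <= 1 / 2 -> k x < k y) -> k 0 = 0 -> k (1 / 2) = 1 / 2 ->
  (forall y, 0 <= y -> y <= 1 / 2 -> exists2 x, seg 0 (1 / 2) x & k x = y) ->
  exists F : homeo R, [/\ per F, forall s, tame setT F s & forall x, fold (F x) = k (fold x)].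
Proof.
move=> tk inck k0 kh onk.
pose G y := if y <= 1 / 2 then k y else 1 - k (1 - y).
have Glo y : y <= 1 / 2 -> G y = k y by rewrite /G => ->.
have Ghi y : 1 / 2 <= y -> G y = 1 - k (1 - y).
  rewrite /G le_eqVlt => /orP[/eqP <-|hy]; last by rewrite leNgt hy.
  have -> : 1 - 1 / 2 = 1 / 2 :> R by field.
  by rewrite lexx kh; field.
have klo y : 0 <= y -> y < 1 / 2 -> k y < 1 / 2.
  by move=> y0 yh; have := inck y (1 / 2) y0 yh (lexx _); rewrite kh.
have kge y : 0 <= y -> y <= 1 / 2 -> 0 <= k y /\ k y <= 1 / 2.
  move=> y0 yh; split.
    move: y0; rewrite le_eqVlt => /orP[/eqP<-|y0]; first by rewrite k0.
    by have := inck 0 y (lexx _) y0 yh; rewrite k0; lra.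
  move: yh; rewrite le_eqVlt => /orP[/eqP->|yh]; first by rewrite kh.
  by apply: ltW; exact: klo.
have incG x y : 0 <= x -> x < y -> y <= 1 -> G x < G y.
  move=> x0 xy y1; have [xh|hx] := leP x (1 / 2); last first.
    rewrite !Ghi; try lra.
    have : k (1 - y) < k (1 - x) by apply: inck; lra.
    by lra.
  have [yh|hy] := leP y (1 / 2); first by rewrite !Glo //; exact: inck.
  rewrite Glo // Ghi; last lra.
  have [_ ?] := kge x x0 xh; have : k (1 - y) < 1 / 2 by apply: klo; lra.
  by lra.
have G0 : G 0 = 0 by rewrite Glo ?k0 //; lra.
have G1 : G 1 = 0 + 1 by rewrite Ghi ?subrr ?k0; lra.
have [|F [pF FE]] := periodic_homeo incG G0 G1.
  move=> y y0; rewrite add0r => y1; have [yh|hy] := leP y (1 / 2).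
    have [x /andP[x0 xh] E] := onk y y0 yh; by exists x; split; [|lra|rewrite Glo].
  have [||x /andP[x0 xh] E] := onk (1 - y); try lra.
  have xn0 : x != 0 by apply/eqP => x00; move: E; rewrite x00 k0; lra.
  have x00 : 0 < x by rewrite lt_neqAle eq_sym xn0.
  exists (1 - x); split; try lra.
  by rewrite Ghi; [rewrite subKr E subKr|lra].
have Flo (n : int) x : n%:~R <= x -> x <= n%:~R + 1 / 2 -> F x = k (x - n%:~R) + n%:~R.
  by move=> ? ?; rewrite -[in LHS](subrK n%:~R x) FE; [rewrite Glo //; lra|lra|lra].
have Fhi (n : int) x : n%:~R - 1 / 2 <= x -> x <= n%:~R -> F x = - k (- (x - n%:~R)) + n%:~R.
  move=> h1 h2; have E : (n - 1)%:~R = n%:~R - 1 :> R by rewrite intrB mulr1z.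
  rewrite -[in LHS](subrK (n - 1)%:~R x) FE E; [|lra|lra].
  rewrite Ghi; last lra.
  have -> : 1 - (x - (n%:~R - 1)) = - (x - n%:~R) by ring.
  by ring.
exists F; split=> //; last first.
  move=> x; have [n [y [-> y0 y1]]] := floor_frac x.
  rewrite FE ?(ltW y1) // !fold_int; have [yh|hy] := leP y (1 / 2).
    by rewrite Glo // (fold_id y0 yh) fold_id //; have [] := kge y y0 yh.
  rewrite Ghi ?ltW // (fold_compl (ltW hy) (ltW y1)).
  by have [] := kge (1 - y); [lra|lra|move=> ? ?; rewrite fold_compl; lra].
have S0 : seg 0 (1 / 2) (0 : R) by apply/andP; split; lra.
have Sh : seg 0 (1 / 2) (1 / 2 : R) by apply/andP; split; lra.
move=> s; have [n [y [-> y0 y1]]] := floor_frac s.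
have h0 : 0 < 1 / 2 :> R by lra.
have En : (n + 1)%:~R = n%:~R + 1 :> R by rewrite intrD mulr1z.
case: (ltgtP y (1 / 2)) => [yh|hy|->].
- move: y0; rewrite le_eqVlt => /orP[/eqP<-|y0].
    have [[l D] B] := tk 0 S0.
    have D1 := sdiff_shift n%:~R n%:~R D; have B1 := bvnear_shift n%:~R n%:~R B.
    have D0 := sdiff_shift n%:~R n%:~R (sdiff_mirror D); have B0 := bvnear_shift n%:~R n%:~R (bvnear_mirror B).
    rewrite oppr0 in D0 B0; rewrite add0r in D0 B0 D1 B1 *.
    apply: (tame_sides h0 D0 B0 D1 B1) => x u1 u2.
      by split; [apply/andP|rewrite (Fhi n) //]; move: u1 u2; clear; lra.
    by split; [apply/andP|rewrite (Flo n) //]; move: u1 u2; clear; lra.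
  have Sy : seg 0 (1 / 2) y by apply/andP; split; exact: ltW.
  apply: tame_restrict (tame_shift n%:~R n%:~R (tk y Sy)) => //.
  exists (Num.min y (1 / 2 - y)); first by rewrite lt_min y0 subr_gt0.
  move=> x _; rewrite lt_min !ltr_norml => /andP[/andP[x1 x2] /andP[x3 x4]].
  by split; [apply/andP|rewrite (Flo n) //]; move: x1 x2 x3 x4; clear; lra.
- have Sy : seg 0 (1 / 2) (1 - y) by apply/andP; split; lra.
  have E : - (1 - y) + (n%:~R + 1) = y + n%:~R by ring.
  have T := tame_shift (n%:~R + 1) (n%:~R + 1) (tame_mirror (tk _ Sy)); rewrite E in T.
  apply: tame_restrict T => //.
  exists (Num.min (y - 1 / 2) (1 - y)); first by rewrite lt_min !subr_gt0 hy.
  move=> x _; rewrite lt_min !ltr_norml => /andP[/andP[x1 x2] /andP[x3 x4]].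
  by split; [apply/andP|rewrite (Fhi (n + 1)) En //]; move: x1 x2 x3 x4; clear; lra.
- have [[l D] B] := tk _ Sh.
  have D0 := sdiff_shift n%:~R n%:~R D; have B0 := bvnear_shift n%:~R n%:~R B.
  have E : - (1 / 2) + (n%:~R + 1) = 1 / 2 + n%:~R :> R by field.
  have D1 := sdiff_shift (n%:~R + 1) (n%:~R + 1) (sdiff_mirror D).
  have B1 := bvnear_shift (n%:~R + 1) (n%:~R + 1) (bvnear_mirror B).
  rewrite E in D1 B1; apply: (tame_sides h0 D0 B0 D1 B1) => x u1 u2.
    by split; [apply/andP|rewrite (Flo n) //]; move: u1 u2; clear; lra.
  by split; [apply/andP|rewrite (Fhi (n + 1)) En //]; move: u1 u2; clear; lra.
Qed.

End Fold.

Section IntervalCover.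
Variables (R : realType) (M : topologicalType) (hM : hausdorff_space M).
Variable at_ : set (chart R M).
Hypothesis trans : tame_map at_ id.
Implicit Types (g p : R -> M) (f : M -> M).

Lemma arc_rescale g L K : 0 < K -> arc at_ g L ->
  arc at_ (fun x => g (L / K * x + 0)) K /\
  image_of (fun x => g (L / K * x + 0)) K = image_of g L.
Proof.
move=> K0 [L0 reg inj]; set a := L / K.
have a0 : 0 < a by rewrite divr_gt0.
have aK : a * K = L by rewrite /a; field; exact: lt0r_neq0.
have aS x : seg 0 K x -> seg 0 L (a * x + 0).
  by move=> /andP[x0 xK]; rewrite /seg /= addr0 mulr_ge0 ?(ltW a0) //= -aK ler_pM2l.
split; last first.
  apply/seteqP; split=> _ [x xS <-]; first by exists (a * x + 0) => //; exact: aS.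
  exists (x / a); last by congr g; field; exact: lt0r_neq0.
  case/andP: xS => x0 xL; rewrite /seg /= divr_ge0 ?(ltW a0) //=.
  by rewrite ler_pdivrMr // mulrC aK.
split=> //; last first.
  by move=> s t /aS ss /aS tt /(inj _ _ ss tt)/addIr; apply: mulfI; exact: lt0r_neq0.
move=> s ss; have [c ac [[e e0 De] tc]] := reg _ (aS s ss).
have [d d0 D] := sdiff_cont ss (sdiff_affine (seg 0 K) 0 s a0) e0.
exists c => //; split.
  by exists d => // x xs; apply: De; split; [apply: aS; case: xs|exact: D].
apply: (tame_comp (B := seg 0 L) (g := fun x => a * x + 0) (k := chart_fun c \o g)) => //; try exact: seg_itv.
- by exists 1 => // x [/aS].
- exact: tame_affine.
Qed.

Section Half.
Variable g : R -> M.
Hypothesis ag : arc at_ g (1 / 2).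
Let reg s : seg 0 (1 / 2) s -> regular at_ (seg 0 (1 / 2)) g s. Proof. by case: ag => _ + _; exact. Qed.
Let inj s t : seg 0 (1 / 2) s -> seg 0 (1 / 2) t -> g s = g t -> s = t.
Proof. by case: ag => _ _; exact. Qed.

Lemma interval_lift f : continuous f -> injective f -> tame_map at_ f ->
  f @` image_of g (1 / 2) = image_of g (1 / 2) -> exists k : R -> R,
  [/\ forall s, seg 0 (1 / 2) s -> tame (seg 0 (1 / 2)) k s,
    forall x y, 0 <= x -> x < y -> y <= 1 / 2 -> k x < k y, k 0 = 0 /\ k (1 / 2) = 1 / 2,
    forall y, 0 <= y -> y <= 1 / 2 -> exists2 x, seg 0 (1 / 2) x & k x = y
    & forall s, seg 0 (1 / 2) s -> g (k s) = f (g s)].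
Proof.
move=> cf injf tf onf; set I := seg 0 (1 / 2).
have /choice[k kP] : forall s, exists t, I s -> I t /\ g t = f (g s).
  move=> s; have [ss|ns] := pselect (I s); last by exists 0.
  have : (f @` image_of g (1 / 2)) (f (g s)) by exists (g s) => //; exists s.
  by rewrite onf => -[t tI E]; exists t.
have kI s : I s -> I (k s) by move=> /kP[].
have gk s : I s -> g (k s) = f (g s) by move=> /kP[].
have iI : is_interval I by exact: seg_itv.
have tk s : I s -> tame I k s.
  move=> ss; apply: (lift_tame (B := I) (g := g) (p := g) (f := f)) => //.
  - exact: reg.
  - by apply: reg; exact: kI.
  - exact: tf.
  - move=> e e0.
    have uniq z : I z -> g z = g (k s) -> z = k s by move=> zI; apply: inj => //; exact: kI.
    have N := regular_inverse hM reg uniq e0; rewrite gk // in N.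
    have cfp : {for g s, continuous f} by exact: cf.
    have [d d0 D] := regular_cont ss (reg ss) (cfp _ N).
    exists d => // x xs; have xI : I x by case: xs.
    by split; [exact: kI|apply: (D x xs); [exact: kI|exact: gk]].
have inck x y : 0 <= x -> x < y -> y <= 1 / 2 -> k x < k y.
  move=> x0 xy y1; apply: locally_increasing => // s xs sy.
  have ss : I s by apply/andP; split; lra.
  have [[l sd] _] := tk s ss; have [d d0 D] := sdiff_incr sd; exists d => // u v xu vy us vs uv.
  by apply: D => //; split=> //; apply/andP; split; lra.
have onk y : 0 <= y -> y <= 1 / 2 -> exists2 x, I x & k x = y.
  move=> y0 y1; have yI : I y by apply/andP.
  have : image_of g (1 / 2) (g y) by exists y.
  rewrite -onf => -[_ [x xI <-] E]; exists x => //.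
  by apply: inj => //; [exact: kI|rewrite gk].
have I0 : I 0 by apply/andP; split; lra.
have Ih : I (1 / 2) by apply/andP; split; lra.
have h0 : 0 <= 1 / 2 :> R by lra.
exists k; split=> //; split.
- have [x /andP[x0 xh] E] := onk 0 (lexx _) h0.
  move: x0; rewrite le_eqVlt => /orP[/eqP xE|x0]; first by move: E; rewrite -xE.
  by have := inck 0 x (lexx _) x0 xh; have /andP[? ?] := kI 0 I0; lra.
- have [x /andP[x0 xh] E] := onk (1 / 2) h0 (lexx _).
  move: xh; rewrite le_eqVlt => /orP[/eqP xE|xh]; first by move: E; rewrite xE.
  by have := inck x (1 / 2) x0 xh (lexx _); have /andP[? ?] := kI _ Ih; lra.
Qed.

Lemma half_cover : right_end at_ g (1 / 2) -> left_end at_ g ->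
  exists p, component_cover at_ p /\ range p = image_of g (1 / 2).
Proof.
move=> re le; have [fold foldP] := fold_exists R.
have foldI x : seg 0 (1 / 2) (fold x) by apply/andP; rewrite fold_ge0 ?fold_half.
have foldE x : 0 <= x -> x <= 1 / 2 -> fold x = x by exact: fold_id.
pose p x := g (fold x).
have rE : range p = image_of g (1 / 2).
  apply/seteqP; split=> _ [x xI <-]; first by exists (fold x).
  by exists x => //; rewrite /p foldE //; case/andP: xI.
have pinj x y : p x = p y -> fold x = fold y by exact: inj.
have fper x : fold (x + 1) = fold x by rewrite -(mulr1z (1 : R)) fold_int.
exists p; split=> //; split.
- move=> x O NO; have [e e0 D] := regular_cont (foldI x) (reg (foldI x)) NO.
  apply/nbhs_ballP; exists e => // z; rewrite /ball /= => zx; apply: D; split=> //.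
  by apply: le_lt_trans zx; rewrite distrC; exact: fold_lip.
- move=> x; rewrite rE; have fI := foldI x.
  have h0 : 0 < 1 / 2 :> R by lra.
  have : exists c, [/\ at_ c, chart_dom c (p x),
      0 = fold x -> forall z, cimg c z -> chart_fun c (p x) <= z &
      fold x = 1 / 2 -> forall z, cimg c z -> z <= chart_fun c (p x)].
    have [E|n0] := pselect (0 = fold x).
      have [c ac [cg H]] := le; rewrite /p -E; exists c; split=> // Eh.
      by move: h0; rewrite -Eh ltxx.
    have [E|nh] := pselect (fold x = 1 / 2).
      by have [c ac [cg H]] := re; rewrite /p E; exists c; split=> // Eh; move: h0; rewrite -Eh ltxx.
    have [c ac [[e e0 De] _]] := reg fI.
    by exists c; split=> //; apply: De; exact: nbd_center.
  move=> [c [ac cx H0 Hh]].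
  exact: (regular_nbhs trans ac fI).
- by move=> x; rewrite /p fper.
- move=> F pF pFE.
  have f00 : fold 0 = 0 by apply: foldE; lra.
  have [k Fk] : exists k : int, F 0 = k%:~R.
    have [k [E|E]] := fold_eq foldP (pinj _ _ (pFE 0)); exists k.
      by rewrite E add0r.
    by rewrite E oppr0 add0r.
  exists k; apply: per_translation => // H pH H0 HF.
  apply: (fold_homeo_id foldP) => // x; have [n ->] := HF x.
  by rewrite fold_int //; exact: pinj.
- move=> f cf injf tf; rewrite rE => onf.
  have [k [tk inck [k0 kh] onk gk]] := interval_lift cf injf tf onf.
  have [F [pF tF FE]] := double_homeo foldP tk inck k0 kh onk.
  by exists F; split=> // x; rewrite /p FE gk.
Qed.

End Half.

Lemma interval_cover g L : arc at_ g L -> right_end at_ g L -> left_end at_ g ->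
  exists p, component_cover at_ p /\ image_of g L `<=` range p.
Proof.
move=> ag re le; have h0 : 0 < 1 / 2 :> R by lra.
have [ag' imE] := arc_rescale h0 ag.
have EL : L / (1 / 2) * (1 / 2) + 0 = L by rewrite addr0; field.
have [||p [cp rp]] := half_cover ag'.
- by case: re => c ac H; exists c => //; rewrite EL.
- by case: le => c ac H; exists c => //; rewrite mulr0 addr0.
by exists p; split=> //; rewrite rp imE.
Qed.

End IntervalCover.

Section Components.
Variables (R : realType) (M : topologicalType) (hM : hausdorff_space M).
Hypothesis cM : compact [set: M].

Lemma component_cover_exists (atl : set (chart R M)) x0 :
  (forall p, exists2 c, atl c & chart_dom c p) -> tame_map atl id ->
  exists p : R -> M, component_cover atl p /\ range p x0.
Proof.
move=> cover tid.
have [[g [L [ag gx re le]]]|[a [g [L [aE lg gx]]]]] := classification hM cM x0 cover tid.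
  by have [p [cp sub]] := interval_cover hM tid ag re le; exists p; split=> //; exact: sub.
case: aE lg => -> lg.
  by have [p [cp sub]] := circle_cover hM tid lg; exists p; split=> //; exact: sub.
(* The atlas enters [component_cover] through [tame_map] alone, and a tame map for [atl] is tame for
   the mirrored atlas. *)
have [p [[cp np pp rig lift] sub]] := circle_cover hM (tame_map_mirror tid) lg.
exists p; split; last exact: sub.
by split=> // f cf injf /tame_map_mirror; exact: lift.
Qed.

End Components.

(** * The action on all components *)

Section Commutation.
Variable R : realType.
Implicit Types (A B F : homeo R).

Lemma per_displacement F y : per F -> F 0 - 1 < F y - y /\ F y - y <= F 0 + 1.
Proof.
move=> pF; have [n [u [-> u0 u1]]] := floor_frac y.
have h1 : F 0 <= F u by rewrite homeo_le.
have h2 : F u <= F 0 + 1 by rewrite -pF add0r homeo_le ltW.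
by rewrite perZ //; split; lra.
Qed.

(* A B^n = T^(nk) B^n A for the unit translation T, while per A and per B bound
   the distance between A B^n 0 and B^n A 0 independently of n. *)
Lemma commutation_defect A B (k : int) : per A -> per B ->
  (forall x, A (B x) = B (A x) + k%:~R) -> k = 0.
Proof.
move=> pA pB E.
have EX n x : A ((B ^+ n)%g x) = (B ^+ n)%g (A x) + (k *+ n)%:~R.
  elim: n x => [|n IH] x; first by rewrite addr0.
  by rewrite !expgS !homeoM E IH perZ // mulrS intrD; ring.
(* The third power is enough: the distance in question is less than 3, so |3 k| < 3. *)
have [a1 a2] := per_displacement ((B ^+ 3)%g 0) pA.
have [j /andP[j1 j2]] := int_translate (A 0) 0.
have pB3 := perX 3 pB.
have b1 : (B ^+ 3)%g 0 <= (B ^+ 3)%g (A 0 + j%:~R) by rewrite homeo_le.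
have b2 : (B ^+ 3)%g (A 0 + j%:~R) <= (B ^+ 3)%g 0 + 1.
  by rewrite -pB3 homeo_le; lra.
rewrite perZ // in b1 b2; rewrite EX in a1 a2.
have h1 : (k *+ 3)%:~R < 3%:~R :> R by rewrite (_ : 3%:~R = 3 :> R) //; lra.
have h2 : (-3)%:~R < (k *+ 3)%:~R :> R by rewrite mulrNz (_ : 3%:~R = 3 :> R) //; lra.
by move: h1 h2; rewrite !ltr_int; clear; lia.
Qed.

End Commutation.

(** * Lifting the action over one component *)

Section Action.
Variables (R : realType) (M : topologicalType) (hM : hausdorff_space M).
Variable atl : set (chart R M).
Variables (G : groupType) (phi : G -> M -> M).
Hypotheses (phi1 : forall x, phi 1%g x = x).
Hypothesis phiM : forall g h x, phi (g * h)%g x = phi g (phi h x).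
Hypotheses (phic : forall g, continuous (phi g)) (phit : forall g, tame_map atl (phi g)).
Implicit Types (g h : G) (p : R -> M).

Lemma phiK g x : phi (g^-1)%g (phi g x) = x.
Proof. by rewrite -phiM mulVg phi1. Qed.

Lemma phiKV g x : phi g (phi (g^-1)%g x) = x.
Proof. by rewrite -phiM mulgV phi1. Qed.

Lemma phi_inj g : injective (phi g).
Proof. exact: can_inj (phiK g). Qed.

Definition stab p g := forall x, range p (phi g (p x)).
Definition trivial_on p g := forall x, phi g (p x) = p x.

Lemma stabM p g h : stab p g -> stab p h -> stab p (g * h)%g.
Proof. by move=> sg sh x; rewrite phiM; have [y _ <-] := sh x. Qed.

Lemma stab1 p : stab p 1%g.
Proof. by move=> x; rewrite phi1; exists x. Qed.

Lemma trivialV p g : trivial_on p g -> trivial_on p (g^-1)%g.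
Proof. by move=> tg x; rewrite -{1}(tg x) phiK. Qed.

Lemma trivial_commg p g h : trivial_on p g -> stab p h -> stab p (h^-1)%g ->
  trivial_on p (g * h * (g^-1 * h^-1))%g.
Proof.
move=> tg sh sV x; rewrite !phiM.
have [y _ yE] := sV x; rewrite -yE (trivialV tg) yE phiKV; exact: tg.
Qed.

Lemma trivial_commg' p g h : trivial_on p h -> stab p (g^-1)%g ->
  trivial_on p (g * h * (g^-1 * h^-1))%g.
Proof.
move=> th sV x; rewrite !phiM (trivialV th).
by have [y _ yE] := sV x; rewrite -yE th yE phiKV.
Qed.

Lemma trivial_conj p f g : trivial_on p g -> stab p (f^-1)%g ->
  trivial_on p (f * g * f^-1)%g.
Proof.
by move=> tg sV x; rewrite !phiM; have [y _ yE] := sV x; rewrite -yE tg yE phiKV.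
Qed.

(** The range of q is open, and closed as a compact image of [0, 1]; the line is connected. *)
Lemma component_stays p q (f : M -> M) x0 : component_cover atl p -> component_cover atl q ->
  continuous f -> range q (f (p x0)) -> forall x, range q (f (p x)).
Proof.
move=> [cp _ _ _ _] [cq nq pq _ _] cf f0.
have qE : range q = q @` seg 0 1.
  apply/seteqP; split=> _ [x _ <-]; last by exists x.
  have [n [y [-> y0 y1]]] := floor_frac x.
  by exists y; [apply/andP; split=> //; exact: ltW|rewrite periodic_int].
have clq : closed (range q).
  rewrite qE; have -> : seg 0 1 = [set` `[(0 : R), 1]].
    by apply/seteqP; split=> x; rewrite /seg /= in_itv.
  apply: compact_closed => //; apply: continuous_compact; last exact: segment_compact.
  exact: continuous_subspaceT.
have opq : open (range q).
  rewrite openE => _ [x _ <-]; exact: nq.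
have cfp : continuous (f \o p) by move=> x; apply: continuous_comp; [exact: cp|exact: cf].
have conn : connected [set: R].
  by apply/connected_intervalP => x y _ _ z _.
pose B := [set x | range q (f (p x))].
have BE : B = setT.
  apply: conn; first by exists x0.
  - exists B; last by rewrite setTI.
    exact: (open_comp (f := f \o p)).
  - exists B; last by rewrite setTI.
    exact: (closed_comp (f := f \o p)).
by move=> x; have : B x by rewrite BE.
Qed.

Section Component.
Variable p : R -> M.
Hypothesis cp : component_cover atl p.

Lemma stab_point g x : range p (phi g (p x)) -> stab p g.
Proof. by move=> px y; exact: (component_stays cp cp (@phic g) px). Qed.

Lemma stabV g : stab p g -> stab p (g^-1)%g.
Proof.
by move=> sg; have [x _ xE] := sg 0; apply: (@stab_point _ x); rewrite xE phiK; exists 0.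
Qed.

Lemma stab_ev u v t w : stab p u -> stab p v -> stab p t -> stab p (ev u v t w).
Proof.
move=> su sv st; elim: w => //= [|w1 h1 w2 h2|w1 h1]; first exact: stab1.
- exact: stabM.
- exact: stabV.
Qed.

Definition lift_of (F : homeo R) g := forall x, p (F x) = phi g (p x).
Definition lifts (F : homeo R) := per F /\ exists g, lift_of F g.

Lemma lift_ofM F H g h : lift_of F g -> lift_of H h -> lift_of (F * H)%g (g * h)%g.
Proof. by move=> Fg Hh x; rewrite homeoM Fg Hh phiM. Qed.

Lemma lift_of1 : lift_of 1%g 1%g.
Proof. by move=> x; rewrite homeo1 phi1. Qed.

Lemma lift_ofV F g : lift_of F g -> lift_of (F^-1)%g (g^-1)%g.
Proof. by move=> Fg x; rewrite -{2}(homeoKV F x) Fg phiK. Qed.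

Lemma lift_ofX F g n : lift_of F g -> lift_of (F ^+ n)%g (g ^+ n)%g.
Proof.
by move=> Fg; elim: n => [|n IH]; rewrite ?expg0 ?expgS; [exact: lift_of1|exact: lift_ofM Fg IH].
Qed.

Lemma lift_of_ev U V T u v t w : lift_of U u -> lift_of V v -> lift_of T t ->
  lift_of (ev U V T w) (ev u v t w).
Proof.
move=> hU hV hT; elim: w => //= [w1 h1 w2 h2|w1 h1].
- exact: lift_ofM h1 h2.
- exact: lift_ofV h1.
Qed.

Lemma lift_unique F H g : per F -> per H -> lift_of F g -> lift_of H g ->
  exists k : int, forall x, F x = H x + k%:~R.
Proof.
move=> pF pH Fg Hg; have [_ _ _ rig _] := cp.
have [|k kE] := rig (F * H^-1)%g (perM pF (perV pH)).
  by move=> x; have := lift_ofM Fg (lift_ofV Hg) x; rewrite mulgV phi1.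
by exists k => x; have := kE (H x); rewrite homeoM homeoK.
Qed.

(** The covering provides one tame lift, and any other periodic lift of the same element differs
    from it by an integer translation. *)
Lemma lift_tameT F : lifts F -> forall s, tame setT F s.
Proof.
move=> [pF [g Fg]] s; have [_ _ _ _ lift] := cp.
have sg : stab p g by apply: (@stab_point _ 0); rewrite -Fg; exists (F 0).
have sV := stabV sg.
have [|H [pH tH Hg]] := lift (phi g) (@phic g) (@phi_inj g) (@phit g).
  apply/seteqP; split=> [_ [_ [x _ <-] <-]|_ [x _ <-]]; first exact: sg.
  by exists (phi (g^-1)%g (p x)); [exact: sV|exact: phiKV].
have [k kE] := lift_unique pF pH Fg Hg.
have := tame_shift 0 k%:~R (tH s); rewrite addr0; apply: tame_restrict => //.
by exists 1 => // x _ _; rewrite subr0 kE.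
Qed.

Lemma lift_exists g : stab p g -> exists2 F, per F & lift_of F g.
Proof.
move=> sg; have sV := stabV sg; have [_ _ _ _ lift] := cp.
have [|H [pH tH Hg]] := lift (phi g) (@phic g) (@phi_inj g) (@phit g); last by exists H.
apply/seteqP; split=> [_ [_ [x _ <-] <-]|_ [x _ <-]]; first exact: sg.
by exists (phi (g^-1)%g (p x)); [exact: sV|exact: phiKV].
Qed.

(** Uniqueness of lifts gives commutation up to an integer translation, and this integer vanishes by
    [commutation_defect]. *)
Lemma lifts_commute A B a b : per A -> per B -> lift_of A a -> lift_of B b ->
  commute a b -> commute A B.
Proof.
move=> pA pB Aa Bb ab; have AB := lift_ofM Aa Bb; rewrite ab in AB.
have [k kE] := lift_unique (perM pA pB) (perM pB pA) AB (lift_ofM Bb Aa).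
have k0 := commutation_defect pA pB kE.
by apply: homeoP => x; rewrite kE k0 addr0.
Qed.

Definition good (F : homeo R) := (exists z, F z = z) \/ aperiodic F.
Definition tamed g n := exists F, [/\ per F, lift_of F (g ^+ n)%g & good F].

Lemma tamed_mul g n k : (0 < k)%N -> tamed g n -> tamed g (n * k)%N.
Proof.
move=> k0 [F [pF Fg gF]]; exists (F ^+ k)%g; split; [exact: perX| |].
  by rewrite expgM; exact: lift_ofX.
case: gF => [[z zE]|ap]; [left|right]; first by exists z; exact: homeoX_fix.
by move=> j z m j0; rewrite -expgM; apply: ap; rewrite muln_gt0 k0.
Qed.

(** If a lift F is not aperiodic, say F^j z = z + k, then F^j - k lifts a power of g and fixes z. *)
Lemma tamed_exists g n : (0 < n)%N -> stab p (g ^+ n)%g -> exists2 k, (0 < k)%N & tamed g k.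
Proof.
move=> n0 /lift_exists[F pF Fg].
have [ap|nap] := pselect (aperiodic F); first by exists n => //; exists F; split=> //; right.
have [j [z [k [j0 jE]]]] : exists j z (k : int), (0 < j)%N /\ (F ^+ j)%g z = z + k%:~R.
  apply: contrapT => H; apply: nap => j z k j0 jE; apply: H; by exists j, z, k.
have [||H HE] := @homeo_of R (fun x => (F ^+ j)%g x + (- k)%:~R).
- by move=> x y xy; rewrite ltrD2r homeo_lt.
- by move=> y; exists ((F ^+ j)^-1 (y + k%:~R))%g; rewrite homeoKV mulrNz addrK.
exists (n * j)%N; first by rewrite muln_gt0 n0.
have pFj := perX j pF; exists H; split.
- by move=> x; rewrite !HE pFj; ring.
- move=> x; have [_ _ pp _ _] := cp.
  by rewrite HE periodic_int // expgM (lift_ofX j Fg).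
- by left; exists z; rewrite HE jE mulrNz addrK.
Qed.

Lemma component_word (a b c d : G) m : tamed a m -> tamed b m -> tamed c m -> tamed d m ->
  commute a b -> commute b c ->
  let g x := (x ^+ m)%g in
  [/\ stab p (g a), stab p (g b), stab p (g c) & stab p (g d)] /\
  exists2 w, rho w != 1%g & trivial_on p (ev (g b) (g a * g c * ((g a)^-1 * (g c)^-1)) (g d) w)%g.
Proof.
move=> [A [pA Aa gA]] [B [pB Bb gB]] [C [pC Cc gC]] [D [pD Dd _]] ab bc g.
have st F x : lift_of F (g x) -> stab p (g x).
  by move=> Fx; apply: (@stab_point _ 0); rewrite -Fx; exists (F 0).
split; first by split; [exact: st Aa|exact: st Bb|exact: st Cc|exact: st Dd].
have L F x : per F -> lift_of F (g x) -> lifts F by move=> pF Fx; split=> //; exists (g x).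
have TM F H : lifts F -> lifts H -> lifts (F * H)%g.
  by move=> [pF [x Fx]] [pH [y Hy]]; split; [exact: perM|exists (x * y)%g; exact: lift_ofM].
have T1 : lifts 1%g by split; [exact: per1|exists 1%g; exact: lift_of1].
have TV F : lifts F -> lifts (F^-1)%g.
  by move=> [pF [x Fx]]; split; [exact: perV|exists (x^-1)%g; exact: lift_ofV].
have Tper F : lifts F -> per F by case.
have Tbv F : lifts F -> bv F by move=> /lift_tameT; exact: tame_bv.
have Tsd F s : lifts F -> exists l, sdiff setT F s l by move=> /lift_tameT/(_ s)[].
have AB := lifts_commute pA pB Aa Bb (commuteX2 m m ab).
have BC := lifts_commute pB pC Bb Cc (commuteX2 m m bc).
have [w rw wE] := trivial_word TM T1 TV Tper Tbv Tsd (L _ _ pA Aa) (L _ _ pB Bb) (L _ _ pC Cc)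
  (L _ _ pD Dd) AB BC gA gB gC.
exists w => // x.
have Vv := lift_ofM (lift_ofM Aa Cc) (lift_ofM (lift_ofV Aa) (lift_ofV Cc)).
by have := lift_of_ev w Bb Vv Dd x; rewrite wE homeo1.
Qed.

End Component.
End Action.

(** * A word trivial on all components *)

Section Global.
Variables (R : realType) (M : topologicalType) (hM : hausdorff_space M).
Hypothesis cM : compact [set: M].
Variable atl : set (chart R M).
Hypotheses (cover : forall p, exists2 c, atl c & chart_dom c p) (tid : tame_map atl id).
Variables (G : groupType) (phi : G -> M -> M).
Hypotheses (phi1 : forall x, phi 1%g x = x).
Hypothesis phiM : forall g h x, phi (g * h)%g x = phi g (phi h x).
Hypotheses (phic : forall g, continuous (phi g)) (phit : forall g, tame_map atl (phi g)).

Lemma finite_components : exists (D : seq M) (P : M -> R -> M),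
  (forall d, component_cover atl (P d)) /\ forall q, exists2 d, d \in D & range (P d) q.
Proof.
have /choice[P PP] := fun x => component_cover_exists hM cM x cover tid.
have oP d : open (range (P d)).
  by rewrite openE => _ [x _ <-]; have [[_ + _ _ _] _] := PP d; exact.
have [|D DP] := compact_finite_cover cM oP; first by move=> d; case: (PP d).
by exists D, P; split=> // d; case: (PP d).
Qed.

Variables (D : seq M) (P : M -> R -> M).
Hypotheses (Pc : forall d, component_cover atl (P d)).
Hypothesis DC : forall q, exists2 d, d \in D & range (P d) q.

(** By the pigeonhole principle two points of the orbit of p 0 under g lie in the same one of
    finitely many components. *)
Lemma stab_power p g : component_cover atl p -> exists2 n, (0 < n)%N & stab phi p (g ^+ n)%g.
Proof.
move=> cp; have /choice[c cP] : forall q, exists d, d \in D /\ range (P d) q.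
  by move=> q; have [d dD dq] := DC q; exists d.
pose s := [seq c (phi (g ^+ k)%g (p 0)) | k <- iota 0 (size D).+1].
have szs : size s = (size D).+1 by rewrite size_map size_iota.
have : ~~ uniq s.
  apply/negP => us; have : (size s <= size D)%N.
    by apply: uniq_leq_size us _ => _ /mapP[k _ ->]; case: (cP (phi (g ^+ k)%g (p 0))).
  by rewrite szs ltnn.
move=> /(uniqPn (p 0))[i [j [ij js]]].
rewrite szs in js; have is_ := ltn_trans ij js.
rewrite !(nth_map 0%N) ?size_iota // !nth_iota // !add0n => E.
have [_ ri] := cP (phi (g ^+ i)%g (p 0)); have [_ rj] := cP (phi (g ^+ j)%g (p 0)).
rewrite -E in rj; case: ri => [x _ xE].
have H := @component_stays _ _ hM atl _ p (phi ((g ^+ i)^-1)%g) x (Pc (c (phi (g ^+ i)%g (p 0)))) cp (@phic _).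
have [y _ yE] := rj.
have {}H : range p (phi ((g ^+ i)^-1)%g (P (c (phi (g ^+ i)%g (p 0))) y)).
  by apply: H; rewrite xE -phiM mulVg phi1; exists 0.
exists (j - i)%N; first by rewrite subn_gt0.
apply: (stab_point hM phic cp (x := 0)).
rewrite yE -phiM -(subnKC (ltnW ij)) expgD mulKg in H.
exact: H.
Qed.

Lemma common_power (l : seq G) : exists2 m, (0 < m)%N &
  forall d x, d \in D -> x \in l -> tamed phi (P d) x m.
Proof.
have [m m0 H] : exists2 m, (0 < m)%N &
    forall q, q \in [seq (d, x) | d <- D, x <- l] -> tamed phi (P q.1) q.2 m.
  elim: [seq _ | _ <- _, _ <- _] => [|[d x] s [m m0 IH]]; first by exists 1%N.
  have [n n0 sn] := stab_power x (Pc d).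
  have [k k0 tk] := tamed_exists hM phi1 phiM phic phit (Pc d) n0 sn.
  exists (k * m)%N; first by rewrite muln_gt0 k0.
  move=> q; rewrite inE => /orP[/eqP-> /=|/IH qm]; first exact: tamed_mul.
  by rewrite mulnC; exact: tamed_mul.
by exists m => // d x dD xl; apply: (H (d, x)); apply/allpairsP; exists (d, x).
Qed.

Lemma combine_words u v t w1 w2 (D1 D2 : seq M) :
  (forall d, d \in D1 ++ D2 -> [/\ stab phi (P d) u, stab phi (P d) v & stab phi (P d) t]) ->
  rho w1 != 1%g -> rho w2 != 1%g ->
  (forall d, d \in D1 -> trivial_on phi (P d) (ev u v t w1)) ->
  (forall d, d \in D2 -> trivial_on phi (P d) (ev u v t w2)) ->
  exists2 w, rho w != 1%g & forall d, d \in D1 ++ D2 -> trivial_on phi (P d) (ev u v t w).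
Proof.
move=> st r1 r2 t1 t2.
have [f fA nc] := alt5_conj_noncomm (rho_Alt w1) (rho_Alt w2) r1 r2.
have [wf wfE] := rho_surj fA.
exists (wcomm w1 (wconj wf w2)); first by move: nc; rewrite -wfE.
move=> d dD; have [su sv st'] := st d dD.
have sE w : stab phi (P d) (ev u v t w) by apply: (stab_ev hM phi1 phiM phic (Pc d)).
move: dD; rewrite mem_cat => /orP[/t1 td|/t2 td].
  apply: (trivial_commg phi1 phiM td); first exact: (sE (wconj wf w2)).
  exact: (sE (WI (wconj wf w2))).
apply: (trivial_commg' phi1 phiM) (sE (WI w1)).
exact: (trivial_conj phi1 phiM td (sE (WI wf))).
Qed.

Lemma global_word (a b c d : G) : commute a b -> commute b c ->
  exists m w, [/\ (0 < m)%N, rho w != 1%g & let g (x : G) := (x ^+ m)%g in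
    forall x, phi (ev (g b) (g a * g c * ((g a)^-1 * (g c)^-1)) (g d) w)%g x = x].
Proof.
move=> ab bc; have [m m0 H] := common_power [:: a; b; c; d].
pose g (x : G) := (x ^+ m)%g; pose v := (g a * g c * ((g a)^-1 * (g c)^-1))%g.
have comp i : i \in D -> [/\ stab phi (P i) (g b), stab phi (P i) v & stab phi (P i) (g d)] /\
    exists2 w, rho w != 1%g & trivial_on phi (P i) (ev (g b) v (g d) w).
  move=> iD; have T x : x \in [:: a; b; c; d] -> tamed phi (P i) x m by exact: H.
  have [Ta Tb Tc Td] : [/\ tamed phi (P i) a m, tamed phi (P i) b m, tamed phi (P i) c m
      & tamed phi (P i) d m] by split; apply: T; rewrite !inE eqxx ?orbT.
  have [[sa sb sc sd] ?] := component_word hM phi1 phiM phic phit (Pc i) Ta Tb Tc Td ab bc.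
  split=> //; split=> //.
  have sV := @stabV _ _ hM _ _ _ phi1 phiM phic _ (Pc i).
  by apply: (stabM phiM); apply: (stabM phiM) => //; exact: sV.
have [w rw wE] : exists2 w, rho w != 1%g &
    forall i, i \in D -> trivial_on phi (P i) (ev (g b) v (g d) w).
  elim: D comp => [_|i s IH comp].
    by exists WU => //; exact: (perm5_neq1 lperm_sx).
  have [|w2 r2 t2] := IH; first by move=> j js; apply: comp; rewrite inE js orbT.
  have [_ [w1 r1 t1]] := comp i (mem_head i s).
  have := @combine_words (g b) v (g d) w1 w2 [:: i] s; apply=> //.
    by move=> j js; case: (comp j js).
  by move=> j; rewrite inE => /eqP ->.
by exists m, w; split=> // ? x; have [i iD [y _ <-]] := DC x; exact: wE.
Qed.

End Global.

Lemma raag_gen_commute (V : finType) (e : rel V) (x y : V) : e x y ->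
  commute (raag_gen e x) (raag_gen e y).
Proof.
move=> xy; pose cls (u : raag_word V) : raag e := (\pi_(raag e) u)%qT.
have clsM u v : (cls u * cls v)%g = cls (u ++ v) by exact: raag_mulE.
have inv z : ((raag_gen e z)^-1)%g = cls [:: (z, true)].
  apply: (mulgI (raag_gen e z)); rewrite mulgV; apply/esym.
  by rewrite [LHS]clsM; apply/raag_piP; exact: raag_eq_cancel.
have E : ((raag_gen e x)^-1 * (raag_gen e y)^-1 * (raag_gen e x * raag_gen e y) = 1)%g.
  rewrite !inv [X in (X * _)%g]clsM [X in (_ * X)%g]clsM clsM.
  by apply/raag_piP; exact: raag_eq_comm.
apply: (mulgI ((raag_gen e x)^-1 * (raag_gen e y)^-1)%g); rewrite E.
by rewrite -mulgA mulKg mulVg.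
Qed.

Theorem corollary1p5 (R : realType) (M : topologicalType)
    (X : one_manifold R M) (Mcompact : compact [set: M]%classic)
    (V : finType) (e : rel V) (Gamma_simple : simple_graph e) :
  embeds_in_Diff_1bv (raag e) X -> P4_free e.
Proof.
move=> [phi [phiD phiC phi_inj']] A [f [h fK hK] fE].
have hM := mfd_hausdorff X.
have diffK g : bijective (phi g) by have [[_ [k [gk kg _]]] _ _] := phiD g; exists k.
have phiM g1 g2 x : phi (g1 * g2)%g x = phi g1 (phi g2 x) by rewrite phiC.
have phi1 x : phi 1%g x = x.
  by apply: (bij_inj (diffK 1%g)); rewrite -phiM mulg1.
have phic g : continuous (phi g) by have [[[]]] := phiD g.
have phit g : tame_map (atlas X) (phi g).
  move=> c d p ac ad cp dp; have [[[_ C1] _] inc BV] := phiD g.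
  by apply: local_expr_tame => //; [exact: C1|exact: inc|exact: BV].
(* Coordinate changes are local expressions of [phi 1], the identity, and thus share the regularity
   of the group. *)
have tid : tame_map (atlas X) id.
  have <- // : phi 1%g = id by apply: funext.
have [D [P [Pc DC]]] := finite_components hM Mcompact (@atlas_cover _ _ X) tid.
pose v (i : 'I_4) : V := val (h i).
have vE i j : e (v i) (v j) = path_graph 4 i j.
  by rewrite -[i in RHS]hK -[j in RHS]hK fE.
have v_inj : injective v by move=> i j /val_inj/(can_inj hK).
pose i0 : 'I_4 := @Ordinal 4 0 isT; pose i1 : 'I_4 := @Ordinal 4 1 isT.
pose i2 : 'I_4 := @Ordinal 4 2 isT; pose i3 : 'I_4 := @Ordinal 4 3 isT.
have ab : commute (raag_gen e (v i0)) (raag_gen e (v i1)) by apply: raag_gen_commute; rewrite vE.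
have bc : commute (raag_gen e (v i1)) (raag_gen e (v i2)) by apply: raag_gen_commute; rewrite vE.
have [m [w [m0 /eqP rw wE]]] :=
  global_word hM phi1 phiM phic phit Pc DC (raag_gen e (v i3)) ab bc.
apply: rw; apply: (@raag_word_trivial V e (v i0) (v i1) (v i2) (v i3) m) => //.
- by rewrite -[X in uniq X]/(map v [:: i0; i1; i2; i3]) map_inj_uniq.
- by rewrite vE.
- by rewrite vE.
- by rewrite vE.
apply: phi_inj'; apply: funext => x; rewrite phi1; exact: wE.
Qed.
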